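(* Let $c\in(1,9/8)$ be fixed, and let $D_c(\lambda,\xi)$ be the discrepancy defined in the context. Then for every $\varepsilon>0$ we have \[ D_c(\lambda,\xi)\lesssim_\varepsilon\lambda^{3/c-1-(9-8c)/(5c)+\varepsilon},\qquad \lambda\in\{1,2,\dots\},\quad \xi\in\mathbb S^2, \] where the implicit constant is uniform in $\lambda$ and $\xi$.
   Context: $\mathbb S^2$ is the Euclidean unit sphere in $\mathbb R^3$. For $x\in\mathbb R^3$, $|x|_c:=(|x_1|^c+|x_2|^c+|x_3|^c)^{1/c}$, and $\mathbb S_c^2:=\{x\in\mathbb R^3:|x|_c=1\}$. $\mu_c$ denotes the unique Borel measure on $\mathbb S_c^2$ such that for every $f\ge0$ measurable or $f\in L^1(\mathbb R^3)$, $\int_{\mathbb R^3}f(x)\,dx=\int_0^\infty r^2\int_{\mathbb S_c^2}f(ry)\,d\mu_c(y)\,dr$, and $\nu_c:=\mu_c/\mu_c(\mathbb S_c^2)$. For a positive integer $\lambda$, \[ \mathbf S_c^3(\lambda):=\{x\in\mathbb Z^3:\lfloor|x_1|^c\rfloor+\lfloor|x_2|^c\rfloor+\lfloor|x_3|^c\rfloor=\lambda\},\quad r_c(\lambda):=\#\mathbf S_c^3(\lambda),\quad \mathbf P_c^3(\lambda):=\{\lambda^{-1/c}x:x\in\mathbf S_c^3(\lambda)\}. \] For $\xi\in\mathbb S^2$ and $a>0$ let \[ C_{a,\xi}:=\{x\in\mathbb S_c^2:x\cdot\xi\ge a\},\qquad \mathbf C_{a,\xi}:=\{x\in\mathbb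 R^3:100\ge x\cdot\xi\ge a\}, \] \[ D_c(\lambda,\xi,a):=\#\big(\mathbf P_c^3(\lambda)\cap\mathbf C_{a,\xi}\big)-r_c(\lambda)\,\nu_c(C_{a,\xi}),\qquad D_c(\lambda,\xi):=\sup_{a>0}|D_c(\lambda,\xi,a)|. \] The implicit constant in $\lesssim_\varepsilon$ may depend on $\varepsilon$ and $c$. *)

(* Defs.v *)
From HB Require Import structures.
From mathcomp Require Import all_boot all_order all_algebra finmap.
From mathcomp Require Import all_classical all_reals all_analysis measurable_realfun.
Set Implicit Arguments.
Unset Strict Implicit.
Unset Printing Implicit Defensive.
Import Order.TTheory GRing.Theory Num.Theory.
Local Open Scope classical_set_scope.
Local Open Scope ring_scope.

(* The product sigma-algebra on this type is the Borel sigma-algebra of R^3.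
   The coordinates of x are x.1.1, x.1.2 and x.2. *)
Notation space3 R :=
  (measurableTypeR R * measurableTypeR R * measurableTypeR R)%type.

Definition lebesgue3 (R : realType) : {measure set (space3 R) -> \bar R} :=
  ((@lebesgue_measure R \x @lebesgue_measure R)%E \x @lebesgue_measure R)%E.

Definition scale3 (R : realType) (t : R) (x : space3 R) : space3 R :=
  (t * x.1.1, t * x.1.2, t * x.2).

Definition dot3 (R : realType) (x y : space3 R) : R :=
  x.1.1 * y.1.1 + x.1.2 * y.1.2 + x.2 * y.2.

Definition cnorm (R : realType) (c : R) (x : space3 R) : R :=
  (`|x.1.1| `^ c + `|x.1.2| `^ c + `|x.2| `^ c) `^ (1 / c).

Definition csphere (R : realType) (c : R) : set (space3 R) :=
  [set x | cnorm c x = 1].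

Definition unit_sphere (R : realType) : set (space3 R) :=
  [set x | Num.sqrt (dot3 x x) = 1].

(* A Borel measure on the c-sphere is represented as a Borel measure on R^3
   that is concentrated on the c-sphere.  The polar coordinates formula then
   determines it uniquely. *)
Definition is_polar_measure (R : realType) (c : R)
    (mu : {measure set (space3 R) -> \bar R}) : Prop :=
  mu (~` csphere c) = 0%E /\
  forall f : space3 R -> \bar R, measurable_fun setT f ->
    (forall x, (0 <= f x)%E) \/ (lebesgue3 R).-integrable setT f ->
    (\int[lebesgue3 R]_x f x =
     \int[@lebesgue_measure R]_(r in `]0%R, +oo[)
       ((r ^+ 2)%:E * \int[mu]_(y in csphere c) f (scale3 r y)))%E.

(* Applied to the indicator of the c-ball, the polar coordinates formula shows
   that mu has finite total mass, so fine loses nothing here. *)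
Definition nuc (R : realType) (c : R)
    (mu : {measure set (space3 R) -> \bar R}) (A : set (space3 R)) : R :=
  fine (mu A) / fine (mu (csphere c)).

Definition S3 (R : realType) (c : R) (lam : nat) : set (int * int * int) :=
  [set x | Num.floor (`|x.1.1%:~R : R| `^ c) + Num.floor (`|x.1.2%:~R : R| `^ c)
           + Num.floor (`|x.2%:~R : R| `^ c) = lam%:Z].

(* fset_set A is the finite set of the elements of A when A is finite (it is
   empty otherwise).  S3 and P3 are finite when c > 0. *)
Definition rc (R : realType) (c : R) (lam : nat) : nat :=
  #|` fset_set (S3 c lam)|%fset.

Definition P3 (R : realType) (c : R) (lam : nat) : set (space3 R) :=
  [set scale3 (lam%:R `^ (- (1 / c))) (x.1.1%:~R, x.1.2%:~R, x.2%:~R)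
     | x in S3 c lam].

Definition cap (R : realType) (c a : R) (xi : space3 R) : set (space3 R) :=
  [set x | csphere c x /\ a <= dot3 x xi].

Definition solid_cap (R : realType) (a : R) (xi : space3 R) : set (space3 R) :=
  [set x | a <= dot3 x xi <= 100].

Definition discrepancy_at (R : realType) (c : R)
    (mu : {measure set (space3 R) -> \bar R})
    (lam : nat) (xi : space3 R) (a : R) : R :=
  (#|` fset_set (P3 c lam `&` solid_cap a xi)|%fset)%:R
  - (rc c lam)%:R * nuc c mu (cap c a xi).

(* The supremum is taken in the extended reals, so that a bound on it is a bound
   for every a > 0. *)
Definition discrepancy (R : realType) (c : R)
    (mu : {measure set (space3 R) -> \bar R})
    (lam : nat) (xi : space3 R) : \bar R :=
  ereal_sup [set (`|discrepancy_at c mu lam xi a|)%:E | a in [set a : R | 0 < a]].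

(* Main.v *)
Require Import Defs.
From mathcomp Require Import all_boot all_order all_algebra finmap.
From mathcomp Require Import all_classical all_reals all_analysis measurable_realfun.
From mathcomp Require Import ring lra zify.
Set Implicit Arguments.
Unset Strict Implicit.
Unset Printing Implicit Defensive.
Import Order.TTheory GRing.Theory Num.Theory.
Import numFieldNormedType.Exports.
Local Open Scope classical_set_scope.
Local Open Scope ring_scope.

(** The number of lattice points is compared with a volume. Let V a be the part
    of the shell lam <= |x|_c ^ c < lam + 1 that lies in the cone over the cap of
    height a. By the polar coordinates formula the volumes of
    these sets are proportional to the measures of the caps (volume_shell_cap), so
    the discrepancy equals (N a - |V a|) - nu a * (N - |V|), where N a counts the
    lattice points in the cap, nu a <= 1 is the normalised measure of the cap, and
    N, V are the count and the shell for the whole sphere. It is therefore enough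
    to bound N a - |V a| for all a, the whole sphere being the case a = - 10
    (discrepancy_at_bound, half_lattice_discrepancy).

    Fix an octant and the first two coordinates k1, k2, and put
    n = lam - floor (k1 ^ c) - floor (k2 ^ c). The k3 with floor (k3 ^ c) = n are
    the integers of [n ^ g, (n + 1) ^ g[ with g = 1 / c; their number is the length
    gap g n of this interval plus {- (n + 1) ^ g} - {- n ^ g} (floorpow_count). The
    volume of the part of V a over the unit square at (k1, k2) is also gap g n, up
    to a small error (cell_volume_in), as long as the square is inside the cap. Two
    kinds of error remain.

    The first is the sum of the fractional parts over the pairs inside the cap.
    With k2 fixed, these k1 form an interval, or the complement of one among all
    k1, because the surface is convex (level_quasiconcave, defect_sum_above). An
    inequality of Erdos-Turan type, obtained from the primitive of the Fejer
    kernel (erdos_turan), reduces the sum to the exponential sums of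
    h * (X - floor (k1 ^ c) - floor (k2 ^ c)) ^ g over k1 and k2. The floors
    cannot be differentiated, but they need not be: with k2 in a short block, apply
    Cauchy-Schwarz over k1, extend the sum of squares from the values of
    floor (k1 ^ c) to all integers, which are hardly more numerous as c is close to
    1, and open the square (expsum_block). The phases are then differences of two
    powers at consecutive integers, with small monotone steps, and the
    Kusmin-Landau inequality applies to them (kusmin_landau). With frequencies up to
    lam ^ (1 / (5 c)) and blocks of length lam ^ (3 / (5 c)) this suffices for the
    stated exponent (sawtooth_pairs).

    The second is the number of pairs whose square meets the boundary of the cap.
    Along a line in at least one direction of the grid, the linear form that cuts
    the cap, restricted to the surface, is either steep or curved, so that few of
    its values lie in a short interval (slope_count, level_count). Pairs with small
    n are few (low_pairs_count). *)

Implicit Types (R : realType) (lam k n : nat) (s : bool).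

(** * The Kusmin-Landau inequality *)

Lemma mean_value R (f df : R -> R) (a b : R) : a <= b ->
  (forall x, a <= x <= b -> is_derive x 1 f (df x)) ->
  exists2 z, a <= z <= b & f b - f a = df z * (b - a).
Proof.
move=> ab fdf.
have d x : x \in `]a, b[ -> is_derive x 1 f (df x).
  by rewrite in_itv/= => /andP[ax xb]; apply: fdf; rewrite !ltW.
have cf : {within `[a, b], continuous f}.
  apply: derivable_within_continuous => x; rewrite in_itv/= => /fdf fx.
  exact: ex_derive.
by have [z + e] := MVT_segment ab d cf; rewrite in_itv/= => zab; exists z.
Qed.

Lemma sin_ler_id R (x : R) : 0 <= x -> sin x <= x.
Proof.
move=> x0; have [z _] := mean_value (f := sin) (df := cos) x0 (fun y _ => is_derive_sin y).
rewrite sin0 !subr0 => ->; rewrite -[leRHS]mul1r.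
by apply: ler_wpM2r => //; exact: cos_le1.
Qed.

Lemma ler_cos_pi R (x y : R) :
  0 <= x -> x <= y -> y <= pi -> cos y <= cos x.
Proof.
move=> x0; rewrite le_eqVlt => /predU1P[<- //|xy ypi].
by apply: ltW; rewrite ltr_cos// in_itv/=; apply/andP; split; lra.
Qed.

Lemma ler_sin_pihalf R (x y : R) :
  0 <= x -> x <= y -> y <= pi / 2 -> sin x <= sin y.
Proof.
move=> x0; rewrite le_eqVlt => /predU1P[<- //|xy ypi].
by apply: ltW; rewrite ltr_sin// in_itv/=; apply/andP; split; lra.
Qed.

Lemma ler_sin_half R (x : R) : 0 <= x <= pi / 2 -> x / 2 <= sin x.
Proof.
case/andP=> x0 xpi.
pose y := x / 2.
have y0 : 0 <= y by rewrite /y; lra.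
have ypi : y <= pi / 4 by rewrite /y; lra.
have pi0 := pi_gt0 R.
have cpi4 : cos (pi / 4 : R) ^+ 2 = 1 / 2.
  have := cos_mulr2n (pi / 4 : R).
  have -> : pi / 4 *+ 2 = pi / 2 :> R by rewrite mulr2n; lra.
  rewrite cos_pihalf; lra.
have [z /andP[z0 zy]] :=
  mean_value (f := sin) (df := cos) y0 (fun y _ => is_derive_sin y).
rewrite sin0 !subr0 => siny.
have cz : cos y <= cos z by apply: ler_cos_pi; lra.
have c4 : 0 <= cos (pi / 4 : R) by apply: cos_ge0_pihalf; lra.
have cy : cos (pi / 4) <= cos y by apply: ler_cos_pi; lra.
have -> : x = y *+ 2 by rewrite /y mulr2n; lra.
rewrite sin_mulr2n siny [X in X <= _](_ : _ = y); last by rewrite mulr2n; lra.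
have h : 1 / 2 <= cos y * cos z.
  rewrite -cpi4 expr2; apply: ler_pM => //; lra.
rewrite mulrA -mulrnAl -[leLHS]mul1r; apply: ler_wpM2r => //.
by rewrite mulr2n; lra.
Qed.

(** Let psi a be half the step of the phase. Then cos (phi a) is half the
    difference of two consecutive cosines plus half of cot (psi a) times the
    difference of two consecutive sines. The steps increase, so the cotangents
    decrease, and summation by parts bounds the sum by the first of them. *)
Lemma kusmin_landau R (phi : nat -> R) (K : nat) (psi0 : R) :
  0 < psi0 ->
  (forall a, (a < K)%N -> psi0 <= (phi a.+1 - phi a) / 2 <= pi / 2) ->
  (forall a, (a.+1 < K)%N -> phi a.+1 - phi a <= phi a.+2 - phi a.+1) ->
  `|\sum_(a < K) cos (phi a)| <= 1 + 2 / psi0.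
Proof.
move=> psi0_gt0 bnd mon.
pose psi a := (phi a.+1 - phi a) / 2.
pose q a := cos (psi a) / sin (psi a).
have pi0 := pi_gt0 R.
have sgt a : (a < K)%N -> 0 < sin (psi a).
  move=> /bnd /andP[h1 h2]; apply: sin_gt0_pi; rewrite /psi; lra.
have cge a : (a < K)%N -> 0 <= cos (psi a).
  move=> /bnd /andP[h1 h2]; apply: cos_ge0_pihalf; rewrite /psi; lra.
have qge a : (a < K)%N -> 0 <= q a.
  by move=> aK; rewrite /q divr_ge0 ?cge// ltW ?sgt.
have qdec a : (a.+1 < K)%N -> q a.+1 <= q a.
  move=> aK; have aK' := ltnW aK.
  have := bnd _ aK; have := bnd _ aK'; rewrite -!/(psi _) => /andP[h1 h2] /andP[h3 h4].
  have le : psi a <= psi a.+1 by rewrite /psi; have := mon _ aK; lra.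
  have s1 := sgt _ aK; have s2 := sgt _ aK'.
  apply: ler_pM; [exact: cge|by rewrite invr_ge0 ltW| |].
    by apply: ler_cos_pi; lra.
  by rewrite lef_pV2 ?posrE ?sgt//; apply: ler_sin_pihalf; lra.
have tele a : (a < K)%N -> cos (phi a) = (cos (phi a) - cos (phi a.+1)) / 2 +
    q a * (sin (phi a.+1) - sin (phi a)) / 2.
  move=> aK; have s0 := sgt _ aK.
  pose m := phi a + psi a.
  have e1 : phi a = m - psi a by rewrite /m addrK.
  have e2 : phi a.+1 = m + psi a by rewrite /m /psi; lra.
  have [c1 c2] := (cosB m (psi a), cosD m (psi a)).
  have [t1 t2] := (sinB m (psi a), sinD m (psi a)).
  by rewrite e2 e1 c1 c2 t1 t2 /q; field; lra.
rewrite (eq_bigr (fun a : 'I_K => (cos (phi a) - cos (phi a.+1)) / 2 +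
    q a * (sin (phi a.+1) - sin (phi a)) / 2)); last by move=> a _; exact: tele.
rewrite big_split/= -!mulr_suml.
have -> : \sum_(i < K) (cos (phi i) - cos (phi i.+1)) = cos (phi 0%N) - cos (phi K).
  rewrite -(big_mkord xpredT (fun i => cos (phi i) - cos (phi i.+1))).
  rewrite (eq_bigr (fun i => - (cos (phi i.+1) - cos (phi i)))).
    by rewrite sumrN telescope_sumr// opprB.
  by move=> i _; rewrite opprB.
have Abel k : (k < K)%N ->
  `|\sum_(i < k.+1) q i * (sin (phi i.+1) - sin (phi i)) - q k * sin (phi k.+1)|
    <= 2 * q 0%N - q k.
  elim: k => [|k IH] kK.
    rewrite big_ord1/= [X in `|X|](_ : _ = - (q 0%N * sin (phi 0%N))); last by ring.
    rewrite normrN normrM (ger0_norm (qge _ kK)).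
    have := ler_wpM2l (qge _ kK) (sin_max (phi 0%N)); lra.
  rewrite big_ord_recr/=; have := IH (ltnW kK).
  set A := \sum_(i < k.+1) _; move=> h.
  rewrite [X in `|X|](_ : _ = (A - q k * sin (phi k.+1)) +
      (q k - q k.+1) * sin (phi k.+1)); last by ring.
  apply: le_trans (ler_normD _ _) _.
  rewrite normrM (ger0_norm (x := q k - _)) ?subr_ge0 ?qdec//.
  have h2 : 0 <= q k - q k.+1 by rewrite subr_ge0 qdec.
  have := ler_wpM2l h2 (sin_max (phi k.+1)); lra.
have q0 : (0 < K)%N -> q 0%N <= 2 / psi0.
  move=> K0; have /andP[h1 h2] := bnd _ K0; rewrite -/(psi _) in h1 h2.
  have h3 : psi0 / 2 <= sin (psi 0%N) by apply: le_trans (ler_sin_half _); lra.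
  apply: (@le_trans _ _ (1 / sin (psi 0%N))).
    by rewrite ler_pM2r ?invr_gt0 ?sgt// cos_le1.
  by rewrite div1r -[leRHS]invrK invf_div lef_pV2 ?posrE ?sgt ?divr_gt0.
have {}Abel : `|\sum_(i < K) q i * (sin (phi i.+1) - sin (phi i))| <= 2 * (2 / psi0).
  case: K q0 qge {bnd mon sgt cge qdec tele} Abel => [|k] q0 qge Abel.
    by rewrite big_ord0 normr0 mulr_ge0// divr_ge0// ltW.
  have := Abel k (ltnSn _); set A := \sum_(i < _) _ => h.
  have := ler_normD (A - q k * sin (phi k.+1)) (q k * sin (phi k.+1)).
  rewrite subrK normrM (ger0_norm (qge _ (ltnSn _))).
  have := ler_wpM2l (qge _ (ltnSn k)) (sin_max (phi k.+1)).
  have := q0 isT; lra.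
apply: le_trans (ler_normD _ _) _; apply: lerD.
  rewrite normrM (ger0_norm (x := 2^-1)) ?invr_ge0//.
  have := ler_normB (cos (phi 0%N)) (cos (phi K)).
  have := cos_max (phi 0%N); have := cos_max (phi K); lra.
by rewrite normrM (ger0_norm (x := 2^-1)) ?invr_ge0//; lra.
Qed.

(** * Powers *)

Lemma ler_powR_base R (r x y : R) :
  0 <= r -> 0 <= x -> x <= y -> x `^ r <= y `^ r.
Proof.
move=> r0 x0 xy; apply: ge0_ler_powR; rewrite ?nnegrE//; exact: le_trans xy.
Qed.

Lemma ltr_powR_base R (r x y : R) :
  0 < r -> 0 <= x -> x < y -> x `^ r < y `^ r.
Proof.
move=> r0 x0 xy; apply: gt0_ltr_powR; rewrite ?nnegrE//; exact: le_trans (ltW xy).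
Qed.

Lemma ler_powR_base_anti R (r x y : R) :
  r <= 0 -> 0 < x -> x <= y -> y `^ r <= x `^ r.
Proof.
move=> r0 x0 xy; have y0 := lt_le_trans x0 xy.
have e z : z `^ r = (z `^ (- r))^-1 by rewrite -powRN opprK.
rewrite !e lef_pV2 ?posrE ?powR_gt0//.
by apply: ler_powR_base; rewrite ?oppr_ge0// ltW.
Qed.

Lemma powR1x R (r : R) : 1 `^ r = 1.
Proof. by rewrite powR1. Qed.

Lemma powRK R (r x : R) : r != 0 -> 0 <= x -> (x `^ r) `^ r^-1 = x.
Proof. by move=> r0 x0; rewrite -powRrM mulfV// powRr1. Qed.

Lemma powRVK R (r x : R) : r != 0 -> 0 <= x -> (x `^ r^-1) `^ r = x.
Proof. by move=> r0 x0; rewrite -powRrM mulVf// powRr1. Qed.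

Lemma powR_ge1 R (q x : R) : 1 <= q -> 0 <= x -> 1 <= q `^ x.
Proof. by move=> q1 x0; rewrite -[leLHS](powRr0 q); apply: ler_powR. Qed.

Lemma powR_lt_root R (c x t : R) : 0 < c -> 0 <= x -> x `^ c < t ->
  x < t `^ c^-1.
Proof.
move=> c0 x0 xt; rewrite -[X in X < _](@powRK _ c) ?gt_eqF//.
by apply: ltr_powR_base => //; [rewrite invr_gt0|exact: powR_ge0].
Qed.

Lemma powR_le_root R (c x t : R) : 0 < c -> 0 <= x -> x `^ c <= t ->
  x <= t `^ c^-1.
Proof.
move=> c0 x0 xt; rewrite -[X in X <= _](@powRK _ c) ?gt_eqF//.
by apply: ler_powR_base => //; [rewrite invr_ge0 ltW|exact: powR_ge0].
Qed.

Lemma root_le_powR R (c x t : R) : 0 < c -> 0 <= x -> 0 <= t ->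
  t <= x `^ c -> t `^ c^-1 <= x.
Proof.
move=> c0 x0 t0 xt; rewrite -[X in _ <= X](@powRK _ c) ?gt_eqF//.
by apply: ler_powR_base => //; rewrite invr_ge0 ltW.
Qed.

Lemma inv_itv01 R (c : R) : 1 < c -> 0 < c^-1 < 1.
Proof. by move=> c1; rewrite invr_gt0 invf_lt1; [apply/andP; split|]; lra. Qed.

Lemma powR_side_le R (c q x : R) : 1 < c < 9 / 8 -> 1 <= q ->
  0 <= x <= 3 * q `^ 5 -> x `^ (c - 1) <= 2 * q `^ (5 * (c - 1)).
Proof.
move=> /andP[c1 c2] q1 /andP[x0 xq].
have three : 3 `^ (c - 1) <= 2 :> R.
  have -> : 2 = (2 `^ 2) `^ (1 / 2) :> R.
    by rewrite -powRrM (_ : 2 * (1 / 2) = 1) ?powRr1//; lra.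
  rewrite (powR_mulrn 2)//; apply: (@le_trans _ _ (3 `^ (1 / 2))).
    by apply: ler_powR; lra.
  by apply: ler_powR_base; rewrite ?expr2; lra.
apply: (@le_trans _ _ ((3 * q `^ 5) `^ (c - 1))).
  by apply: ler_powR_base => //; lra.
rewrite (@powRM _ 3 (q `^ 5)) ?powR_ge0// -powRrM.
by apply: ler_wpM2r => //; exact: powR_ge0.
Qed.

(** Young's inequality for u and v `^ (c - 1). *)
Lemma powR_tangent R (c u v : R) : 1 < c -> 0 <= u -> 0 <= v ->
  c * v `^ (c - 1) * (u - v) <= u `^ c - v `^ c.
Proof.
move=> c1 u0 v0.
have h := @conjugate_powR _ u (v `^ (c - 1)) c (c / (c - 1)) u0 (powR_ge0 _ _).
have {h} : u * v `^ (c - 1) <= u `^ c / c + v `^ c / (c / (c - 1)).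
  rewrite [v `^ c](_ : _ = (v `^ (c - 1)) `^ (c / (c - 1))); last first.
    by rewrite -powRrM mulrC divfK//; lra.
  by apply: h; [lra|rewrite divr_gt0; lra|field; lra].
have e : v * v `^ (c - 1) = v `^ c by rewrite mulr_powRB1//; lra.
move=> h.
have : c * (u * v `^ (c - 1)) <= c * (u `^ c / c + v `^ c / (c / (c - 1))).
  by apply: ler_wpM2l => //; lra.
rewrite [X in _ <= X](_ : _ = u `^ c + (c - 1) * v `^ c); last by field; lra.
nra.
Qed.

Lemma powR_superadditive R (c a b : R) : 1 <= c -> 0 <= a -> 0 <= b ->
  a `^ c + b `^ c <= (a + b) `^ c.
Proof.
move=> c1 a0 b0; rewrite -!(@mulr_powRB1 _ _ c)//; try lra.
rewrite mulrDl; apply: lerD; apply: ler_wpM2l => //; apply: ler_powR_base; lra.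
Qed.

Lemma is_derive_powR_shift R (g a s : R) : 0 < s + a ->
  is_derive s 1 (fun x => (x + a) `^ g) (g * (s + a) `^ (g - 1)).
Proof.
move=> sa.
have h := is_derive_shift s 1 a.
have h2 := is_derive1_powR g sa.
have := @is_derive1_comp _ (fun y => y `^ g) (shift a) s _ _ h2 h.
by rewrite mulr1.
Qed.

(** For g = 1 / c, the length of the interval of those x >= 0 with t <= x `^ c <
    t + 1. *)
Definition gap R (g t : R) : R := (t + 1) `^ g - t `^ g.

Lemma is_derive_gap R (g a s : R) : 0 < s + a ->
  is_derive s 1 (fun x => gap g (x + a)) (g * gap (g - 1) (s + a)).
Proof.
move=> sa.
have sa1 : 0 < s + (a + 1) by lra.
have -> : (fun x => gap g (x + a)) =
    (fun x => (x + (a + 1)) `^ g) - (fun x => (x + a) `^ g).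
  by apply/funext => x; rewrite /gap -addrA.
have -> : g * gap (g - 1) (s + a) =
    g * (s + (a + 1)) `^ (g - 1) - g * (s + a) `^ (g - 1).
  by rewrite /gap addrA mulrBr.
by apply: is_deriveB; exact: is_derive_powR_shift.
Qed.

Lemma gap_mvt R (g t : R) : 0 < t ->
  exists2 z, t <= z <= t + 1 & gap g t = g * z `^ (g - 1).
Proof.
move=> t0.
have t1 : t <= t + 1 by lra.
have d x : t <= x <= t + 1 -> is_derive x 1 (fun x => x `^ g) (g * x `^ (g - 1)).
  by move=> /andP[h _]; apply: is_derive1_powR; lra.
have [z h e] := mean_value t1 d; exists z => //.
by rewrite /gap e addrAC subrr add0r mulr1.
Qed.

Lemma gap_second_mvt R (g t d : R) : 0 < t -> 0 <= d ->
  exists2 z, t <= z <= t + d + 1 &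
    gap g t - gap g (t + d) = d * (g * (1 - g) * z `^ (g - 2)).
Proof.
move=> t0 d0.
have h1 : t <= t + d by lra.
have D x : t <= x <= t + d ->
    is_derive x 1 (fun x => gap g (x + 0)) (g * gap (g - 1) (x + 0)).
  by move=> /andP[h _]; apply: is_derive_gap; lra.
have [s h] := mean_value h1 D; rewrite !addr0 => e.
have s0 : 0 < s by lra.
have [z hz ez] := gap_mvt (g - 1) s0.
exists z; first lra.
have -> : g - 2 = g - 1 - 1 by lra.
by rewrite -opprB e ez; ring.
Qed.

(** Two applications of the mean value theorem. The phases of the exponential
    sums have differences of gaps as their steps, so these bounds give the size
    of the steps. *)
Lemma gap_diff_bounds R (g t d : R) : 0 < g < 1 -> 0 < t -> 0 <= d ->
  d * (g * (1 - g) * (t + d + 1) `^ (g - 2)) <= gap g t - gap g (t + d)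
    <= d * (g * (1 - g) * t `^ (g - 2)).
Proof.
move=> /andP[g0 g1] t0 d0; have [z /andP[z1 z2] ->] := gap_second_mvt g t0 d0.
have gg : 0 <= g * (1 - g) by rewrite mulr_ge0//; lra.
apply/andP; split; apply: ler_wpM2l => //; apply: ler_wpM2l => //;
  apply: ler_powR_base_anti; lra.
Qed.

Lemma gap_nincr R (g t u : R) : 0 < g < 1 -> 0 < t -> t <= u ->
  gap g u <= gap g t.
Proof.
move=> g01 t0 tu; have d0 : 0 <= u - t by lra.
have [z /andP[h _]] := gap_second_mvt g t0 d0; rewrite subrKC => e.
rewrite -subr_ge0 e !mulr_ge0 ?powR_ge0//; lra.
Qed.

(** The derivative of gap g is g * gap (g - 1), which increases as g - 1 < 0.
    This is the monotonicity of the steps that the Kusmin-Landau inequality asks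
    for. *)
Lemma gap_convex R (g t d e : R) : 0 < g < 1 -> 0 < t -> 0 <= d ->
  0 <= e -> gap g (t + e) - gap g (t + e + d) <= gap g t - gap g (t + d).
Proof.
move=> /andP[g0 g1] t0 d0 e0.
have h1 : t <= t + e by lra.
have D x : t <= x <= t + e ->
    is_derive x 1 ((fun x => gap g (x + 0)) - (fun x => gap g (x + d)))
      (g * gap (g - 1) (x + 0) - g * gap (g - 1) (x + d)).
  by move=> /andP[h _]; apply: is_deriveB; apply: is_derive_gap; lra.
have [s h E] := mean_value h1 D.
have : gap (g - 1) s <= gap (g - 1) (s + d).
  have h2 : s <= s + d by lra.
  have D2 x : s <= x <= s + d ->
      is_derive x 1 (fun x => gap (g - 1) (x + 0)) ((g - 1) * gap (g - 1 - 1) (x + 0)).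
    by move=> /andP[h3 _]; apply: is_derive_gap; lra.
  have [z h3] := mean_value h2 D2; rewrite !addr0 => e2.
  rewrite -subr_ge0 e2 (_ : s + d - s = d); last by lra.
  apply: mulr_ge0 => //.
  apply: mulr_le0; first lra.
  by rewrite /gap subr_le0; apply: ler_powR_base_anti; lra.
move=> h4; rewrite -subr_ge0.
move: E; rewrite /= -![(_ - _ : _ -> _) _]/(_ - _) !addr0 => E.
have : g * (gap (g - 1) s - gap (g - 1) (s + d)) * (t + e - t) <= 0.
  rewrite -mulrA mulr_ge0_le0//; first exact: ltW.
  by apply: mulr_le0_ge0; lra.
rewrite [g * (_ - _)]mulrBr => H; set l := (X in 0 <= X).
have -> : l = - ((g * gap (g - 1) s - g * gap (g - 1) (s + d)) * (t + e - t)).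
  by rewrite -E /l; ring.
by rewrite oppr_ge0.
Qed.

(** The upper bound is the superadditivity of the power 1 / g at t `^ g and 1. *)
Lemma gap_bounds R (g t : R) : 0 < g < 1 -> 0 <= t -> 0 <= gap g t <= 1.
Proof.
move=> /andP[g0 g1] t0; rewrite /gap subr_ge0 ler_powR_base; [|lra..].
have V1 : 1 <= g^-1 by rewrite invf_ge1// ltW.
have := powR_superadditive V1 (powR_ge0 t g) ler01.
rewrite powRK ?gt_eqF// powR1 => h.
rewrite lerBlDr [leRHS]addrC.
rewrite -(@powRVK _ g (t `^ g + 1)) ?gt_eqF ?addr_ge0 ?powR_ge0//.
by apply: ler_powR_base => //; lra.
Qed.

(** * The discrepancy of a finite sequence modulo one *)

Definition harmonic R (n : nat) : R := \sum_(d < n) (d.+1%:R)^-1.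

Lemma harmonic_ge0 R (n : nat) : 0 <= harmonic R n.
Proof. by apply: sumr_ge0 => d _; rewrite invr_ge0. Qed.

Lemma harmonic_homo R (m n : nat) : (m <= n)%N ->
  harmonic R m <= harmonic R n.
Proof.
move=> mn; rewrite /harmonic -(subnKC mn) big_split_ord/= lerDl.
by apply: sumr_ge0 => d _; rewrite invr_ge0.
Qed.

Lemma sum_inv_dist R (n k : nat) : (k < n)%N ->
  \sum_(l < n | l != k :> nat) `|k%:R - l%:R : R|^-1 <= 2 * harmonic R n.
Proof.
move=> kn.
have -> : \sum_(l < n | l != k :> nat) `|k%:R - l%:R : R|^-1 =
   \sum_(0 <= l < k) `|k%:R - l%:R : R|^-1 + \sum_(k.+1 <= l < n) `|k%:R - l%:R : R|^-1.
  rewrite -(big_mkord (fun l => l != k) (fun l => `|k%:R - l%:R : R|^-1)).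
  rewrite (big_cat_nat (n := k)) ?(ltnW kn)//=; congr (_ + _).
    rewrite [LHS]big_nat_cond [RHS]big_nat_cond; apply: eq_bigl => l; lia.
  rewrite big_ltn_cond// eqxx/= [LHS]big_nat_cond [RHS]big_nat_cond.
  by apply: eq_bigl => l; lia.
rewrite mulr2n mulrDl !mul1r; apply: lerD.
  apply: le_trans (harmonic_homo R (ltnW kn)).
  rewrite /harmonic -(big_mkord xpredT (fun d => (d.+1%:R : R)^-1)).
  rewrite [leRHS]big_nat_rev/= !big_nat.
  apply: ler_sum => l /andP[_ lk]; rewrite add0n -natrB ?(ltnW lk)// normr_nat.
  by have -> : ((k - l.+1).+1 = k - l)%N by lia.
have h : (n - k.+1 <= n)%N by lia.
apply: le_trans (harmonic_homo R h).
rewrite /harmonic -(big_mkord xpredT (fun d => (d.+1%:R : R)^-1)).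
rewrite -{1}[k.+1]add0n big_addn !big_nat.
apply: ler_sum => l _; rewrite distrC -natrB; last by lia.
by rewrite normr_nat; have -> : (l + k.+1 - k = l.+1)%N by lia.
Qed.

Lemma sin_nat_pi R (n : nat) : sin (n%:R * pi : R) = 0.
Proof.
elim: n => [|n IH]; first by rewrite mul0r sin0.
by rewrite -natr1 mulrDl mul1r sinDpi IH oppr0.
Qed.

Lemma sin_natB_pi R (k l : nat) : sin ((k%:R - l%:R) * pi : R) = 0.
Proof. by rewrite mulrBl sinB !sin_nat_pi mulr0 mul0r subrr. Qed.

Lemma sin_int_2pi R (z : int) : sin (z%:~R * (2 * pi) : R) = 0.
Proof.
have e (n : nat) : sin (n%:R * (2 * pi) : R) = 0.
  by rewrite mulrA -natrM sin_nat_pi.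
by case: z => n; rewrite ?NegzE ?mulrNz ?mulNr ?sinN e ?oppr0.
Qed.

Lemma cos_int_2pi R (z : int) : cos (z%:~R * (2 * pi) : R) = 1.
Proof.
have e (n : nat) : cos (n%:R * (2 * pi) : R) = 1.
  have -> : n%:R * (2 * pi) = (n%:R * pi) *+ 2 :> R by rewrite mulr2n; ring.
  have := cos2Dsin2 (n%:R * pi : R); rewrite cos_mulr2n sin_nat_pi.
  rewrite mulr2n; lra.
by case: z => n; rewrite ?NegzE ?mulrNz ?mulNr ?cosN e.
Qed.

Lemma cosD_int_2pi R (z : int) (x : R) :
  cos (z%:~R * (2 * pi) + x) = cos x.
Proof. by rewrite cosD cos_int_2pi sin_int_2pi mul1r mul0r subr0. Qed.

Lemma sinD_int_2pi R (z : int) (x : R) :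
  sin (z%:~R * (2 * pi) + x) = sin x.
Proof. by rewrite sinD cos_int_2pi sin_int_2pi mul1r mul0r add0r. Qed.

(** The square of the modulus of the sum of exp (2 pi i k t) over k < H, that is
    H times the Fejer kernel, written with cosines so that its sum over a
    sequence is visibly a combination of exponential sums. *)
Definition fejer R (H : nat) (t : R) : R :=
  \sum_(k < H) \sum_(l < H) cos (2 * pi * (k%:R - l%:R) * t).

Lemma fejer_sq R (H : nat) (t : R) : fejer H t =
  (\sum_(k < H) cos (2 * pi * k%:R * t)) ^+ 2 +
  (\sum_(k < H) sin (2 * pi * k%:R * t)) ^+ 2.
Proof.
rewrite !expr2 !big_distrlr/= -big_split/=; apply: eq_bigr => k _.
rewrite -big_split/=; apply: eq_bigr => l _.
by rewrite -cosB; congr cos; ring.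
Qed.

Lemma fejer_ge0 R (H : nat) (t : R) : 0 <= fejer H t.
Proof. by rewrite fejer_sq addr_ge0 ?sqr_ge0. Qed.

(** The geometric sum, multiplied out so that nothing is divided by a sine that
    may vanish. *)
Lemma fejer_closed R (H : nat) (t : R) :
  sin (pi * t) ^+ 2 * fejer H t = sin (H%:R * (pi * t)) ^+ 2.
Proof.
set p := pi * t.
have e k : 2 * pi * k%:R * t = k%:R * p + k%:R * p by rewrite /p; ring.
have hc : sin p * \sum_(k < H) cos (2 * pi * k%:R * t) =
    sin (H%:R * p) * cos (H%:R * p - p).
  elim: H => [|H IH]; first by rewrite big_ord0 mul0r sin0 mul0r mulr0.
  rewrite big_ord_recr/= mulrDr IH e -natr1 mulrDl mul1r addrK.
  by rewrite cosB cosD sinD; ring.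
have hs : sin p * \sum_(k < H) sin (2 * pi * k%:R * t) =
    sin (H%:R * p) * sin (H%:R * p - p).
  elim: H {hc} => [|H IH]; first by rewrite big_ord0 mul0r sin0 mul0r mulr0.
  rewrite big_ord_recr/= mulrDr IH e -natr1 mulrDl mul1r addrK.
  by rewrite sinB !sinD; ring.
rewrite fejer_sq mulrDr -!exprMn hc hs !exprMn -mulrDr.
by rewrite cos2Dsin2 mulr1.
Qed.

Lemma fejer_le R (H : nat) (t : R) : 0 < t <= 1 / 2 ->
  fejer H t <= (t ^+ 2)^-1.
Proof.
move=> /andP[t0 t2]; have pi2 := pi_ge2 R.
have t20 : 0 < t ^+ 2 by rewrite exprn_gt0.
rewrite -[leRHS]mul1r ler_pdivlMr// mulrC.
have h1 : t <= sin (pi * t).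
  apply: le_trans (ler_sin_half _); nra.
apply: (@le_trans _ _ (sin (pi * t) ^+ 2 * fejer H t)).
  apply: ler_wpM2r; first exact: fejer_ge0.
  by rewrite ler_sqr ?nnegrE//; lra.
rewrite fejer_closed; have := cos2Dsin2 (H%:R * (pi * t)).
by have := sqr_ge0 (cos (H%:R * (pi * t))); lra.
Qed.

Lemma fejerN R (H : nat) (t : R) : fejer H (- t) = fejer H t.
Proof.
by apply: eq_bigr => k _; apply: eq_bigr => l _; rewrite mulrN cosN.
Qed.

Lemma fejerD_int R (H : nat) (t : R) (z : int) :
  fejer H (t + z%:~R) = fejer H t.
Proof.
apply: eq_bigr => k _; apply: eq_bigr => l _.
rewrite -[RHS](cosD_int_2pi ((k%:Z - l%:Z) * z)); congr cos.
rewrite intrM intrB -!pmulrn; ring.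
Qed.

(** On the arc of length 1 / H the numerator of the closed form has not reached
    its first maximum, where sin x >= x / 2 applies. *)
Lemma fejer_ge R (H : nat) (t : R) : (0 < H)%N ->
  `|t| <= (2 * H%:R)^-1 -> H%:R ^+ 2 / 4 <= fejer H t.
Proof.
move=> H0 tH; have pi2 := pi_ge2 R; have H1 : 1 <= H%:R :> R by rewrite ler1n.
wlog t0 : t tH / 0 <= t.
  move=> h; have [|t0] := lerP 0 t; first exact: h.
  by rewrite -fejerN; apply: h; rewrite ?normrN// oppr_ge0 ltW.
move: tH; rewrite ger0_norm// -[X in _ <= X]mul1r ler_pdivlMr ?mulr_gt0//; last lra.
move=> tH.
have [->|tn0] := eqVneq t 0.
  rewrite /fejer (eq_bigr (fun=> H%:R)); last first.
    move=> k _; rewrite (eq_bigr (fun=> 1)); first by rewrite sumr_const card_ord.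
    by move=> l _; rewrite mulr0 cos0.
  rewrite sumr_const card_ord -[X in _ <= X]mulr_natr -expr2.
  by have := sqr_ge0 (H%:R : R); lra.
have {}t0 : 0 < t by rewrite lt_neqAle eq_sym tn0.
have pt : 0 < pi * t by nra.
have h1 : sin (pi * t) <= pi * t by apply: sin_ler_id; exact: ltW.
have h0 : 0 <= sin (pi * t) by apply: sin_ge0_pi; apply/andP; split; nra.
have h2 : H%:R * (pi * t) / 2 <= sin (H%:R * (pi * t)).
  by apply: ler_sin_half; apply/andP; split; nra.
have h3 : (H%:R * (pi * t) / 2) ^+ 2 <= sin (H%:R * (pi * t)) ^+ 2.
  by rewrite ler_sqr ?nnegrE//; nra.
have h4 : sin (pi * t) ^+ 2 * fejer H t <= (pi * t) ^+ 2 * fejer H t.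
  by rewrite ler_wpM2r ?fejer_ge0// ler_sqr ?nnegrE// ltW.
rewrite fejer_closed in h4.
have p2 : 0 < (pi * t) ^+ 2 by rewrite exprn_gt0.
rewrite -(ler_pM2l p2); apply: le_trans (le_trans h3 h4).
by rewrite le_eqVlt; apply/orP; left; apply/eqP; field.
Qed.

(** The primitive of fejer H that vanishes at 0. Divided by H, it is a smooth
    staircase, close to 1 / 2 plus the integral part. *)
Definition fejer_prim R (H : nat) (t : R) : R :=
  \sum_(k < H) \sum_(l < H) (if k == l then t else
    sin (2 * pi * (k%:R - l%:R) * t) / (2 * pi * (k%:R - l%:R))).

Lemma is_derive_fejer_prim R (H : nat) (t : R) :
  is_derive t 1 (fejer_prim H) (fejer H t).
Proof.
have -> : fejer_prim H = \sum_(k < H) \sum_(l < H) (fun t : R => if k == l then t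
  else sin (2 * pi * (k%:R - l%:R) * t) / (2 * pi * (k%:R - l%:R))).
  apply/funext => x; rewrite fct_sumE; apply: eq_bigr => k _.
  by rewrite fct_sumE.
apply: is_derive_sum => k; apply: is_derive_sum => l.
have [->|kl] := eqVneq k l.
  by rewrite subrr mulr0 mul0r cos0; exact: is_derive_id.
set a := 2 * pi * (k%:R - l%:R).
have a0 : a != 0.
  have kl' : k%:R - l%:R != 0 :> R by rewrite subr_eq0 eqr_nat.
  by rewrite /a mulf_neq0// mulf_neq0// gt_eqF// pi_gt0.
have h1 : is_derive t (1 : R) (fun x => a * x) a.
  have := is_deriveZ a (is_derive_id t (1 : R)).
  by rewrite /GRing.scale/= mulr1.
have := @is_derive1_comp _ sin (fun x => a * x) t _ _ (is_derive_sin _) h1.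
move=> /(is_deriveZ a^-1); rewrite /GRing.scale/= mulrCA mulVf// mulr1.
set f := (X in is_derive _ _ X); set g := (X in _ -> is_derive _ _ X _).
suff -> : f = g by [].
by apply/funext => x; rewrite /f /g mulrC.
Qed.

Lemma fejer_prim_half R (H : nat) :
  fejer_prim H (1 / 2 : R) = H%:R / 2.
Proof.
have e (k l : 'I_H) : (if k == l then 1 / 2 else
    sin (2 * pi * (k%:R - l%:R) * (1 / 2)) / (2 * pi * (k%:R - l%:R))) =
    (if k == l then 1 / 2 else 0) :> R.
  case: ifP => // _.
  have -> : 2 * pi * (k%:R - l%:R) * (1 / 2) = (k%:R - l%:R) * pi :> R by field.
  by rewrite sin_natB_pi mul0r.
rewrite /fejer_prim (eq_bigr (fun=> 1 / 2)).
  by rewrite sumr_const card_ord -[LHS]mulr_natl mulrA mulr1.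
move=> k _; rewrite (eq_bigr _ (fun l _ => e k l)) -big_mkcond/=.
by rewrite (eq_bigl (pred1 k)) ?big_pred1_eq// => l; rewrite /= eq_sym.
Qed.

Lemma fejer_primD1 R (H : nat) (t : R) (z : int) :
  fejer_prim H (t + z%:~R) = fejer_prim H t + H%:R * z%:~R.
Proof.
have -> : H%:R * z%:~R = \sum_(k < H) \sum_(l < H) (if k == l then z%:~R else 0) :> R.
  rewrite (eq_bigr (fun=> z%:~R)) ?sumr_const ?card_ord ?mulr_natl// => k _.
  by rewrite -big_mkcond/= (eq_bigl (pred1 k)) ?big_pred1_eq// => l; rewrite /= eq_sym.
rewrite -big_split/=; apply: eq_bigr => k _.
rewrite -big_split/=; apply: eq_bigr => l _.
case: ifP => // _; rewrite addr0; congr (_ / _).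
rewrite -[RHS](sinD_int_2pi ((k%:Z - l%:Z) * z)); congr sin.
rewrite intrM intrB -!pmulrn; ring.
Qed.

Lemma fejer_primN R (H : nat) (t : R) :
  fejer_prim H (- t) = - fejer_prim H t.
Proof.
rewrite /fejer_prim -sumrN; apply: eq_bigr => k _.
rewrite -sumrN; apply: eq_bigr => l _.
by case: ifP => // _; rewrite mulrN sinN mulNr.
Qed.

Lemma fejer_prim_homo R (H : nat) (s t : R) : s <= t ->
  fejer_prim H s <= fejer_prim H t.
Proof.
move=> st; have [z _ e] := mean_value st (fun x _ => is_derive_fejer_prim H x).
by rewrite -subr_ge0 e mulr_ge0 ?fejer_ge0 ?subr_ge0.
Qed.

Lemma fejer_prim0 R (H : nat) : fejer_prim H (0 : R) = 0.
Proof. by have := fejer_primN H (0 : R); rewrite oppr0; lra. Qed.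

Lemma fejer_prim_tail R (H : nat) (u : R) : 0 < u <= 1 / 2 ->
  0 <= H%:R / 2 - fejer_prim H u <= u^-1.
Proof.
move=> /andP[u0 u2]; rewrite -fejer_prim_half subr_ge0 fejer_prim_homo//=.
have D x : u <= x <= 1 / 2 ->
    is_derive x 1 (fejer_prim H + (fun y => y `^ (- 1))) (fejer H x + (- 1) * x `^ (- 1 - 1)).
  move=> /andP[h _]; apply: is_deriveD; first exact: is_derive_fejer_prim.
  by apply: is_derive1_powR; lra.
have [z /andP[z1 z2]] := mean_value u2 D.
rewrite -![(_ + _ : _ -> _) _]/(_ + _) !powR_inv1; [|lra..] => e.
have : fejer H z <= (z ^+ 2)^-1 by apply: fejer_le; lra.
have -> : (z ^+ 2)^-1 = z `^ (- 1 - 1).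
  by rewrite -powR_invn; [congr (_ `^ _); lra|lra].
have u2i : 0 < (1 / 2 : R)^-1 by rewrite invr_gt0; lra.
have u3 : 0 <= 1 / 2 - u by lra.
nra.
Qed.

Definition frac_part R (u : R) : R := u - (Num.floor u)%:~R.

Lemma frac_part_itv R (u : R) : 0 <= frac_part u < 1.
Proof.
rewrite /frac_part subr_ge0 ge_floor/= ltrBlDr addrC.
by have := lt_succ_floor u; rewrite intrD addrC.
Qed.

(** On [0, 1 / 2] the distance from the middle of the step is a tail of the
    integral of the kernel, and the kernel is at most the inverse square; the
    other half of the period follows by symmetry. The two terms measure the
    distances of u to 0 and to 1, in units of 1 / H. *)
Lemma staircase_error R (H j : nat) (u : R) : (0 < H)%N ->
  0 <= u < 1 -> j%:R <= H%:R * u < j.+1%:R ->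
  `|fejer_prim H u / H%:R - 1 / 2| <= 2 / j.+1%:R + 2 / (H%:R - j%:R).
Proof.
move=> H0 /andP[u0 u1] /andP[j1 j2].
have HR : 1 <= H%:R :> R by rewrite ler1n.
have jR : 0 <= j%:R :> R by [].
have jH : j%:R + 1 <= H%:R :> R.
  rewrite natr1 ler_nat; rewrite -(ltr_nat R); nra.
rewrite -natr1 in j2 *.
have half (v i : R) : 0 <= v <= 1 / 2 -> 0 <= i -> i <= H%:R * v <= i + 1 ->
    `|fejer_prim H v / H%:R - 1 / 2| <= 2 / (i + 1).
  move=> /andP[v0 v2] i0 /andP[i1 i2].
  have hp : fejer_prim H v <= H%:R / 2 by rewrite -fejer_prim_half fejer_prim_homo.
  have hp0 : 0 <= fejer_prim H v by rewrite -(fejer_prim0 R H) fejer_prim_homo.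
  rewrite ler0_norm; last by rewrite subr_le0 ler_pdivrMr; lra.
  have -> : - (fejer_prim H v / H%:R - 1 / 2) = (H%:R / 2 - fejer_prim H v) / H%:R.
    by field; lra.
  rewrite ler_pdivrMr; last lra.
  rewrite mulrAC ler_pdivlMr; last lra.
  have [i1'|i1'] := lerP i 1; first by nra.
  have v0' : 0 < v by nra.
  have /andP[_] : 0 <= H%:R / 2 - fejer_prim H v <= v^-1.
    by apply: fejer_prim_tail; rewrite v0'.
  rewrite -[v^-1]mul1r ler_pdivlMr// => h; nra.
have [u2|u2] := lerP u (1 / 2).
  apply: le_trans (half u j%:R _ _ _) _; rewrite ?u0 ?j1 ?(ltW j2)//.
  by rewrite lerDl divr_ge0; lra.
have Hu : fejer_prim H u = H%:R - fejer_prim H (1 - u).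
  have := @fejer_primD1 R H (- u) 1.
  rewrite fejer_primN mulr1 [- u + _]addrC => ->; ring.
have -> : fejer_prim H u / H%:R - 1 / 2 = - (fejer_prim H (1 - u) / H%:R - 1 / 2).
  by rewrite Hu; field; lra.
rewrite normrN.
have := half (1 - u) (H%:R - j%:R - 1).
rewrite subrK => h; apply: le_trans (h _ _ _) _; [lra|lra|apply/andP; split; lra|].
by rewrite lerDr divr_ge0; lra.
Qed.

Lemma exchange_sum3 R (I : Type) (r : seq I) (H : nat)
    (F : 'I_H -> 'I_H -> I -> R) :
  \sum_(i <- r) \sum_(k < H) \sum_(l < H) F k l i =
  \sum_(k < H) \sum_(l < H) \sum_(i <- r) F k l i.
Proof. by rewrite exchange_big; apply: eq_bigr => k _; rewrite exchange_big. Qed.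

Lemma expsum_diff R (I : Type) (r : seq I) (u : I -> R) (H : nat) (B : R) :
  (forall h, (0 < h < H)%N -> forall t,
    `|\sum_(i <- r) cos (2 * pi * h%:R * u i + t)| <= B) ->
  forall k l, (k < H)%N -> (l < H)%N -> k != l -> forall t,
    `|\sum_(i <- r) cos (2 * pi * (k%:R - l%:R) * u i + t)| <= B.
Proof.
move=> expsum k l kH lH kl t.
have [lk|lk] := leqP l k.
  by rewrite -natrB//; apply: expsum; lia.
rewrite (eq_bigr (fun i => cos (2 * pi * (l - k)%N%:R * u i - t))).
  by apply: expsum; lia.
move=> i _; rewrite natrB ?(ltnW lk)// -cosN; congr cos; ring.
Qed.

(** The diagonal of the kernel contributes H for each point, and every other
    term is an exponential sum. *)
Lemma sum_fejer_le R (I : Type) (r : seq I) (u : I -> R) (H : nat)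
    (B tau : R) : 0 <= B ->
  (forall h, (0 < h < H)%N -> forall t,
    `|\sum_(i <- r) cos (2 * pi * h%:R * u i + t)| <= B) ->
  \sum_(i <- r) fejer H (u i - tau) <= H%:R * (size r)%:R + H%:R ^+ 2 * B.
Proof.
move=> B0 /expsum_diff expsum; rewrite exchange_sum3.
apply: (@le_trans _ _ (\sum_(k < H) ((size r)%:R + \sum_(l < H) B))); last first.
  by rewrite !sumr_const !card_ord -(mulr_natr B) -(mulr_natr (_ + _)); lra.
apply: ler_sum => k _.
rewrite (bigD1 k)//= [X in _ <= _ + X](bigD1 k)//= addrA; apply: lerD.
  rewrite (eq_bigr (fun=> 1)).
    by rewrite big_const_seq count_predT iter_addr_0 lerDl.
  by move=> i _; rewrite subrr mulr0 mul0r cos0.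
apply: ler_sum => l lk; apply: le_trans (ler_norm _) _.
rewrite (eq_bigr (fun i => cos (2 * pi * (k%:R - l%:R) * u i +
   (- (2 * pi * (k%:R - l%:R) * tau))))); last by move=> i _; rewrite mulrBr.
by apply: expsum => //; rewrite eq_sym.
Qed.

(** The kernel centred at the middle of the arc majorises H ^ 2 / 4 times its
    indicator. *)
Lemma count_arc_le R (I : Type) (r : seq I) (u : I -> R) (H j : nat)
    (B : R) : 0 <= B -> (0 < H)%N ->
  (forall h, (0 < h < H)%N -> forall t,
    `|\sum_(i <- r) cos (2 * pi * h%:R * u i + t)| <= B) ->
  (count (fun i => j%:R <= H%:R * frac_part (u i) < j.+1%:R) r)%:R <=
    4 * ((size r)%:R / H%:R + B).
Proof.
move=> B0 H0 expsum; have HR : 1 <= H%:R :> R by rewrite ler1n.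
have := @sum_fejer_le _ _ r u H B ((2 * j%:R + 1) / (2 * H%:R)) B0 expsum.
set c := (X in (count X _)).
suff : (count c r)%:R * (H%:R ^+ 2 / 4) <=
    \sum_(i <- r) fejer H (u i - (2 * j%:R + 1) / (2 * H%:R)) :> R.
  move=> h1 /(le_trans h1); rewrite mulrA ler_pdivrMr// => h2.
  have H2 : 0 < H%:R ^+ 2 :> R by rewrite exprn_gt0//; lra.
  rewrite -(ler_pM2r H2); apply: le_trans h2 _.
  by rewrite le_eqVlt; apply/orP; left; apply/eqP; field; lra.
rewrite -sum1_count natr_sum mulr_suml [leRHS](bigID c)/=.
rewrite -[leLHS]addr0; apply: lerD; last by apply: sumr_ge0 => i _; exact: fejer_ge0.
apply: ler_sum => i /andP[c1 c2]; rewrite mul1r.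
rewrite -natr1 in c2.
rewrite -(@fejerD_int _ _ _ (- Num.floor (u i))).
apply: fejer_ge => //.
rewrite mulrNz.
have -> : u i - (2 * j%:R + 1) / (2 * H%:R) - (Num.floor (u i))%:~R =
  (2 * H%:R * frac_part (u i) - (2 * j%:R + 1)) / (2 * H%:R).
  by rewrite /frac_part; field; lra.
rewrite normrM normfV (ger0_norm (x := 2 * H%:R)); last lra.
rewrite ler_pdivrMr ?mulVf; [|lra..].
by rewrite ler_norml; apply/andP; split; lra.
Qed.

(** The smooth sawtooth is a trigonometric polynomial in which the coefficient
    of the frequency k - l is of the order of the inverse of k - l. *)
Lemma sum_smooth_sawtooth R (I : Type) (r : seq I) (u : I -> R) (H : nat)
    (B : R) : 0 <= B -> (0 < H)%N ->
  (forall h, (0 < h < H)%N -> forall t,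
    `|\sum_(i <- r) cos (2 * pi * h%:R * u i + t)| <= B) ->
  `|\sum_(i <- r) (fejer_prim H (u i) / H%:R - u i)| <= harmonic R H * B.
Proof.
move=> B0 H0 /expsum_diff expsum; have HR : 1 <= H%:R :> R by rewrite ler1n.
have pi2 := pi_ge2 R.
pose F (k l : 'I_H) i := if k == l then 0 else
    sin (2 * pi * (k%:R - l%:R) * u i) / (2 * pi * (k%:R - l%:R)).
have e i : fejer_prim H (u i) / H%:R - u i =
    (\sum_(k < H) \sum_(l < H) F k l i) / H%:R.
  have -> : fejer_prim H (u i) = H%:R * u i + \sum_(k < H) \sum_(l < H) F k l i.
    have -> : H%:R * u i = \sum_(k < H) \sum_(l < H) (if k == l then u i else 0).
      rewrite (eq_bigr (fun=> u i)) ?sumr_const ?card_ord ?mulr_natl// => k _.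
      by rewrite -big_mkcond/= (eq_bigl (pred1 k)) ?big_pred1_eq// => l; rewrite /= eq_sym.
    rewrite -big_split/=; apply: eq_bigr => k _; rewrite -big_split/=.
    by apply: eq_bigr => l _; rewrite /F; case: ifP; rewrite ?addr0 ?add0r.
  by field; lra.
rewrite (eq_bigr _ (fun i _ => e i)) -mulr_suml exchange_sum3.
rewrite normrM normfV (ger0_norm (x := H%:R)) ?ler_pdivrMr; [|lra..].
apply: le_trans (ler_norm_sum _ _ _) _.
have -> : harmonic R H * B * H%:R = \sum_(k < H) (harmonic R H * B).
  by rewrite sumr_const card_ord mulr_natr.
apply: ler_sum => k _; apply: le_trans (ler_norm_sum _ _ _) _.
apply: (@le_trans _ _ (\sum_(l < H | l != k :> nat) B / 4 * `|k%:R - l%:R : R|^-1)).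
  rewrite [leRHS]big_mkcond/=; apply: ler_sum => l _.
  have [kl|kl] := eqVneq (l : nat) k.
    have -> : l = k by exact/val_inj.
    by rewrite /F eqxx big1 ?normr0.
  have kln : (k == l) = false by apply: contra_neqF kl => /eqP ->.
  rewrite /F kln.
  rewrite -mulr_suml normrM normfV.
  have kl0 : 0 < `|k%:R - l%:R : R|.
    by rewrite normr_gt0 subr_eq0 eqr_nat eq_sym.
  rewrite [X in _ / X]normrM (ger0_norm (x := 2 * pi)); last lra.
  rewrite invfM mulrA; apply: ler_pM; rewrite ?invr_ge0//.
    by rewrite mulr_ge0// invr_ge0; lra.
  apply: ler_pM => //.
  - by rewrite invr_ge0; lra.
  - rewrite (eq_bigr (fun i => cos (2 * pi * (k%:R - l%:R) * u i + - (pi / 2)))).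
      by apply: expsum => //; rewrite eq_sym.
    by move=> i _; rewrite cosBpihalf.
  - by rewrite lef_pV2 ?posrE; lra.
rewrite -mulr_sumr; have := sum_inv_dist R (ltn_ord k).
set s := \sum_(_ < _ | _) _ => hs.
apply: (@le_trans _ _ (B / 4 * (2 * harmonic R H))).
  by rewrite ler_wpM2l// divr_ge0.
by have := mulr_ge0 (harmonic_ge0 R H) B0; lra.
Qed.

(** An inequality of Erdos-Turan type. The sawtooth is the error of the smooth
    staircase minus the smooth sawtooth. The sum of the errors is estimated by
    counting the points in each arc of length 1 / H, which costs a harmonic sum. *)
Lemma erdos_turan R (I : Type) (r : seq I) (u : I -> R) (H : nat)
    (B : R) : 0 <= B -> (0 < H)%N ->
  (forall h, (0 < h < H)%N -> forall t,
    `|\sum_(i <- r) cos (2 * pi * h%:R * u i + t)| <= B) ->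
  `|\sum_(i <- r) (frac_part (u i) - 1 / 2)| <=
    17 * harmonic R H * ((size r)%:R / H%:R + B).
Proof.
move=> B0 H0 expsum; have HR : 1 <= H%:R :> R by rewrite ler1n.
have Hh := harmonic_ge0 R H.
pose g i := fejer_prim H (frac_part (u i)) / H%:R - 1 / 2.
have e i : frac_part (u i) - 1 / 2 = g i - (fejer_prim H (u i) / H%:R - u i).
  have := fejer_primD1 H (frac_part (u i)) (Num.floor (u i)).
  by rewrite /g {1}/frac_part subrK => ->; rewrite /frac_part; field; lra.
rewrite (eq_bigr _ (fun i _ => e i)) sumrB.
apply: le_trans (ler_normB _ _) _.
have h1 := sum_smooth_sawtooth B0 H0 expsum.
suff : `|\sum_(i <- r) g i| <= 16 * harmonic R H * ((size r)%:R / H%:R + B).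
  have a0 : 0 <= (size r)%:R / H%:R :> R by rewrite divr_ge0.
  have : harmonic R H * B <= harmonic R H * ((size r)%:R / H%:R + B).
    by apply: ler_wpM2l => //; lra.
  set X := (_ / _ + B); move: h1; set Y := harmonic R H * B.
  rewrite -(mulrA 16) -(mulrA 17); set Z := harmonic R H * X; lra.
apply: le_trans (ler_norm_sum _ _ _) _.
pose arc (j : nat) i := j%:R <= H%:R * frac_part (u i) < j.+1%:R.
pose w (j : nat) : R := 2 / j.+1%:R + 2 / (H%:R - j%:R).
have w0 (j : 'I_H) : 0 <= w j.
  rewrite /w addr_ge0// divr_ge0// subr_ge0 ler_nat ltnW//.
apply: (@le_trans _ _ (\sum_(i <- r) \sum_(j < H) w j * (arc j i)%:R)).
  apply: ler_sum => i _.
  have /andP[f0 f1] := frac_part_itv (u i).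
  have Hf : 0 <= H%:R * frac_part (u i) by rewrite mulr_ge0//; lra.
  have /andP[t1 t2] := truncn_itv Hf.
  have tH : (Num.truncn (H%:R * frac_part (u i)) < H)%N.
    by rewrite -(ltr_nat R); apply: le_lt_trans t1 _; rewrite gtr_pMr; lra.
  rewrite (bigD1 (Ordinal tH))//= /arc t1 t2 mulr1.
  rewrite -[leLHS]addr0; apply: lerD; last first.
    by apply: sumr_ge0 => j _; rewrite mulr_ge0.
  by apply: staircase_error => //; rewrite ?f0 ?t1.
rewrite exchange_big/=.
apply: (@le_trans _ _ (\sum_(j < H) w j * (4 * ((size r)%:R / H%:R + B)))).
  apply: ler_sum => j _; rewrite -mulr_sumr ler_wpM2l//.
  apply: le_trans (count_arc_le j B0 H0 expsum).
  rewrite -sum1_count natr_sum [leRHS]big_mkcond/=.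
  by apply: ler_sum => i _; rewrite -/(arc _ _); case: (arc _ _).
rewrite -mulr_suml /w big_split/= -!mulr_sumr.
have -> : \sum_(i < H) (H%:R - i%:R : R)^-1 = harmonic R H.
  rewrite /harmonic -(big_mkord xpredT (fun d => (H%:R - d%:R : R)^-1)).
  rewrite -(big_mkord xpredT (fun d => (d.+1%:R : R)^-1)) [LHS]big_nat_rev/=.
  rewrite big_nat [RHS]big_nat; apply: eq_bigr => i /andP[_ iH].
  rewrite add0n -natrB ?leq_subr//; congr (_%:R)^-1; lia.
by rewrite -/(harmonic R H) le_eqVlt; apply/orP; left; apply/eqP; ring.
Qed.

(** * Exponential sums over sums of two floors *)

(** The steps of the phase are 2 pi h times differences of gaps at distance b' -
    b. The bound by 1 keeps them at most pi. *)
Lemma kusmin_landau_powR R (g X T b b' : R) (h p k : nat) :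
  0 < g < 1 -> 0 < T -> (0 < h)%N -> 0 <= b -> 1 <= b' - b ->
  h%:R * (b' - b) * T `^ (g - 2) <= 1 ->
  (forall a, (a < k)%N -> T + 1 <= X - (p + a)%N%:R - b') ->
  `|\sum_(a < k) cos (2 * pi * h%:R *
      ((X - (p + a)%N%:R - b) `^ g - (X - (p + a)%N%:R - b') `^ g))|
    <= 1 + X `^ (2 - g) / (g * (1 - g)) / (b' - b).
Proof.
move=> /[dup] g01 /andP[g0 g1] T0 h0 b0 bb' hbT hT.
have gg : 0 < g * (1 - g) by rewrite mulr_gt0//; lra.
have gg4 : g * (1 - g) <= 1 / 4 by have := sqr_ge0 (g - 1 / 2); rewrite expr2; lra.
have pi2 := pi_ge2 R.
have h1 : 1 <= h%:R :> R by rewrite ler1n.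
have [->|k0] := posnP k.
  by rewrite big_ord0 normr0 addr_ge0// !divr_ge0 ?powR_ge0//; lra.
have X0 : 0 < X.
  have := hT 0%N k0; have : 0 <= (p + 0)%N%:R :> R by []. lra.
pose d := b' - b.
pose t a : R := X - (p + a)%N%:R - b' - 1.
pose phi a := 2 * pi * h%:R *
  ((X - (p + a)%N%:R - b) `^ g - (X - (p + a)%N%:R - b') `^ g).
have e a : phi a.+1 - phi a = 2 * pi * h%:R * (gap g (t a) - gap g (t a + d)).
  rewrite /phi /gap -mulrBr addnS -(natr1 (p + a)%N); congr (_ * _).
  have -> : X - ((p + a)%N%:R + 1) - b = t a + d by rewrite /t /d; ring.
  have -> : X - ((p + a)%N%:R + 1) - b' = t a by rewrite /t; ring.
  have -> : X - (p + a)%N%:R - b = t a + d + 1 by rewrite /t /d; ring.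
  have -> : X - (p + a)%N%:R - b' = t a + 1 by rewrite /t; ring.
  by ring.
have tT a : (a < k)%N -> T <= t a by move=> /hT; rewrite /t; lra.
pose psi0 := pi * h%:R * (d * (g * (1 - g) * X `^ (g - 2))).
have d1 : 1 <= d by [].
have XX : 0 < X `^ (g - 2) by apply: powR_gt0.
have psi0_gt0 : 0 < psi0 by rewrite /psi0 !mulr_gt0//; lra.
have bnd a : (a < k)%N -> psi0 <= (phi a.+1 - phi a) / 2 <= pi / 2.
  move=> ak; have ta := tT _ ak.
  have /andP[l u] := gap_diff_bounds g01 (lt_le_trans T0 ta) (le_trans ler01 d1).
  rewrite e; have -> : 2 * pi * h%:R * (gap g (t a) - gap g (t a + d)) / 2 =
    pi * h%:R * (gap g (t a) - gap g (t a + d)) by field.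
  have ph : 0 <= pi * h%:R :> R by rewrite mulr_ge0//; lra.
  apply/andP; split.
    rewrite /psi0; apply: ler_wpM2l => //; apply: le_trans l.
    apply: ler_wpM2l; first lra.
    apply: ler_wpM2l; first lra.
    apply: ler_powR_base_anti; rewrite /t /d; [lra| |].
      by rewrite -/(t a) -/d; lra.
    by have : 0 <= (p + a)%N%:R :> R by []; lra.
  rewrite -mulrA; apply: ler_wpM2l; first lra.
  apply: (@le_trans _ _ (h%:R * (d * (g * (1 - g) * T `^ (g - 2))))).
    apply: ler_wpM2l; first lra.
    apply: le_trans u _; apply: ler_wpM2l; first lra.
    apply: ler_wpM2l; first lra.
    by apply: ler_powR_base_anti; lra.
  have -> : h%:R * (d * (g * (1 - g) * T `^ (g - 2))) =
     (g * (1 - g)) * (h%:R * d * T `^ (g - 2)) by ring.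
  have : 0 <= h%:R * d * T `^ (g - 2).
    by rewrite mulr_ge0 ?powR_ge0// mulr_ge0//; lra.
  by move: hbT; rewrite -/d; set Y := h%:R * d * _; nra.
have mon a : (a.+1 < k)%N -> phi a.+1 - phi a <= phi a.+2 - phi a.+1.
  move=> ak; rewrite !e; apply: ler_wpM2l; first by rewrite mulr_ge0//; lra.
  have -> : t a = t a.+1 + 1 by rewrite /t addnS -(natr1 (p + a)%N); ring.
  by apply: gap_convex => //; [have := tT _ ak; lra|lra].
have := kusmin_landau psi0_gt0 bnd mon.
move=> /le_trans; apply; rewrite lerD2l.
have -> : X `^ (2 - g) = (X `^ (g - 2))^-1 by rewrite -powRN opprB.
rewrite /psi0 -/d.
have -> : (X `^ (g - 2))^-1 / (g * (1 - g)) / d =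
    1 / (d * (g * (1 - g) * X `^ (g - 2))).
  by field; apply/and4P; split; rewrite gt_eqF//; lra.
set Y := d * _.
have Y0 : 0 < Y by rewrite /Y !mulr_gt0//; lra.
rewrite invfM mulrA ler_pM2r ?invr_gt0// ler_pdivrMr; first by nra.
by rewrite mulr_gt0//; lra.
Qed.

Definition nat_convex (Q : nat -> bool) :=
  forall i j l, (i <= j <= l)%N -> Q i -> Q l -> Q j.

Lemma nat_convexI (P Q : nat -> bool) :
  nat_convex P -> nat_convex Q -> nat_convex (fun a => P a && Q a).
Proof.
move=> cP cQ i j l ijl /andP[Pi Qi] /andP[Pl Ql].
by rewrite (cP i j l)// (cQ i j l).
Qed.

Lemma big_nat_convex R (Q : nat -> bool) (L : nat) : nat_convex Q ->
  exists p k, (forall F : nat -> R, \sum_(a < L | Q a) F a = \sum_(a < k) F (p + a)%N) /\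
    forall a, (a < k)%N -> Q (p + a)%N /\ (p + a < L)%N.
Proof.
move=> cQ.
have [|none] := boolP (has Q (iota 0 L)); last first.
  exists 0%N, 0%N; split => // F; rewrite big_ord0 big1// => a Qa.
  by move/hasPn: none => /(_ a); rewrite mem_iota Qa ltn_ord => /(_ isT).
move=> /hasP[x0]; rewrite mem_iota add0n => x0L Qx0.
have ex : exists a, Q a && (a < L)%N by exists x0; rewrite Qx0.
have bd a : Q a && (a < L)%N -> (a <= L)%N by move=> /andP[_ /ltnW].
case: (ex_minnP ex) => p /andP[Qp pL] pmin.
case: (ex_maxnP ex bd) => q /andP[Qq qL] qmax.
have pq : (p <= q)%N by apply: pmin; rewrite Qq.
exists p, (q.+1 - p)%N; split => [F|a ak]; last first.
  split; last by lia.
  by apply: (cQ p _ q) => //; lia.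
rewrite -(big_mkord Q F) -big_filter.
rewrite (perm_big (index_iota p q.+1)).
  by rewrite -{1}[p]add0n big_addn big_mkord; apply: eq_bigr => i _; rewrite addnC.
apply: uniq_perm; rewrite ?filter_uniq ?iota_uniq// => a.
rewrite mem_filter !mem_index_iota leq0n /=.
apply/andP/andP => [[Qa aL]|[pa aq]].
  by rewrite ltnS pmin ?qmax ?Qa ?aL.
split; last by lia.
by apply: (cQ p _ q) => //; lia.
Qed.

(** After Cauchy-Schwarz the summands are nonnegative, so the sum over the
    values of an increasing sequence can be extended to all integers. This
    replaces the floors by consecutive integers. *)
Lemma sum_subseq_le R (m : nat -> nat) (G : nat -> R) (M L : nat) :
  {homo m : i j / (i < j)%N} -> (forall a, 0 <= G a) ->
  (forall a, (L <= a)%N -> G a = 0) ->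
  \sum_(k < M) G (m k) <= \sum_(a < L) G a.
Proof.
move=> mm G0 GL.
have step n n' : (n <= n')%N -> \sum_(a < n) G a <= \sum_(a < n') G a.
  by move=> nn; rewrite -(subnKC nn) big_split_ord/= lerDl sumr_ge0.
apply: (@le_trans _ _ (\sum_(a < m M) G a)).
  elim: M => [|M IH]; first by rewrite big_ord0 sumr_ge0.
  rewrite big_ord_recr/=; apply: le_trans (step _ _ (mm _ _ (ltnSn M))).
  by rewrite big_ord_recr/= lerD2r.
have [mL|Lm] := leqP (m M) L; first exact: step.
rewrite -(subnKC (ltnW Lm)) big_split_ord/= gerDl big1// => i _.
by apply: GL; rewrite leq_addr.
Qed.

Lemma sqr_sum_le R (n : nat) (x : 'I_n -> R) :
  (\sum_(i < n) x i) ^+ 2 <= n%:R * \sum_(i < n) x i ^+ 2.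
Proof.
case: n x => [|n] x; first by rewrite !big_ord0 mul0r expr0n.
have n1 : 0 < n.+1%:R :> R by [].
set s := \sum_(i < n.+1) x i; set q := \sum_(i < n.+1) _.
have : 0 <= \sum_(i < n.+1) (x i - s / n.+1%:R) ^+ 2 by apply: sumr_ge0 => i _; exact: sqr_ge0.
rewrite (eq_bigr (fun i => x i ^+ 2 + ((- (2 * s / n.+1%:R)) * x i + (s / n.+1%:R) ^+ 2))); last first.
  by move=> i _; ring.
rewrite !big_split/= -mulr_sumr -/s -/q sumr_const card_ord.
rewrite -[X in _ + (_ + X)]mulr_natl.
have -> : q + (- (2 * s / n.+1%:R) * s + n.+1%:R * (s / n.+1%:R) ^+ 2) = q - s ^+ 2 / n.+1%:R.
  by field; rewrite gt_eqF.
by rewrite subr_ge0 ler_pdivrMr// mulrC.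
Qed.

Lemma big_ord_mul R (F : nat -> R) (n G : nat) :
  \sum_(k < n * G) F k = \sum_(i < n) \sum_(j < G) F (i * G + j)%N.
Proof.
elim: n => [|n IH]; first by rewrite mul0n !big_ord0.
by rewrite mulSnr big_split_ord/= IH big_ord_recr.
Qed.

(** Cauchy-Schwarz over k1, the extension to all integers a < L, and the opening
    of the square. The diagonal contributes L for each j. For j != j' the phase
    is a difference of two powers of a, and the bound of Kusmin and Landau is
    divided by the distance of the values of m, hence by the distance of j and
    j'. *)
Lemma expsum_block R (g X T : R) (m : nat -> nat) (M G L h : nat)
    (Q : nat -> nat -> bool) (k0 : nat) (t : R) :
  0 < g < 1 -> 0 < T -> (0 < h)%N -> {homo m : i j / (i < j)%N} ->
  (forall k, nat_convex (Q k)) ->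
  (forall k a, Q k a -> (a < L)%N /\ T + 1 <= X - a%:R - (m k)%:R) ->
  (forall k k' a a', (k < k' < k + G)%N -> Q k a -> Q k' a' ->
    h%:R * ((m k')%:R - (m k)%:R) * T `^ (g - 2) <= 1) ->
  (\sum_(j < G) \sum_(k1 < M | Q (k0 + j)%N (m k1))
     cos (2 * pi * h%:R * (X - (m k1)%:R - (m (k0 + j)%N)%:R) `^ g + t)) ^+ 2
  <= M%:R * (G%:R * (L%:R + G%:R + 2 * (X `^ (2 - g) / (g * (1 - g))) * harmonic R G)).
Proof.
move=> g01 T0 h0 mm cQ QL QT.
set W := X `^ (2 - g) / (g * (1 - g)).
have W0 : 0 <= W.
  by rewrite divr_ge0 ?powR_ge0// mulr_ge0//; lra.
pose th a j : R := 2 * pi * h%:R * (X - a%:R - (m (k0 + j)%N)%:R) `^ g.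
pose C a := \sum_(j < G | Q (k0 + j)%N a) cos (th a j + t).
pose S a := \sum_(j < G | Q (k0 + j)%N a) sin (th a j + t).
have -> : \sum_(j < G) \sum_(k1 < M | Q (k0 + j)%N (m k1))
     cos (2 * pi * h%:R * (X - (m k1)%:R - (m (k0 + j)%N)%:R) `^ g + t) =
   \sum_(k1 < M) C (m k1).
  by rewrite (exchange_big_dep predT).
apply: le_trans (sqr_sum_le _) _; apply: ler_wpM2l => //.
apply: (@le_trans _ _ (\sum_(a < L) (C a ^+ 2 + S a ^+ 2))).
  apply: (@le_trans _ _ (\sum_(a < L) C a ^+ 2)); last first.
    by apply: ler_sum => a _; rewrite lerDl sqr_ge0.
  apply: (sum_subseq_le (G := fun a => C a ^+ 2)) => // [a|a La]; first exact: sqr_ge0.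
  rewrite /C big1 ?expr0n// => j /QL[aL _].
  by move: La; rewrite leqNgt aL.
pose P (j j' : 'I_G) a := Q (k0 + j)%N a && Q (k0 + j')%N a.
have e a : C a ^+ 2 + S a ^+ 2 =
    \sum_(j < G) \sum_(j' < G) if P j j' a then cos (th a j - th a j') else 0.
  rewrite !expr2 !big_distrlr/= -big_split/= big_mkcond/=; apply: eq_bigr => j _.
  rewrite /P; case: (Q (k0 + j)%N a) => /=; last by rewrite big1.
  rewrite -big_split/= big_mkcond/=; apply: eq_bigr => j' _.
  by case: ifP => // _; rewrite -cosB; congr cos; ring.
rewrite (eq_bigr _ (fun (a : 'I_L) _ => e a)) exchange_sum3.
have -> : G%:R * (L%:R + G%:R + 2 * W * harmonic R G) =
    \sum_(j < G) (L%:R + G%:R + 2 * W * harmonic R G).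
  by rewrite sumr_const card_ord mulr_natl.
apply: ler_sum => j _.
rewrite (bigD1 j)//= -addrA; apply: lerD.
  apply: (@le_trans _ _ (\sum_(a < L) 1)); last by rewrite sumr_const card_ord.
  by apply: ler_sum => a _; case: ifP => // _; exact: cos_le1.
apply: (@le_trans _ _ (\sum_(j' < G | j' != j :> nat) (1 + W * `|j%:R - j'%:R : R|^-1))).
  rewrite [leRHS](eq_bigl (fun j' => j' != j)) //.
  apply: ler_sum => j' jj'; apply: le_trans (ler_norm _) _.
  rewrite -big_mkcond/=.
  have [p [k [hs hp]]] := @big_nat_convex R (P j j') L (nat_convexI (cQ _) (cQ _)).
  rewrite (hs (fun a => cos (th a j - th a j'))) {hs}.
  have [->|kn0] := posnP k.
    by rewrite big_ord0 normr0 addr_ge0// mulr_ge0// invr_ge0.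
  have [/andP[Qj Qj'] _] := hp 0%N kn0.
  wlog lt : j j' jj' p k kn0 Qj Qj' hp / (j < j')%N.
    move=> H; have [lt|gt|eq] := ltngtP j j'.
    - exact: (H j j' jj' p k).
    - rewrite distrC (eq_bigr (fun i : 'I_k => cos (th (p + i)%N j' - th (p + i)%N j))).
        apply: (H j' j _ p k) => //; first by rewrite eq_sym.
        by move=> a ak; have [/andP[h1 h2] h3] := hp a ak; rewrite /P h2 h1.
      by move=> i _; rewrite -cosN opprB.
    - by move: jj'; rewrite -(inj_eq val_inj)/= eq eqxx.
  have mjj : (m (k0 + j) + (j' - j) <= m (k0 + j'))%N.
    rewrite -(subnKC (ltnW lt)) addKn; elim: (j' - j)%N => [|i IH]; first by rewrite !addn0.
    by rewrite !addnS (leq_ltn_trans IH)// mm// addnA.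
  have mjjR : j'%:R - j%:R <= (m (k0 + j'))%:R - (m (k0 + j))%:R :> R.
    move: mjj; rewrite -(ler_nat R) natrD natrB ?(ltnW lt)//; lra.
  have j1 : 1 <= j'%:R - j%:R :> R.
    by rewrite lerBrDr addrC natr1 ler_nat.
  have := @kusmin_landau_powR R g X T (m (k0 + j))%:R (m (k0 + j'))%:R h p k g01 T0 h0.
  rewrite -/W => /(_ _ _ _ _) => K.
  rewrite (eq_bigr (fun a : 'I_k => cos (2 * pi * h%:R *
     ((X - (p + a)%N%:R - (m (k0 + j))%:R) `^ g - (X - (p + a)%N%:R - (m (k0 + j'))%:R) `^ g)))).
    apply: le_trans (K _ _ _ _) _ => //.
    - exact: le_trans mjjR.
    - by apply: QT Qj Qj'; rewrite !ltn_add2l lt/= -addnA ltn_add2l (leq_trans (ltn_ord j'))// leq_addl.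
    - by move=> a ak; have [/andP[_ /QL[_ +]] _] := hp a ak.
    rewrite lerD2l ler_wpM2l// distrC ger0_norm; last lra.
    by rewrite lef_pV2 ?posrE//; lra.
  by move=> a _; congr cos; rewrite /th mulrBr.
rewrite big_split/= -mulr_sumr; apply: lerD.
  rewrite sumr_const -mulr_natl mulr1 ler_nat.
  by rewrite (leq_trans (max_card _))// card_ord.
rewrite [leRHS](_ : _ = W * (2 * harmonic R G)); last by ring.
apply: ler_wpM2l => //.
exact: sum_inv_dist.
Qed.

(** One block of length G for each of the Nb blocks that cover the range of k2. *)
Lemma expsum_bound R (g X T : R) (m : nat -> nat) (M G Nb L h : nat)
    (Q : nat -> nat -> bool) (t : R) :
  0 < g < 1 -> 0 < T -> (0 < h)%N -> (M <= Nb * G)%N -> {homo m : i j / (i < j)%N} ->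
  (forall k, nat_convex (Q k)) ->
  (forall k a, Q k a -> [/\ (k < M)%N, (a < L)%N & T + 1 <= X - a%:R - (m k)%:R]) ->
  (forall k k', (k < k' < k + G)%N -> (k' < M)%N ->
    h%:R * ((m k')%:R - (m k)%:R) * T `^ (g - 2) <= 1) ->
  `|\sum_(k2 < M) \sum_(k1 < M | Q k2 (m k1))
     cos (2 * pi * h%:R * (X - (m k1)%:R - (m k2)%:R) `^ g + t)|
  <= Nb%:R * Num.sqrt (M%:R * (G%:R * (L%:R + G%:R +
       2 * (X `^ (2 - g) / (g * (1 - g))) * harmonic R G))).
Proof.
move=> g01 T0 h0 MG mm cQ QL QT.
pose F k2 := \sum_(k1 < M | Q k2 (m k1))
     cos (2 * pi * h%:R * (X - (m k1)%:R - (m k2)%:R) `^ g + t).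
have -> : \sum_(k2 < M) F k2 = \sum_(k2 < Nb * G) F k2.
  rewrite -(subnKC MG) big_split_ord/= [X in _ + X]big1 ?addr0// => i _.
  rewrite /F big_pred0// => k1; apply/negbTE/negP => /QL[+ _ _].
  by rewrite ltnNge leq_addr.
rewrite big_ord_mul; apply: le_trans (ler_norm_sum _ _ _) _.
rewrite -[Nb in leRHS]card_ord mulr_natl -sumr_const; apply: ler_sum => i _.
rewrite -sqrtr_sqr; apply: ler_wsqrtr.
apply: (expsum_block (T := T)) => // [k a /QL[] //|k k' a a' kk /QL[kM _ _] /QL[k'M _ _]].
exact: QT.
Qed.

Definition floorpow R (c : R) (k : nat) : nat :=
  Num.truncn (k%:R `^ c).

(** A strict bound for the coordinates of the points counted. *)
Definition side R (c : R) lam : nat :=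
  (Num.truncn (lam%:R `^ c^-1)).+2.

(** Pairs that leave less than lam ^ (4 / 5) for the third coordinate are
    treated trivially, since the phases move too fast there. *)
Definition cutoff R lam : nat :=
  (Num.truncn (16 * lam%:R `^ (4 / 5) : R)).+2.

(** Everything is measured by powers of this scale q: coordinates go up to
    q ^ 5, frequencies up to q, blocks have length q ^ 3, and the final error is
    q ^ (6 + 3 c) up to harmonic sums. *)
Definition unitscale R (c : R) lam : R := lam%:R `^ (5 * c)^-1.

Lemma truncn_bounds R (x : R) : 0 <= x ->
  (Num.truncn x)%:R <= x < (Num.truncn x)%:R + 1.
Proof. by move=> x0; rewrite natr1; exact: truncn_itv. Qed.

Lemma floorpow_itv R (c : R) (k : nat) :
  (floorpow c k)%:R <= k%:R `^ c < (floorpow c k)%:R + 1.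
Proof. by rewrite natr1; apply: truncn_itv; exact: powR_ge0. Qed.

Lemma floorpow_homo R (c : R) : 1 < c ->
  {homo floorpow c : i j / (i < j)%N}.
Proof.
move=> c1 i j ij; have /andP[a1 _] := floorpow_itv c i.
have /andP[_ b2] := floorpow_itv c j.
have h : i%:R `^ c + 1 <= j%:R `^ c.
  rewrite -[X in _ + X](powR1x c); apply: le_trans (powR_superadditive _ _ _) _; try lra.
    by [].
  by apply: ler_powR_base; [lra|rewrite addr_ge0|rewrite natr1 ler_nat].
have : (floorpow c i)%:R < (floorpow c j)%:R :> R by lra.
by rewrite ltr_nat.
Qed.

Lemma unitscale_ge1 R (c : R) lam : 1 < c -> (1 <= lam)%N ->
  1 <= unitscale c lam.
Proof.
move=> c1 l1; rewrite /unitscale -[X in X <= _](powR1x (5 * c)^-1).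
by apply: ler_powR_base => //; rewrite ?invr_ge0 ?ler1n//; lra.
Qed.

Lemma unitscaleE R (c x : R) lam : c != 0 ->
  lam%:R `^ x = unitscale c lam `^ (5 * c * x).
Proof.
move=> c0; rewrite /unitscale -powRrM; congr (_ `^ _); field; exact/eqP/eqP.
Qed.

Lemma root_unitscale R (c : R) lam : c != 0 ->
  lam%:R `^ c^-1 = unitscale c lam `^ 5.
Proof. by move=> c0; rewrite (unitscaleE _ _ c0) -mulrA divff// mulr1. Qed.

Lemma side_bounds R (c : R) lam : 1 < c -> (1 <= lam)%N ->
  unitscale c lam `^ 5 <= (side c lam)%:R <= 3 * unitscale c lam `^ 5.
Proof.
move=> c1 l1; have c0 : c != 0 by rewrite gt_eqF//; lra.
have e := root_unitscale lam c0.
have q1 : 1 <= unitscale c lam `^ 5.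
  by apply: powR_ge1 => //; exact: unitscale_ge1.
have -> : (side c lam)%:R = (Num.truncn (unitscale c lam `^ 5))%:R + 2 :> R.
  by rewrite /side e -addn2 natrD.
have q0 : 0 <= unitscale c lam `^ 5 by lra.
have /andP[h1 h2] := truncn_bounds q0.
by apply/andP; split; lra.
Qed.

Lemma floorpow_gap R (c : R) lam k k' :
  1 < c < 9 / 8 -> (1 <= lam)%N -> (k < k' < side c lam)%N ->
  k'%:R - k%:R <= unitscale c lam `^ 3 ->
  (floorpow c k')%:R - (floorpow c k)%:R <= 8 * unitscale c lam `^ (5 * c - 2).
Proof.
move=> /andP[c1 c2] l1 /andP[kk' k'M] kG.
have q1 := unitscale_ge1 c1 l1.
have /andP[_ qM] := side_bounds c1 l1.
move: q1 kG qM; move: (unitscale c lam) => q q1 kG qM; have q0 : 0 < q by lra.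
have /andP[a1 a2] := floorpow_itv c k; have /andP[b1 b2] := floorpow_itv c k'.
have k'k : k%:R <= k'%:R :> R by rewrite ler_nat ltnW.
have tg := @powR_tangent _ c k%:R k'%:R c1 (ler0n _ _) (ler0n _ _).
have kc : k'%:R `^ (c - 1) <= 2 * q `^ (5 * (c - 1)).
  apply: powR_side_le => //; first by rewrite c1.
  by rewrite ler0n; apply: le_trans qM; rewrite ler_nat ltnW.
have kk2 : k'%:R `^ (c - 1) * (k'%:R - k%:R) <= 2 * q `^ (5 * c - 2).
  have -> : q `^ (5 * c - 2) = q `^ (5 * (c - 1)) * q `^ 3.
    rewrite -powRD; first by congr (_ `^ _); ring.
    by rewrite (gt_eqF q0) implybT.
  by rewrite mulrA; apply: ler_pM => //; rewrite subr_ge0.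
have kk0 : 0 <= k'%:R `^ (c - 1) * (k'%:R - k%:R).
  by rewrite mulr_ge0 ?powR_ge0// subr_ge0.
have q52 : 1 <= q `^ (5 * c - 2).
  by apply: powR_ge1 => //; lra.
move: tg; have -> : c * k'%:R `^ (c - 1) * (k%:R - k'%:R) =
    - (c * (k'%:R `^ (c - 1) * (k'%:R - k%:R))) by ring.
move: kk2 kk0; set Z := k'%:R `^ (c - 1) * _ => kk2 kk0 tg.
have : c * Z <= 9 / 8 * Z by apply: ler_wpM2r => //; lra.
lra.
Qed.

Definition vdc_const R (c : R) : R :=
  3 + 8 / (c^-1 * (1 - c^-1)).

(** The exponent obtained is 2 + (5 + 3 + (10 c - 5)) / 2 = 5 c + 7 / 2, which
    is less than 6 + 3 c. *)
Lemma blocks_bound R (c q M G Nb X l hG hM : R) :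
  1 < c < 9 / 8 -> 1 <= q -> 0 <= M <= 3 * q `^ 5 -> 0 <= G <= q `^ 3 ->
  0 <= Nb <= 7 * q `^ 2 -> 0 <= X <= 2 * q `^ (5 * c) -> 0 <= l <= 2 * q `^ (5 * c) ->
  0 <= hG <= hM -> 1 <= hM ->
  Nb * Num.sqrt (M * (G * (l + G + 2 * (X `^ (2 - c^-1) / (c^-1 * (1 - c^-1))) * hG)))
  <= 7 * Num.sqrt (3 * vdc_const c) * hM * q `^ (6 + 3 * c).
Proof.
move=> /andP[c1 c2] q1 /andP[M0 qM] /andP[G0 qG] /andP[Nb0 qNb] /andP[X0 qX].
move=> /andP[l0 ql] /andP[hG0 hGM] hM1.
have c0 : c != 0 by rewrite gt_eqF//; lra.
set g := c^-1.
have g1 : g < 1 by rewrite /g invf_lt1//; lra.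
have g0 : 0 < g by rewrite invr_gt0; lra.
have gg0 : 0 < g * (1 - g) by rewrite mulr_gt0//; lra.
have gc : g * c = 1 by rewrite mulVf.
set K := vdc_const c.
have KE : K = 3 + 8 / (g * (1 - g)) by [].
have K0 : 0 < K by rewrite KE addr_gt0// divr_gt0.
have q0 : 0 < q by lra.
have hq x y : x <= y -> q `^ x <= q `^ y by move=> xy; exact: ler_powR.
have pD x y : q `^ x * q `^ y = q `^ (x + y).
  by rewrite powRD// (gt_eqF q0) implybT.
set Y := q `^ (10 * c - 5).
have Y0 : 0 <= Y by exact: powR_ge0.
have YY : q `^ (5 * c) <= Y by apply: hq; lra.
have i2 : G <= Y by apply: le_trans qG _; apply: hq; lra.
have i3 : X `^ (2 - g) <= 4 * Y.
  apply: (@le_trans _ _ ((2 * q `^ (5 * c)) `^ (2 - g))).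
    by apply: ler_powR_base => //; lra.
  rewrite (@powRM _ 2 (q `^ (5 * c))) ?powR_ge0// -powRrM.
  have -> : 5 * c * (2 - g) = 10 * c - 5 by rewrite mulrBr -[5 * c * g]mulrA (mulrC c g) gc; ring.
  rewrite -/Y; apply: ler_wpM2r => //.
  have -> : 4 = 2 `^ 2 :> R by rewrite (powR_mulrn 2)// expr2; lra.
  by apply: ler_powR; lra.
have i4 : 2 * (X `^ (2 - g) / (g * (1 - g))) * hG <= 8 / (g * (1 - g)) * Y * hM.
  apply: ler_pM => //; first by rewrite mulr_ge0// divr_ge0 ?powR_ge0// ltW.
  rewrite mulrA [leRHS]mulrAC ler_pM2r ?invr_gt0//; lra.
have i5 : Y <= Y * hM by rewrite ler_peMr.
set I := l + G + _.
have I0 : 0 <= I.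
  by rewrite /I !addr_ge0// mulr_ge0// mulr_ge0// divr_ge0 ?powR_ge0// ltW.
have inner : I <= K * Y * hM.
  rewrite /I KE; move: i4; set k := 8 / _; set W := 2 * _ * hG => i4.
  have -> : (3 + k) * Y * hM = 3 * (Y * hM) + k * Y * hM by ring.
  lra.
apply: (@le_trans _ _ (7 * q `^ 2 * Num.sqrt ((3 * K) * (hM * q `^ (10 * c + 3))))).
  apply: ler_pM => //.
  apply: ler_wsqrtr.
  have -> : 3 * K * (hM * q `^ (10 * c + 3)) = 3 * q `^ 5 * (q `^ 3 * (K * Y * hM)).
    have -> : 3 * q `^ 5 * (q `^ 3 * (K * Y * hM)) =
       3 * K * (hM * (q `^ 5 * q `^ 3 * Y)) by ring.
    by rewrite /Y !pD; congr (_ * (_ * (_ `^ _))); ring.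
  by apply: ler_pM => //; [rewrite mulr_ge0|apply: ler_pM].
rewrite sqrtrM; last by rewrite mulr_ge0// ltW.
have -> : Num.sqrt (hM * q `^ (10 * c + 3)) =
    Num.sqrt hM * Num.sqrt (q `^ (10 * c + 3)) by rewrite sqrtrM//; lra.
have s1 : Num.sqrt hM <= hM.
  rewrite -[leRHS]ger0_norm; last lra.
  rewrite -sqrtr_sqr ler_wsqrtr// expr2 ler_peMl; lra.
have s2 : Num.sqrt (q `^ (10 * c + 3)) = q `^ (5 * c + 3 / 2).
  by rewrite -powR12_sqrt ?powR_ge0// -powRrM; congr (_ `^ _); field.
rewrite s2.
have -> : 7 * q `^ 2 * (Num.sqrt (3 * K) * (Num.sqrt hM * q `^ (5 * c + 3 / 2))) =
  7 * Num.sqrt (3 * K) * (Num.sqrt hM * (q `^ 2 * q `^ (5 * c + 3 / 2))) by ring.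
rewrite pD -[leRHS]mulrA; apply: ler_wpM2l; first by rewrite mulr_ge0// sqrtr_ge0.
apply: ler_pM; [exact: sqrtr_ge0|exact: powR_ge0|by []|].
by apply: hq; lra.
Qed.

(** The exponents of the frequency, of the difference of the floors in a block,
    and of the second derivative add up to 1 + (5 c - 2) + (4 - 8 c) = 3 - 3 c <
    0. *)
Lemma step_condition R (c q h d : R) : 1 < c < 9 / 8 -> 1 <= q ->
  0 <= h <= 2 * q -> 0 <= d <= 8 * q `^ (5 * c - 2) ->
  h * d * (16 * q `^ (4 * c)) `^ (c^-1 - 2) <= 1.
Proof.
move=> /andP[c1 c2] q1 /andP[h0 hq2] /andP[d0 dq].
have c0 : c != 0 by rewrite gt_eqF//; lra.
have g1 : c^-1 < 1 by rewrite invf_lt1//; lra.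
have gc : c * c^-1 = 1 by rewrite mulfV.
have q0 : 0 < q by lra.
have Tg : (16 * q `^ (4 * c)) `^ (c^-1 - 2) <= 1 / 16 * q `^ (4 - 8 * c).
  rewrite (@powRM _ 16 (q `^ (4 * c))) ?powR_ge0// -powRrM.
  have -> : 4 * c * (c^-1 - 2) = 4 - 8 * c by rewrite mulrBr -mulrA gc; ring.
  apply: ler_wpM2r; first exact: powR_ge0.
  have -> : 1 / 16 = 16 `^ (- 1) :> R by rewrite powR_inv1 ?div1r.
  by apply: ler_powR; lra.
apply: (@le_trans _ _ (2 * q * (8 * q `^ (5 * c - 2)) * (1 / 16 * q `^ (4 - 8 * c)))).
  by apply: ler_pM; [rewrite mulr_ge0|exact: powR_ge0|exact: ler_pM|exact: Tg].
have -> : 2 * q * (8 * q `^ (5 * c - 2)) * (1 / 16 * q `^ (4 - 8 * c)) =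
  q `^ 1 * q `^ (5 * c - 2) * q `^ (4 - 8 * c).
  by rewrite powRr1 ?(ltW q0)//; field.
rewrite -!powRD ?(gt_eqF q0) ?implybT// -[X in _ <= X](powRr0 q).
by apply: ler_powR => //; lra.
Qed.

(** The inequality of Erdos-Turan type for frequencies up to about q, with the
    exponential sums bounded over blocks of length about q ^ 3. The term of the
    number of points is 9 q ^ 10 / q, which is at most 9 q ^ (6 + 3 c). *)
Lemma sawtooth_pairs R (c : R) : 1 < c < 9 / 8 ->
  exists2 C : R, 0 < C & forall (lam X : nat) (P : nat -> nat -> bool),
  (1 <= lam)%N -> (lam <= X <= lam.+1)%N ->
  (forall k2, nat_convex (P^~ k2)) ->
  (forall k1 k2, P k1 k2 -> [/\ (k1 < side c lam)%N, (k2 < side c lam)%N &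
     (floorpow c k1 + floorpow c k2 + cutoff R lam <= lam)%N]) ->
  `|\sum_(k2 < side c lam) \sum_(k1 < side c lam | P k1 k2)
     (frac_part (- ((X%:R - (floorpow c k1)%:R - (floorpow c k2)%:R) `^ c^-1)) - 1 / 2)|
  <= C * harmonic R (side c lam) ^+ 2 * unitscale c lam `^ (6 + 3 * c).
Proof.
move=> /andP[c1 c2]; have c0 : c != 0 by rewrite gt_eqF//; lra.
pose g := c^-1.
have g1 : g < 1 by rewrite /g invf_lt1//; lra.
have g0 : 0 < g by rewrite invr_gt0; lra.
have gg0 : 0 < g * (1 - g) by rewrite mulr_gt0//; lra.
have gc : g * c = 1 by rewrite mulVf.
pose K := vdc_const c.
exists (17 * (9 + 7 * Num.sqrt (3 * K))).
  by rewrite mulr_gt0// ltr_pwDl// mulr_ge0// sqrtr_ge0.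
move=> lam X P l1 /andP[lX Xl] cP hP.
set q := unitscale c lam; have q1 : 1 <= q by exact: unitscale_ge1.
have q0 : 0 < q by lra.
set M := side c lam; have /andP[Mq qM] := side_bounds c1 l1; rewrite -/q -/M in Mq qM.
have hq x y : x <= y -> q `^ x <= q `^ y by move=> xy; exact: ler_powR.
have pD x y : q `^ x * q `^ y = q `^ (x + y) by rewrite powRD// (gt_eqF q0) implybT.
have qx1 x : 0 <= x -> 1 <= q `^ x by exact: powR_ge1.
have lamq : lam%:R = q `^ (5 * c) :> R.
  by rewrite -[LHS]powRr1// (unitscaleE 1 lam c0) mulr1.
pose m := floorpow c.
have mm : {homo m : i j / (i < j)%N} by exact: floorpow_homo.
pose H := (Num.truncn q).+1.
have /andP[Hq qH] : q <= H%:R <= 2 * q.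
  have /andP[h1 h2] := truncn_bounds (ltW q0).
  have -> : H%:R = (Num.truncn q)%:R + 1 :> R by rewrite natr1.
  by apply/andP; split; lra.
pose G := Num.truncn (q `^ 3).
have q3 : 1 <= q `^ 3 by apply: qx1.
have /andP[Gq qG] : q `^ 3 / 2 <= G%:R <= q `^ 3.
  have q30 : 0 <= q `^ 3 by lra.
  have /andP[h1 h2] := truncn_bounds q30; rewrite -/G in h1 h2.
  have : (1 <= G)%N by rewrite truncn_gt0.
  by rewrite -(ler_nat R) h1 andbT; lra.
have G0 : (0 < G)%N by rewrite truncn_gt0.
pose Nb := (M %/ G).+1.
have MNb : (M <= Nb * G)%N by rewrite ltnW// ltn_ceil.
have Nbq : Nb%:R <= 7 * q `^ 2.
  have -> : Nb%:R = (M %/ G)%:R + 1 :> R by rewrite natr1.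
  have : (M %/ G)%:R * G%:R <= M%:R :> R by rewrite -natrM ler_nat leq_trunc_div.
  have e5 : q `^ 5 = q `^ 2 * q `^ 3 by rewrite pD; congr (_ `^ _); lra.
  have q2 : 1 <= q `^ 2 by apply: qx1.
  set d := (M %/ G)%:R => hd.
  have d0 : 0 <= d by rewrite /d.
  have : d * (q `^ 3 / 2) <= 3 * q `^ 5.
    by apply: le_trans qM; apply: le_trans hd; apply: ler_wpM2l.
  rewrite e5 mulrA ler_pdivrMr//.
  have -> : 3 * (q `^ 2 * q `^ 3) * 2 = 6 * q `^ 2 * q `^ 3 by ring.
  rewrite ler_pM2r; lra.
have GM : (G <= M)%N.
  rewrite -(ler_nat R); apply: le_trans qG _; apply: le_trans Mq; apply: hq; lra.
have HM : (H <= M)%N.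
  rewrite /H /M /side ltnS; apply: leq_trans (leqnSn _).
  have lq5 := root_unitscale lam c0.
  apply: le_truncn; rewrite lq5 -[X in X <= _]powRr1; last exact: ltW.
  by apply: hq; lra.
set hM := harmonic R M.
have hM1 : 1 <= hM.
  apply: le_trans (harmonic_homo R (leq_trans G0 GM)).
  by rewrite /harmonic big_ord1 invr1.
pose T := 16 * q `^ (4 * c).
have T0 : 0 < T by rewrite /T mulr_gt0// powR_gt0.
have cutT : T + 1 <= (cutoff R lam)%:R.
  rewrite /cutoff (unitscaleE _ _ c0) -/q (_ : 5 * c * (4 / 5) = 4 * c); last by field.
  have := truncnS_gt T; rewrite -/T -addn2 -addn1 !natrD; lra.
pose r := [seq (k1, k2) | k2 <- iota 0 M, k1 <- [seq k1 <- iota 0 M | P k1 k2]].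
have sumr F : \sum_(i <- r) F i.1 i.2 = \sum_(k2 < M) \sum_(k1 < M | P k1 k2) F k1 k2 :> R.
  rewrite /r big_allpairs_dep -(big_mkord xpredT (fun k2 => \sum_(k1 < M | P k1 k2) F k1 k2)).
  rewrite /index_iota subn0; apply: eq_bigr => k2 _.
  by rewrite big_filter -(big_mkord (P^~ k2) (fun k1 => F k1 k2)) /index_iota subn0.
pose u (i : nat * nat) := - ((X%:R - (m i.1)%:R - (m i.2)%:R) `^ g) : R.
rewrite -(sumr (fun k1 k2 => frac_part (- ((X%:R - (m k1)%:R - (m k2)%:R) `^ g)) - 1 / 2)).
pose B := Nb%:R * Num.sqrt (M%:R * (G%:R * (lam.+1%:R + G%:R +
       2 * (X%:R `^ (2 - g) / (g * (1 - g))) * harmonic R G))).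
have B0 : 0 <= B by rewrite mulr_ge0// sqrtr_ge0.
have H0 : (0 < H)%N by [].
have ex h : (0 < h < H)%N -> forall t, `|\sum_(i <- r) cos (2 * pi * h%:R * u i + t)| <= B.
  move=> /andP[h0 hH] t.
  rewrite (eq_bigr (fun i => cos (2 * pi * h%:R * (X%:R - (m i.1)%:R - (m i.2)%:R) `^ g - t))); last first.
    by move=> i _; rewrite -cosN; congr cos; rewrite /u; ring.
  rewrite (sumr (fun k1 k2 => cos (2 * pi * h%:R * (X%:R - (m k1)%:R - (m k2)%:R) `^ g - t))).
  (* The integers between two values of m on a section of P: this set is convex,
     and it contains the values of m on that section only. *)
  pose Q k a := [exists i : 'I_M, [exists j : 'I_M, [&& P i k, P j k & (m i <= a <= m j)%N]]].
  have QP k k1 : (k1 < M)%N -> Q k (m k1) = P k1 k.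
    move=> k1M; apply/existsP/idP => [[i /existsP[j /and3P[Pi Pj /andP[mi mj]]]]|Pk1].
      apply: (cP k i k1 j) => //.
      by apply/andP; split; rewrite leqNgt; apply/negP => /mm; rewrite ltnNge ?mi ?mj.
    by exists (Ordinal k1M); apply/existsP; exists (Ordinal k1M); rewrite /= Pk1 leqnn.
  have -> : \sum_(k2 < M) \sum_(k1 < M | P k1 k2)
      cos (2 * pi * h%:R * (X%:R - (m k1)%:R - (m k2)%:R) `^ g - t) =
    \sum_(k2 < M) \sum_(k1 < M | Q k2 (m k1))
      cos (2 * pi * h%:R * (X%:R - (m k1)%:R - (m k2)%:R) `^ g - t).
    by apply: eq_bigr => k2 _; apply: eq_bigl => k1; rewrite QP.
  apply: (expsum_bound (T := T)) => //.
  - by rewrite g0.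
  - move=> k i j l /andP[ij jl] /existsP[x /existsP[y /and3P[Px Py /andP[xi iy]]]].
    move=> /existsP[x' /existsP[y' /and3P[Px' Py' /andP[xl ly]]]].
    apply/existsP; exists x; apply/existsP; exists y'; rewrite Px Py'/=.
    by rewrite (leq_trans xi ij) (leq_trans jl ly).
  - move=> k a /existsP[x /existsP[y /and3P[Px Py /andP[xa ay]]]].
    have [_ kM cut] := hP _ _ Py; rewrite -/m in cut; split => //.
      by clear -ay cut; lia.
    have : (a + m k + cutoff R lam <= X)%N by clear -ay cut lX; lia.
    by rewrite -(ler_nat R) !natrD => cutR; clear -cutR cutT; lra.
  - move=> k k' /andP[kk' k'G] k'M.
    have mk : (m k')%:R - (m k)%:R <= 8 * q `^ (5 * c - 2).
      apply: floorpow_gap => //; rewrite ?c1 ?kk'//.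
      apply: le_trans qG; rewrite lerBlDr -natrD ler_nat addnC ltnW//.
    have mk0 : 0 <= (m k')%:R - (m k)%:R :> R by rewrite subr_ge0 ler_nat ltnW// mm.
    have hq2 : h%:R <= 2 * q :> R by apply: le_trans qH; rewrite ler_nat ltnW.
    by apply: step_condition; rewrite ?c1 ?q1 ?ler0n ?mk0.
have := erdos_turan B0 H0 ex.
move=> /le_trans; apply.
have sr : (size r)%:R <= 9 * q `^ 10.
  have : (size r <= M * M)%N.
    rewrite /r size_allpairs_dep sumnE big_map.
    apply: (@leq_trans (\sum_(j <- iota 0 M) M)).
      by apply: leq_sum => j _; rewrite size_filter (leq_trans (count_size _ _))// size_iota.
    by rewrite big_const_seq count_predT size_iota iter_addn addn0.
  rewrite -(ler_nat R) natrM => /le_trans; apply.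
  apply: (@le_trans _ _ ((3 * q `^ 5) * (3 * q `^ 5))).
    by apply: ler_pM.
  have -> : 3 * q `^ 5 * (3 * q `^ 5) = 9 * (q `^ 5 * q `^ 5) by ring.
  by rewrite pD ler_pM2l ?hq//; lra.
have sH : (size r)%:R / H%:R <= 9 * q `^ (6 + 3 * c).
  have H1 : 0 < H%:R :> R by lra.
  rewrite ler_pdivrMr//; apply: le_trans sr _.
  apply: (@le_trans _ _ (9 * q `^ (6 + 3 * c) * q `^ 1)).
    by rewrite -mulrA pD ler_pM2l// hq//; lra.
  by rewrite ler_pM2l ?powRr1 ?(ltW q0)// mulr_gt0// powR_gt0.
have harmHM : harmonic R H <= hM by exact: harmonic_homo.
have harmGM : harmonic R G <= hM by exact: harmonic_homo.
have Bq : B <= 7 * Num.sqrt (3 * K) * hM * q `^ (6 + 3 * c).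
  apply: blocks_bound => //.
  - by rewrite c1.
  - by rewrite ler0n.
  - by rewrite ler0n.
  - by rewrite ler0n.
  - by rewrite ler0n -lamq -natrM ler_nat; clear -Xl l1; lia.
  - by rewrite ler0n -lamq -natrM ler_nat; clear -l1; lia.
  - by rewrite harmonic_ge0.
set Y := q `^ (6 + 3 * c) in sH Bq *.
have Y0 : 0 <= Y by exact: powR_ge0.
set s := Num.sqrt (3 * K) in Bq *.
have s0 : 0 <= s by exact: sqrtr_ge0.
apply: (@le_trans _ _ (17 * hM * (9 * Y * hM + 7 * s * hM * Y))).
  apply: ler_pM.
  - by rewrite mulr_ge0 ?harmonic_ge0.
  - by rewrite addr_ge0// divr_ge0.
  - by rewrite ler_pM2l.
  apply: lerD => //; apply: le_trans sH _; rewrite ler_peMr// mulr_ge0//.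
by rewrite le_eqVlt; apply/orP; left; apply/eqP; ring.
Qed.

(** * Caps cut by a plane *)

Lemma spread_count R (P : nat -> bool) (M : nat) (D : R) : 0 <= D ->
  (forall k k', (k < k' < M)%N -> P k -> P k' -> k'%:R - k%:R <= D) ->
  \sum_(k < M) (P k)%:R <= D + 1.
Proof.
move=> D0 hD.
have [|none] := boolP (has P (iota 0 M)); last first.
  rewrite big1 ?addr_ge0// => k _.
  move/hasPn: none => /(_ k); rewrite mem_iota ltn_ord => /(_ isT).
  by move=> /negbTE ->.
move=> /hasP[x0]; rewrite mem_iota add0n => x0M Px0.
have ex : exists a, P a && (a < M)%N by exists x0; rewrite Px0.
have bd a : P a && (a < M)%N -> (a <= M)%N by move=> /andP[_ /ltnW].
case: (ex_minnP ex) => p /andP[Pp pM] pmin.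
case: (ex_maxnP ex bd) => r /andP[Pr rM] rmax.
have pr : (p <= r)%N by apply: pmin; rewrite Pr.
have pD : r%:R - p%:R <= D.
  move: pr; rewrite leq_eqVlt => /predU1P[->|pr]; first by rewrite subrr.
  by apply: hD => //; rewrite pr.
apply: (@le_trans _ _ (\sum_(k < M) (p <= k < r.+1)%N%:R)).
  apply: ler_sum => k _; have [Pk|//] := boolP (P k).
  by rewrite ltnS pmin ?rmax ?Pk ?ltn_ord.
rewrite -(big_mkord xpredT (fun k => (p <= k < r.+1)%N%:R : R)).
have pM' := ltnW pM; have pr' : (p <= r.+1)%N by exact: leqW.
rewrite (big_cat_nat (n := p))//= (big_cat_nat (n := r.+1) (m := p))//=.
rewrite [X in X + _]big_nat big1 => [|k /andP[_ kp]]; last by rewrite leqNgt kp.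
rewrite [X in _ + (_ + X)]big_nat [X in _ + (_ + X)]big1; last first.
  by move=> k /andP[kr _]; rewrite [(k < _)%N]ltnNge kr andbF.
rewrite add0r addr0 big_nat (eq_bigr (fun=> 1)) => [|k ->//].
rewrite -big_nat sumr_const_nat natrB; last by rewrite ltnW.
have -> : r.+1%:R = r%:R + 1 :> R by rewrite natr1.
lra.
Qed.

Lemma increments_ge R (u : nat -> R) (d : R) (i j : nat) : (i <= j)%N ->
  (forall k, (i <= k < j)%N -> d <= u k.+1 - u k) -> (j%:R - i%:R) * d <= u j - u i.
Proof.
move=> ij h; have -> : (j%:R - i%:R) * d = \sum_(i <= k < j) d.
  by rewrite sumr_const_nat -natrB// mulr_natl.
by rewrite -(telescope_sumr _ ij) !big_nat; apply: ler_sum => k; exact: h.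
Qed.

(** Where the slope s is at least e in absolute value, f crosses the strip of
    width 2 C0 within 2 C0 / e steps. Where it is less than e, the slope
    decreases by at least kappa at each step, so this range has at most 2 e /
    kappa steps. *)
Lemma slope_count R (f s : nat -> R) (M : nat) (V : nat -> bool)
    (b C0 e kappa : R) :
  0 <= C0 -> 0 < e -> 0 < kappa ->
  (forall i j, (0 < i <= j)%N -> V j -> V i) ->
  (forall k, (0 < k)%N -> V k.+1 -> s k.+1 <= f k.+1 - f k <= s k) ->
  (forall k, (0 < k)%N -> V k.+1 -> - e <= s k.+1 -> s k <= e -> kappa <= s k - s k.+1) ->
  \sum_(k < M) [&& (0 < k)%N, V k & `|f k - b| < C0]%:R
    <= 4 * C0 / e + 2 * e / kappa + 3.
Proof.
move=> C00 e0 k0 Vle sl cv.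
have sdec k : (0 < k)%N -> V k.+1 -> s k.+1 <= s k.
  by move=> k1 Vk; have := sl _ k1 Vk; lra.
have sdecs i j : (0 < i)%N -> (i <= j)%N -> V j -> s j <= s i.
  move=> i0; elim: j => [|j IH]; first by rewrite leqn0 => /eqP i00; rewrite i00 in i0.
  rewrite leq_eqVlt => /predU1P[->//|ij] Vj.
  have j0 : (0 < j)%N by exact: (leq_trans i0 ij).
  apply: le_trans (sdec _ j0 Vj) (IH ij _).
  by apply: (Vle _ j.+1); rewrite ?j0 ?leqnSn.
pose U k := [&& (0 < k)%N, V k & `|f k - b| < C0].
pose U1 k := U k && (e <= s k).
pose U2 k := U k && (s k <= - e).
pose U3 k := U k && (- e <= s k <= e).
apply: (@le_trans _ _ (\sum_(k < M) ((U1 k)%:R + ((U2 k)%:R + (U3 k)%:R)))).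
  apply: ler_sum => k _; rewrite -/(U k) /U1 /U2 /U3.
  case: (U k) => //=; rewrite ?addr0//.
  have [h1|h1] := lerP e (s k); first by rewrite lerDl addr_ge0.
  have [h2|h2] := lerP (s k) (- e); first by rewrite add0r lerDl.
  by rewrite (ltW h1) (ltW h2) !add0r.
rewrite !big_split/=.
have mid i j k : (0 < i)%N -> V j -> (i <= k < j)%N ->
    [/\ (0 < k)%N, V k.+1, s j <= s k.+1 & s k <= s i].
  move=> i0 Vj /andP[ik kj]; have Vk : V k.+1 by apply: (Vle _ j); rewrite ?kj.
  have k10 := leq_trans i0 ik; split => //; first exact: sdecs.
  by apply: sdecs => //; apply: (Vle _ k.+1); rewrite ?k10 ?leqnSn.
have close i j : U i -> U j -> `|f j - f i| <= 2 * C0.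
  move=> /and3P[_ _ fi] /and3P[_ _ fj]; move: fi fj.
  rewrite !ltr_norml ler_norml => /andP[f1 f2] /andP[f3 f4]; clear -f1 f2 f3 f4.
  by apply/andP; split; lra.
have U1c : \sum_(k < M) (U1 k)%:R <= 2 * C0 / e + 1.
  apply: spread_count; first by rewrite divr_ge0// ?mulr_ge0// ltW.
  move=> i j /andP[ij _] /andP[Ui _] /andP[Uj sj]; rewrite ler_pdivlMr//.
  apply: le_trans (le_trans (ler_norm _) (close _ _ Ui Uj)).
  apply: increments_ge => [|k kij]; first exact: ltnW.
  have [/and3P[i0 _ _] /and3P[_ Vj _]] := (Ui, Uj).
  have [k1 Vk h _] := mid _ _ _ i0 Vj kij; have /andP[h1 _] := sl _ k1 Vk.
  by clear -h h1 sj; lra.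
have U2c : \sum_(k < M) (U2 k)%:R <= 2 * C0 / e + 1.
  apply: spread_count; first by rewrite divr_ge0// ?mulr_ge0// ltW.
  move=> i j /andP[ij _] /andP[Ui si] /andP[Uj _]; rewrite ler_pdivlMr//.
  apply: le_trans (le_trans (ler_norm _) (close _ _ Uj Ui)).
  have -> : f i - f j = - f j - - f i by rewrite opprK addrC.
  apply: (@increments_ge _ (fun k => - f k)) => [|k kij]; first exact: ltnW.
  have [/and3P[i0 _ _] /and3P[_ Vj _]] := (Ui, Uj).
  have [k1 Vk _ h] := mid _ _ _ i0 Vj kij; have /andP[_ h1] := sl _ k1 Vk.
  by clear -h h1 si; lra.
have U3c : \sum_(k < M) (U3 k)%:R <= 2 * e / kappa + 1.
  apply: spread_count; first by rewrite divr_ge0// ?mulr_ge0// ltW.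
  move=> i j /andP[ij _] /andP[Ui /andP[_ si]] /andP[Uj /andP[sj _]].
  rewrite ler_pdivlMr//.
  apply: (@le_trans _ _ (- s j - - s i)); last by clear -si sj; lra.
  apply: (@increments_ge _ (fun k => - s k)) => [|k kij]; first exact: ltnW.
  have [/and3P[i0 _ _] /and3P[_ Vj _]] := (Ui, Uj).
  have [k1 Vk h h'] := mid _ _ _ i0 Vj kij.
  have := cv _ k1 Vk (le_trans sj h) (le_trans h' si).
  by clear; lra.
have -> : 4 * C0 / e = 2 * C0 / e + 2 * C0 / e by field; rewrite gt_eqF.
clear -U1c U2c U3c; lra.
Qed.

(** The third coordinate of the point of the surface |x|_c ^ c = lam + 2 above
    (k1, k2). The shift by 2 compensates the two floors and keeps the base of
    the power at least 1 for inner pairs. *)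
Definition height R (c : R) lam k1 k2 : R :=
  (lam%:R + 2 - k1%:R `^ c - k2%:R `^ c) `^ c^-1.

(** The value at this point of the linear form that cuts the cap. *)
Definition level R (c : R) lam (e1 e2 e3 : R) k1 k2 : R :=
  e1 * k1%:R + e2 * k2%:R + e3 * height c lam k1 k2.

Definition inner_pair R (c : R) lam k1 k2 : bool :=
  (floorpow c k1 + floorpow c k2 + cutoff R lam <= lam)%N.

(** Minus the derivative of the height with respect to k1. *)
Definition slope R (c : R) lam k1 k2 : R :=
  k1%:R `^ (c - 1) / height c lam k1 k2 `^ (c - 1).

Lemma inner_pair_base R (c : R) lam k1 k2 :
  inner_pair c lam k1 k2 -> 1 <= lam%:R + 2 - k1%:R `^ c - k2%:R `^ c.
Proof.
rewrite /inner_pair => h.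
have {}h : (floorpow c k1)%:R + (floorpow c k2)%:R + (1 : R) <= lam%:R.
  by rewrite -natrD natr1 ler_nat (leq_trans _ h)// -addn1 leq_add2l.
have /andP[_ a] := floorpow_itv c k1; have /andP[_ b] := floorpow_itv c k2.
lra.
Qed.

Lemma inner_pair_le R (c : R) lam i j k2 : 1 < c ->
  (i <= j)%N -> inner_pair c lam j k2 -> inner_pair c lam i k2.
Proof.
move=> c1; rewrite leq_eqVlt => /predU1P[->//|ij]; rewrite /inner_pair.
by have := floorpow_homo c1 ij => /ltnW h; apply: leq_trans; rewrite !leq_add2r.
Qed.

Lemma inner_pairC R (c : R) lam k1 k2 :
  inner_pair c lam k1 k2 = inner_pair c lam k2 k1.
Proof. by rewrite /inner_pair (addnC (floorpow c k1)). Qed.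

Lemma heightC R (c : R) lam k1 k2 :
  height c lam k1 k2 = height c lam k2 k1.
Proof. by rewrite /height; congr (_ `^ _); lra. Qed.

Lemma height_ge1 R (c : R) lam k1 k2 : 1 < c ->
  inner_pair c lam k1 k2 -> 1 <= height c lam k1 k2.
Proof.
move=> c1 /inner_pair_base h; rewrite -[X in X <= _](powR1x c^-1).
by apply: ler_powR_base => //; rewrite invr_ge0; lra.
Qed.

Lemma height_pow R (c : R) lam k1 k2 : 1 < c ->
  inner_pair c lam k1 k2 ->
  height c lam k1 k2 `^ c = lam%:R + 2 - k1%:R `^ c - k2%:R `^ c.
Proof.
by move=> c1 /inner_pair_base h; rewrite powRVK ?gt_eqF//; lra.
Qed.

(** Adding the tangent inequalities for the power c in both coordinates: the
    level curve lies below its tangent line since the ball is convex. *)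
Lemma level_curve_tangent R (c x z x0 z0 : R) : 1 < c ->
  0 <= x -> 0 <= z -> 0 <= x0 -> 0 < z0 -> x `^ c + z `^ c = x0 `^ c + z0 `^ c ->
  z <= z0 - x0 `^ (c - 1) / z0 `^ (c - 1) * (x - x0).
Proof.
move=> c1 hx hz hx0 hz0 e.
have t1 := powR_tangent c1 hx hx0.
have t2 := powR_tangent c1 hz (ltW hz0).
have p0 : 0 < z0 `^ (c - 1) by exact: powR_gt0.
rewrite lerBrDl -lerBrDr -(ler_pM2l p0).
have -> : z0 `^ (c - 1) * (z0 - z) = - (z0 `^ (c - 1) * (z - z0)) by ring.
have -> : z0 `^ (c - 1) * (x0 `^ (c - 1) / z0 `^ (c - 1) * (x - x0)) =
   x0 `^ (c - 1) * (x - x0) by field; rewrite gt_eqF.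
move: t1 t2; rewrite -!mulrA; set A := x0 `^ _ * _; set B := z0 `^ _ * _ => t1 t2.
have : c * (A + B) <= 0 by rewrite mulrDr; lra.
rewrite pmulr_rle0; lra.
Qed.

Lemma height_tangent R (c : R) lam i j k2 : 1 < c ->
  inner_pair c lam i k2 -> inner_pair c lam j k2 ->
  height c lam i k2 <= height c lam j k2 - slope c lam j k2 * (i%:R - j%:R).
Proof.
move=> c1 vi vj; rewrite /slope.
have hi := height_pow c1 vi; have hj := height_pow c1 vj.
have gi := height_ge1 c1 vi; have gj := height_ge1 c1 vj.
move: hi hj gi gj; set zi := height c lam i k2; set zj := height c lam j k2.
clearbody zi zj => hi hj gi gj.
have z0 : 0 < zj by lra.
have zi0 : 0 <= zi by lra.
by apply: (level_curve_tangent c1 (ler0n _ i) zi0 (ler0n _ j) z0); lra.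
Qed.

(** For e3 >= 0 the level is a concave function of k1, so that the k1 above a
    given level form an interval. *)
Lemma level_quasiconcave R (c : R) lam (e1 e2 e3 : R)
    i j l k2 : 1 < c -> 0 <= e3 -> (i <= j <= l)%N ->
  inner_pair c lam l k2 ->
  Num.min (level c lam e1 e2 e3 i k2) (level c lam e1 e2 e3 l k2) <=
    level c lam e1 e2 e3 j k2.
Proof.
move=> c1 e30 /andP[ij jl] vl.
have vj := inner_pair_le c1 jl vl; have vi := inner_pair_le c1 ij vj.
have ti := height_tangent c1 vi vj; have tl := height_tangent c1 vl vj.
rewrite ge_min /level.
have {}ti := ler_wpM2l e30 ti; have {}tl := ler_wpM2l e30 tl.
have ijR : i%:R <= j%:R :> R by rewrite ler_nat.
have jlR : j%:R <= l%:R :> R by rewrite ler_nat.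
move: ti tl; set zi := height _ _ i _; set zj := height _ _ j _; set zl := height _ _ l _.
set y := slope _ _ _ _; rewrite !mulrBr => ti tl.
have [s0|s0] := lerP 0 (e1 - e3 * y).
  have h : 0 <= (e1 - e3 * y) * (j%:R - i%:R) by rewrite mulr_ge0// subr_ge0.
  by apply/orP; left; clear -h ti; lra.
have h : (e1 - e3 * y) * (l%:R - j%:R) <= 0.
  by rewrite mulr_le0_ge0 ?subr_ge0// ltW.
by apply/orP; right; clear -h tl; lra.
Qed.

(** The power c - 1 has derivative (c - 1) * x `^ (c - 2) at some x between k
    and k + 1, and x, z <= Z. If e3 is not small this suffices. If e3 times the
    slope is not small, compare with the slope: the ratio is (c - 1) * x `^ (c -
    2) / k `^ (c - 1). *)
Lemma curvature_bound R (c k z z' Z e3 : R) : 1 < c < 2 ->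
  0 < k -> 0 < z' -> z' <= z -> z <= Z -> k + 1 <= Z -> 0 <= e3 ->
  1 / 4 <= e3 \/ 1 / 4 <= e3 * (k `^ (c - 1) / z `^ (c - 1)) ->
  (c - 1) / (4 * Z) <=
    e3 * ((k + 1) `^ (c - 1) / z' `^ (c - 1) - k `^ (c - 1) / z `^ (c - 1)).
Proof.
move=> /andP[c1 c2] k0 z'0 z'z zZ kZ e30 alt.
have z0 : 0 < z by lra.
have Z0 : 0 < Z by lra.
have [x /andP[kx xk] gx] := gap_mvt (c - 1) k0.
have x0 : 0 < x by lra.
have pz : 0 < z `^ (c - 1) by exact: powR_gt0.
have pz' : 0 < z' `^ (c - 1) by exact: powR_gt0.
have pk : 0 < k `^ (c - 1) by exact: powR_gt0.
have pZ : 0 < Z `^ (c - 1) by exact: powR_gt0.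
have gE : (k + 1) `^ (c - 1) = k `^ (c - 1) + (c - 1) * x `^ (c - 2).
  move: gx; rewrite /gap; have -> : c - 1 - 1 = c - 2 by ring.
  lra.
have px : 0 < x `^ (c - 2) by exact: powR_gt0.
have low : (c - 1) * x `^ (c - 2) / z `^ (c - 1) <=
    (k + 1) `^ (c - 1) / z' `^ (c - 1) - k `^ (c - 1) / z `^ (c - 1).
  rewrite lerBrDr -mulrDl [_ + k `^ _]addrC -gE; apply: ler_wpM2l; first exact: powR_ge0.
  by rewrite lef_pV2 ?posrE//; apply: ler_powR_base; lra.
apply: le_trans (ler_wpM2l e30 low).
have e4 : (c - 1) / (4 * Z) = 1 / 4 * ((c - 1) / Z) by field; rewrite gt_eqF.
have cc : 0 <= (c - 1) / Z by rewrite divr_ge0//; lra.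
rewrite e4; case: alt => alt.
  apply: ler_pM => //.
  rewrite -mulrA ler_pM2l; last by lra.
  rewrite ler_pdivlMr//.
  have -> : Z^-1 = Z `^ (- 1) by rewrite powR_inv1// ltW.
  apply: (@le_trans _ _ (Z `^ (- 1) * Z `^ (c - 1))).
    by apply: ler_wpM2l; [exact: powR_ge0|apply: ler_powR_base; lra].
  rewrite -powRD ?(gt_eqF Z0) ?implybT//.
  have -> : - 1 + (c - 1) = c - 2 by ring.
  by apply: ler_powR_base_anti; lra.
have -> : e3 * ((c - 1) * x `^ (c - 2) / z `^ (c - 1)) =
  e3 * (k `^ (c - 1) / z `^ (c - 1)) * ((c - 1) * (x `^ (c - 2) / k `^ (c - 1))).
  by field; rewrite !gt_eqF.
apply: ler_pM => //.
rewrite ler_pM2l; last by lra.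
rewrite ler_pdivlMr//.
have -> : Z^-1 = Z `^ (- 1) by rewrite powR_inv1// ltW.
apply: (@le_trans _ _ (x `^ (- 1) * x `^ (c - 1))).
  apply: ler_pM; [exact: powR_ge0|exact: powR_ge0| |].
    by apply: ler_powR_base_anti; lra.
  by apply: ler_powR_base; lra.
rewrite -powRD ?(gt_eqF x0) ?implybT//.
by have -> : - 1 + (c - 1) = c - 2 by ring.
Qed.

(** The power c expands the distances to a point at least 1, so the error of the
    height is at most that of its power. *)
Lemma powR_dist R (c x z : R) : 1 < c -> 0 <= x -> 1 <= z ->
  `|x - z| <= `|x `^ c - z `^ c|.
Proof.
move=> c1 x0 z1.
have key (u v : R) : 0 <= u -> u <= v -> 1 <= v -> v - u <= v `^ c - u `^ c.
  move=> u0 uv v1.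
  have v0 : 0 <= v by lra.
  rewrite -!(@mulr_powRB1 _ _ c)//; try lra.
  have h1 : u * u `^ (c - 1) <= u * v `^ (c - 1).
    by apply: ler_wpM2l => //; apply: ler_powR_base; lra.
  have h2 : 1 <= v `^ (c - 1).
    by rewrite -[X in X <= _](powR1x (c - 1)); apply: ler_powR_base; lra.
  have h3 : (v - u) * 1 <= (v - u) * v `^ (c - 1) by apply: ler_wpM2l => //; lra.
  lra.
have [xz|/ltW zx] := lerP x z.
  by rewrite (distrC (x `^ c)); exact: le_trans (key _ _ x0 xz z1) (ler_norm _).
exact: le_trans (key z x (le_trans ler01 z1) zx (le_trans z1 zx)) (ler_norm _).
Qed.

Lemma inner_pair_side R (c : R) lam k1 k2 : 1 < c ->
  (1 <= lam)%N -> inner_pair c lam k1 k2 -> k1%:R + 1 <= 3 * unitscale c lam `^ 5.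
Proof.
move=> c1 l1 h.
have c0 : c != 0 by rewrite gt_eqF//; lra.
have e := root_unitscale lam c0.
have q1 : 1 <= unitscale c lam `^ 5.
  by apply: powR_ge1 => //; exact: unitscale_ge1.
have h1 : (floorpow c k1)%:R + 1 <= lam%:R :> R.
  rewrite natr1 ler_nat; move: h; rewrite /inner_pair => h.
  by apply: leq_trans h; rewrite -addnA -addn1 leq_add2l addn_gt0 orbT.
have /andP[_ a] := floorpow_itv c k1.
have : k1%:R <= lam%:R `^ c^-1.
  rewrite -[X in X <= _](@powRK _ c)//; apply: ler_powR_base; last by lra.
    by rewrite invr_ge0; lra.
  exact: powR_ge0.
rewrite e; lra.
Qed.

Lemma cell_pow_le R (c q k x : R) : 1 < c < 9 / 8 -> 1 <= q ->
  0 <= k -> k + 1 <= 3 * q `^ 5 -> k <= x <= k + 1 ->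
  k `^ c <= x `^ c <= k `^ c + 5 / 2 * q `^ (5 * (c - 1)).
Proof.
move=> c12 q1 k0 kq /andP[kx xk]; have /andP[c1 c2] := c12.
rewrite ler_powR_base//=; last by lra.
have k10 : 0 <= k + 1 by lra.
have p := powR_side_le c12 q1 (x := k + 1); rewrite k10 kq in p.
have {}p := p isT.
have t := powR_tangent c1 k0 k10.
have h : x `^ c <= (k + 1) `^ c by apply: ler_powR_base; lra.
move: t; have -> : c * (k + 1) `^ (c - 1) * (k - (k + 1)) = - (c * (k + 1) `^ (c - 1)).
  by ring.
move: p; set P := (k + 1) `^ (c - 1) => p t.
have P0 : 0 <= P by exact: powR_ge0.
have : c * P <= 9 / 8 * P by apply: ler_wpM2r => //; lra.
have := powR_ge0 q (5 * (c - 1)).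
by move=> h3 h2; clear -t h h2 h3 p; lra.
Qed.

(** Over a unit cell the powers of the first two coordinates vary by O(q ^ (5 (c
    - 1))), which dominates the width of the shell. *)
Lemma cell_height R (c : R) lam k1 k2 (x1 x2 x3 : R) :
  1 < c < 9 / 8 -> (1 <= lam)%N -> inner_pair c lam k1 k2 ->
  k1%:R <= x1 <= k1%:R + 1 -> k2%:R <= x2 <= k2%:R + 1 -> 0 <= x3 ->
  lam%:R <= x1 `^ c + x2 `^ c + x3 `^ c <= lam%:R + 3 ->
  `|x3 - height c lam k1 k2| <= 7 * unitscale c lam `^ (5 * (c - 1)).
Proof.
move=> c12 l1 v hx1 hx2 x30 /andP[s1 s2]; have /andP[c1 c2] := c12.
have v' : inner_pair c lam k2 k1 by rewrite inner_pairC.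
have q1 := unitscale_ge1 c1 l1.
have b1 := inner_pair_side c1 l1 v; have b2 := inner_pair_side c1 l1 v'.
have /andP[p1 p1'] := cell_pow_le c12 q1 (ler0n _ k1) b1 hx1.
have /andP[p2 p2'] := cell_pow_le c12 q1 (ler0n _ k2) b2 hx2.
apply: le_trans (powR_dist c1 x30 (height_ge1 c1 v)) _.
rewrite height_pow//.
have Q1 : 1 <= unitscale c lam `^ (5 * (c - 1)).
  by apply: powR_ge1 => //; lra.
rewrite ler_norml; apply/andP; split; lra.
Qed.

Lemma cell_level R (c : R) lam k1 k2 (e1 e2 e3 x1 x2 x3 : R) :
  1 < c < 9 / 8 -> (1 <= lam)%N -> inner_pair c lam k1 k2 ->
  `|e1| <= 1 -> `|e2| <= 1 -> `|e3| <= 1 ->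
  k1%:R <= x1 <= k1%:R + 1 -> k2%:R <= x2 <= k2%:R + 1 -> 0 <= x3 ->
  lam%:R <= x1 `^ c + x2 `^ c + x3 `^ c <= lam%:R + 3 ->
  `|e1 * x1 + e2 * x2 + e3 * x3 - level c lam e1 e2 e3 k1 k2|
    <= 9 * unitscale c lam `^ (5 * (c - 1)).
Proof.
move=> c12 l1 v n1 n2 n3 hx1 hx2 x30 hs; have /andP[c1 _] := c12.
have h := cell_height c12 l1 v hx1 hx2 x30 hs.
have Q1 : 1 <= unitscale c lam `^ (5 * (c - 1)).
  by apply: powR_ge1; [exact: unitscale_ge1|lra].
rewrite /level; move: h; set z := height _ _ _ _ => h.
have -> : e1 * x1 + e2 * x2 + e3 * x3 - (e1 * k1%:R + e2 * k2%:R + e3 * z) =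
  e1 * (x1 - k1%:R) + e2 * (x2 - k2%:R) + e3 * (x3 - z) by ring.
have one (e d : R) (r : R) : `|e| <= 1 -> `|d| <= r -> `|e * d| <= r.
  by move=> he hd; rewrite normrM -[r]mul1r; apply: ler_pM.
have a1 : `|e1 * (x1 - k1%:R)| <= 1 by apply: one => //; rewrite ler_norml; lra.
have a2 : `|e2 * (x2 - k2%:R)| <= 1 by apply: one => //; rewrite ler_norml; lra.
have a3 := one _ _ _ n3 h.
apply: le_trans (ler_normD _ _) _; have := ler_normD (e1 * (x1 - k1%:R)) (e2 * (x2 - k2%:R)).
lra.
Qed.

(** By superadditivity, the k2 whose floors lie in an interval of length cutoff
    differ by O(cutoff ^ (1 / c)). *)
Lemma low_pairs_count R (c : R) lam k1 : 1 < c < 9 / 8 ->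
  (1 <= lam)%N ->
  \sum_(k2 < side c lam)
    [&& (floorpow c k1 + floorpow c k2 <= lam)%N & ~~ inner_pair c lam k1 k2]%:R
  <= 20 * unitscale c lam `^ 4.
Proof.
move=> /andP[c1 c2] l1; have c0 : c != 0 by rewrite gt_eqF//; lra.
have q1 := unitscale_ge1 c1 l1; set q := unitscale c lam in q1 *.
have q41 : 1 <= q `^ 4.
  by apply: powR_ge1 => //; lra.
have q4c : 1 <= q `^ (4 * c).
  by apply: powR_ge1 => //; lra.
have cutq : (cutoff R lam)%:R <= 18 * q `^ (4 * c).
  have e : 16 * lam%:R `^ (4 / 5) = 16 * q `^ (4 * c) :> R.
    by rewrite (unitscaleE (4 / 5) lam c0) -/q; congr (_ * _ `^ _); field.
  have q160 : 0 <= 16 * q `^ (4 * c) by lra.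
  have /andP[t1 _] := truncn_bounds q160.
  have -> : (cutoff R lam)%:R = (Num.truncn (16 * q `^ (4 * c)))%:R + 2 :> R.
    by rewrite /cutoff e -addn2 natrD.
  lra.
apply: (@le_trans _ _ (19 * q `^ 4 + 1)); last by lra.
apply: (@spread_count R (fun k2 => [&& (floorpow c k1 + floorpow c k2 <= lam)%N
  & ~~ inner_pair c lam k1 k2])); first by rewrite mulr_ge0// powR_ge0.
move=> i j /andP[ij _] /andP[hi ni] /andP[hj nj].
have /andP[i1 i2] := floorpow_itv c i; have /andP[j1 j2] := floorpow_itv c j.
move: ni; rewrite /inner_pair -ltnNge => ni.
have mij : (floorpow c j)%:R + 1 <= (floorpow c i)%:R + (cutoff R lam)%:R :> R.
  rewrite natr1 -natrD ler_nat -(ltn_add2l (floorpow c k1)) addnA.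
  exact: leq_ltn_trans hj ni.
have ijR : i%:R <= j%:R :> R by rewrite ler_nat ltnW.
have d0 : 0 <= j%:R - i%:R :> R by rewrite subr_ge0.
have sup := powR_superadditive (ltW c1) (ler0n R i) d0.
rewrite subrKC in sup.
have dc : (j%:R - i%:R) `^ c <= 19 * q `^ (4 * c).
  clear -sup i1 i2 j1 j2 mij cutq q4c; lra.
clear cutq mij sup i1 i2 j1 j2; clearbody q.
rewrite -[X in X <= _](@powRK _ c)//.
apply: (@le_trans _ _ ((19 * q `^ (4 * c)) `^ c^-1)).
  by apply: ler_powR_base => //; [rewrite invr_ge0; lra|exact: powR_ge0].
rewrite (@powRM _ 19 (q `^ (4 * c))) ?powR_ge0// -powRrM mulfK//.
apply: ler_wpM2r; first exact: powR_ge0.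
rewrite -[X in _ <= X]powRr1//; apply: ler_powR; first by lra.
by rewrite invf_le1//; lra.
Qed.

Lemma height_le R (c : R) lam k1 k2 : 1 < c -> (1 <= lam)%N ->
  inner_pair c lam k1 k2 -> height c lam k1 k2 <= 3 * unitscale c lam `^ 5.
Proof.
move=> c1 l1 /inner_pair_base hb.
have c0 : c != 0 by rewrite gt_eqF//; lra.
have e := root_unitscale lam c0.
have g0 : 0 <= c^-1 by rewrite invr_ge0; lra.
have g1 : c^-1 <= 1 by rewrite invf_le1//; lra.
rewrite -e /height.
apply: (@le_trans _ _ ((3 * lam%:R) `^ c^-1)).
  apply: ler_powR_base => //; first by lra.
  have := powR_ge0 k1%:R c; have := powR_ge0 k2%:R c.
  have : 1 <= lam%:R :> R by rewrite ler1n.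
  lra.
rewrite (@powRM _ 3 lam%:R)//; apply: ler_wpM2r; first exact: powR_ge0.
by rewrite -[X in _ <= X]powRr1//; apply: ler_powR => //; lra.
Qed.

Lemma height_gt0 R (c : R) lam k1 k2 : 1 < c ->
  inner_pair c lam k1 k2 -> 0 < height c lam k1 k2.
Proof. by move=> c1 /(height_ge1 c1); apply: lt_le_trans. Qed.

(** Few pairs lie close to the boundary of a cap: along a line, either the level
    moves with slope bounded below, or it is curved. *)
Lemma level_count_row R (c : R) lam (e1 e2 e3 b C0 : R) k2 :
  1 < c < 9 / 8 -> (1 <= lam)%N -> 0 <= e3 -> 1 / 2 <= `|e1| \/ 1 / 2 <= e3 ->
  0 <= C0 <= 20 * unitscale c lam `^ (5 * (c - 1)) ->
  \sum_(k1 < side c lam)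
    [&& (0 < k1)%N, inner_pair c lam k1 k2 & `|level c lam e1 e2 e3 k1 k2 - b| < C0]%:R
  <= (323 + 6 / (c - 1)) * unitscale c lam `^ (5 / 2 * c).
Proof.
move=> /andP[c1 c2] l1 e30 alt /andP[C00 C0q].
have q1 := unitscale_ge1 c1 l1.
have cge0 : 0 <= c by lra.
have c12' : 1 < c < 2 by rewrite c1; lra.
(* This value of e balances C0 / e against e / kappa. *)
pose e := unitscale c lam `^ (5 / 2 * c - 5) / 4.
pose kappa := (c - 1) / (4 * (3 * unitscale c lam `^ 5)).
have q0 : 0 < unitscale c lam by lra.
have e0 : 0 < e by rewrite divr_gt0// powR_gt0.
have kappa0 : 0 < kappa.
  apply: divr_gt0; first by lra.
  by apply: mulr_gt0 => //; apply: mulr_gt0 => //; exact: powR_gt0.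
have e4 : e <= 1 / 4.
  rewrite /e ler_pM2r; last by lra.
  rewrite -[X in _ <= X](powRr0 (unitscale c lam)); apply: ler_powR => //; lra.
have := @slope_count R (fun k => level c lam e1 e2 e3 k k2)
  (fun k => e1 - e3 * slope c lam k k2) (side c lam)
  (fun k => inner_pair c lam k k2) b C0 e kappa C00 e0 kappa0.
have sl k : (0 < k)%N -> inner_pair c lam k.+1 k2 ->
    e1 - e3 * slope c lam k.+1 k2 <=
    level c lam e1 e2 e3 k.+1 k2 - level c lam e1 e2 e3 k k2 <=
    e1 - e3 * slope c lam k k2.
  move=> k0 vk; have vk' := inner_pair_le c1 (leqnSn k) vk.
  have t1 := ler_wpM2l e30 (height_tangent c1 vk vk').
  have t2 := ler_wpM2l e30 (height_tangent c1 vk' vk).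
  move: t1 t2; rewrite /level.
  move: (height _ _ k.+1 _) (height _ _ k _) (slope _ _ k.+1 _) (slope _ _ k _).
  by clear => z' z y' y; rewrite -(natr1 k) => t1 t2; apply/andP; split; lra.
have cv k : (0 < k)%N -> inner_pair c lam k.+1 k2 ->
    - e <= e1 - e3 * slope c lam k.+1 k2 -> e1 - e3 * slope c lam k k2 <= e ->
    kappa <= e1 - e3 * slope c lam k k2 - (e1 - e3 * slope c lam k.+1 k2).
  move=> k0 vk s1 s2; have vk' := inner_pair_le c1 (leqnSn k) vk.
  have -> : e1 - e3 * slope c lam k k2 - (e1 - e3 * slope c lam k.+1 k2) =
    e3 * (slope c lam k.+1 k2 - slope c lam k k2).
    by move: (slope _ _ k.+1 _) (slope _ _ k _) => y' y; ring.
  have h1 := height_gt0 c1 vk; have h2 := height_gt0 c1 vk'.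
  have h3 := height_le c1 l1 vk'; have h4 := inner_pair_side c1 l1 vk'.
  have kk : k.+1%:R = k%:R + 1 :> R by rewrite natr1.
  have hmon : height c lam k.+1 k2 <= height c lam k k2.
    have kc : k%:R `^ c <= k.+1%:R `^ c :> R.
      by apply: ler_powR_base; [exact: cge0|exact: ler0n|rewrite ler_nat].
    have := inner_pair_base vk; rewrite /height; move: kc.
    move: (k%:R `^ c) (k.+1%:R `^ c) (k2%:R `^ c) => A B D.
    clear -c1 => AB hB; apply: ler_powR_base; last by lra.
      by rewrite invr_ge0; lra.
    by lra.
  have kR : 0 < k%:R :> R by rewrite ltr0n.
  have sl0 : 0 <= e3 * slope c lam k.+1 k2.
    by rewrite mulr_ge0// divr_ge0 ?powR_ge0.
  have alt' : 1 / 4 <= e3 \/ 1 / 4 <= e3 * slope c lam k k2.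
    move: s1 s2 sl0; move: (slope _ _ k.+1 _) (slope _ _ k _) => y' y s1 s2 sl0.
    clear -alt s1 s2 sl0 e4.
    have [h|h] := lerP (1 / 4) e3; first by left.
    right; case: alt => [|h5]; last by lra.
    have [a|a] := lerP 0 e1; [rewrite ger0_norm//|rewrite ltr0_norm//]; lra.
  by have := curvature_bound c12' kR h1 hmon h3 h4 e30 alt'; rewrite -kk.
have Vle i j : (0 < i <= j)%N -> inner_pair c lam j k2 -> inner_pair c lam i k2.
  by move=> /andP[_ ij]; exact: inner_pair_le.
move=> /(_ Vle sl cv) /le_trans; apply.
clear Vle sl cv; have pD x y : unitscale c lam `^ x * unitscale c lam `^ y = unitscale c lam `^ (x + y).
  by rewrite powRD// (gt_eqF q0) implybT.
have r1 : 4 * C0 / e <= 320 * unitscale c lam `^ (5 / 2 * c).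
  rewrite ler_pdivrMr// /e.
  have -> : 320 * unitscale c lam `^ (5 / 2 * c) * (unitscale c lam `^ (5 / 2 * c - 5) / 4) =
    80 * (unitscale c lam `^ (5 / 2 * c) * unitscale c lam `^ (5 / 2 * c - 5)).
    by field.
  rewrite pD; have -> : 5 / 2 * c + (5 / 2 * c - 5) = 5 * (c - 1) by field.
  lra.
have r2 : 2 * e / kappa <= 6 / (c - 1) * unitscale c lam `^ (5 / 2 * c).
  have -> : 2 * e / kappa = 6 / (c - 1) *
      (unitscale c lam `^ (5 / 2 * c - 5) * unitscale c lam `^ 5).
    have qn : unitscale c lam `^ 5 != 0 by rewrite gt_eqF// powR_gt0.
    have cn : c - 1 != 0 by rewrite gt_eqF// subr_gt0.
    by rewrite /e /kappa; field; rewrite qn cn.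
  by rewrite pD subrK.
have r3 : 1 <= unitscale c lam `^ (5 / 2 * c).
  by apply: powR_ge1 => //; apply: mulr_ge0; [rewrite divr_ge0|exact: cge0].
clear -r1 r2 r3; lra.
Qed.

(** * One octant *)

Lemma levelC R (c : R) lam (e1 e2 e3 : R) k1 k2 :
  level c lam e1 e2 e3 k1 k2 = level c lam e2 e1 e3 k2 k1.
Proof. by rewrite /level heightC (addrC (e1 * _)). Qed.

Lemma levelN R (c : R) lam (e1 e2 e3 : R) k1 k2 :
  level c lam (- e1) (- e2) (- e3) k1 k2 = - level c lam e1 e2 e3 k1 k2.
Proof. by rewrite /level !mulNr !opprD. Qed.

Definition near_level R (c : R) lam (e1 e2 e3 b C0 : R)
    k1 k2 : bool :=
  [&& (0 < k1)%N, (0 < k2)%N, inner_pair c lam k1 k2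
    & `|level c lam e1 e2 e3 k1 k2 - b| < C0].

(** A unit vector has a coordinate at least 1 / 2 in absolute value, so the
    lines of at least one of the two directions of the grid satisfy the
    hypothesis of level_count_row. Changing the sign of the linear form makes e3
    nonnegative. *)
Lemma level_count R (c : R) lam (e1 e2 e3 b C0 : R) :
  1 < c < 9 / 8 -> (1 <= lam)%N -> e1 ^+ 2 + e2 ^+ 2 + e3 ^+ 2 = 1 ->
  0 <= C0 <= 20 * unitscale c lam `^ (5 * (c - 1)) ->
  \sum_(k2 < side c lam) \sum_(k1 < side c lam)
    (near_level c lam e1 e2 e3 b C0 k1 k2)%:R
  <= 3 * (323 + 6 / (c - 1)) * unitscale c lam `^ (6 + 3 * c).
Proof.
move=> c12 l1; have /andP[c1 c2] := c12.
wlog e30 : e1 e2 e3 b / 0 <= e3.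
  move=> H n1 hC; have [e30|e30] := lerP 0 e3; first exact: H.
  have := H (- e1) (- e2) (- e3) (- b); rewrite !sqrrN oppr_ge0 => /(_ (ltW e30) n1 hC).
  apply: le_trans; apply: ler_sum => k2 _; apply: ler_sum => k1 _.
  by rewrite /near_level levelN -opprD normrN.
move=> n1 hC.
have q1 := unitscale_ge1 c1 l1.
have /andP[Mq qM] := side_bounds c1 l1.
set A := 323 + 6 / (c - 1).
have A0 : 0 <= A by apply: addr_ge0; [exact: ler0n|apply: divr_ge0; [exact: ler0n|rewrite subr_ge0 ltW]].
have fin (F : nat -> nat -> R) :
    (forall j, \sum_(i < side c lam) F i j <= A * unitscale c lam `^ (5 / 2 * c)) ->
    \sum_(j < side c lam) \sum_(i < side c lam) F i j <=
      3 * A * unitscale c lam `^ (6 + 3 * c).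
  move=> hF; apply: (@le_trans _ _ (\sum_(j < side c lam) (A * unitscale c lam `^ (5 / 2 * c)))).
    by apply: ler_sum => j _; exact: hF.
  rewrite sumr_const card_ord -[X in X <= _]mulr_natl.
  apply: (@le_trans _ _ (3 * unitscale c lam `^ 5 * (A * unitscale c lam `^ (5 / 2 * c)))).
    by apply: ler_wpM2r => //; rewrite mulr_ge0// powR_ge0.
  rewrite (_ : _ * (A * _) = 3 * A * (unitscale c lam `^ 5 * unitscale c lam `^ (5 / 2 * c))); last first.
    by move: (unitscale c lam `^ 5) (unitscale c lam `^ (5 / 2 * c)) => x y; ring.
  apply: ler_wpM2l; first by rewrite mulr_ge0.
  rewrite -powRD; last by rewrite gt_eqF ?implybT//; lra.
  by apply: ler_powR => //; clear -c1 c2; lra.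
have [alt|alt] := boolP ((1 / 2 <= `|e1|) || (1 / 2 <= e3)).
  apply: (fin (fun k1 k2 => (near_level c lam e1 e2 e3 b C0 k1 k2)%:R)) => k2.
  apply: le_trans (@level_count_row _ c lam e1 e2 e3 b C0 k2 c12 l1 e30 (orP alt) hC).
  apply: ler_sum => k1 _; rewrite /near_level.
  by case: (0 < k1)%N => //=; case: (0 < k2)%N => //=.
rewrite exchange_big/=.
have alt2 : 1 / 2 <= `|e2| \/ 1 / 2 <= e3.
  left; move: alt; rewrite negb_or -!ltNge => /andP[a1 a3].
  rewrite leNgt; apply/negP => a2.
  have s1 : e1 ^+ 2 < 1 / 4.
    by rewrite -real_normK ?num_real// expr2; have := normr_ge0 e1; clear -a1; nra.
  have s2 : e2 ^+ 2 < 1 / 4.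
    by rewrite -real_normK ?num_real// expr2; have := normr_ge0 e2; clear -a2; nra.
  have s3 : e3 ^+ 2 < 1 / 4 by rewrite expr2; clear -a3 e30; nra.
  by clear -s1 s2 s3 n1; lra.
apply: (fin (fun k2 k1 => (near_level c lam e1 e2 e3 b C0 k1 k2)%:R)) => k1.
apply: le_trans (@level_count_row _ c lam e2 e1 e3 b C0 k1 c12 l1 e30 alt2 hC).
apply: ler_sum => k2 _; rewrite /near_level inner_pairC levelC.
by case: (0 < k1)%N => //=; case: (0 < k2)%N => //=.
Qed.

Lemma ceil_count R (M : nat) (u : R) : 0 <= u <= M%:R ->
  \sum_(k < M) (k%:R < u)%R%:R = u + frac_part (- u).
Proof.
move=> /andP[u0 uM].
have -> : u + frac_part (- u) = (Num.ceil u)%:~R by rewrite /frac_part ceilNfloor intrN; lra.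
have c0 : 0 <= Num.ceil u by rewrite ceil_ge0; lra.
pose n := `|Num.ceil u|%N.
have nE : Num.ceil u = n%:Z by rewrite /n gez0_abs.
have nM : (n <= M)%N by rewrite -lez_nat -nE ceil_le_int -pmulrn.
rewrite nE -pmulrn (eq_bigr (fun k : 'I_M => ((k < n)%N : nat)%:R)); last first.
  by move=> k _; rewrite -ltz_nat -nE ceil_gt_int -pmulrn.
rewrite -natr_sum; congr (_%:R).
rewrite -(subnKC nM) big_split_ord/= [X in (_ + X)%N]big1 => [|i _]; last by rewrite ltnNge leq_addr.
rewrite (eq_bigr (fun=> 1%N)) => [|i _]; last by rewrite ltn_ord.
by rewrite sum1_card card_ord addn0.
Qed.

Lemma floorpow_eq R (c : R) (k n : nat) : 1 < c ->
  (floorpow c k == n) = (n%:R `^ c^-1 <= k%:R < n.+1%:R `^ c^-1).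
Proof.
move=> c1; have c0 : c != 0 by rewrite gt_eqF//; lra.
have i0 : 0 < c^-1 by rewrite invr_gt0; lra.
have mono (x y : R) : 0 <= x -> 0 <= y -> (x `^ c^-1 <= y) = (x <= y `^ c).
  move=> x0 y0; apply/idP/idP => h.
    rewrite -(@powRVK _ c x)//; apply: ler_powR_base => //; first by lra.
    exact: powR_ge0.
  rewrite -(@powRK _ c y)//; apply: ler_powR_base => //; exact: ltW.
rewrite /floorpow truncn_eq ?powR_ge0// mono//; congr (_ && _).
by rewrite !ltNge; congr (~~ _); rewrite mono.
Qed.

Lemma side_ge_root R (c : R) lam n : 1 < c -> (1 <= lam)%N ->
  (n <= lam.+1)%N -> n%:R `^ c^-1 <= (side c lam)%:R.
Proof.
move=> c1 l1 nl; have c0 : c != 0 by rewrite gt_eqF//; lra.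
have i0 : 0 <= c^-1 by rewrite invr_ge0; lra.
apply: (@le_trans _ _ ((lam%:R + 1) `^ c^-1)).
  by apply: ler_powR_base => //; rewrite natr1 ler_nat.
have -> : (side c lam)%:R = (Num.truncn (lam%:R `^ c^-1))%:R + 2 :> R.
  by rewrite /side -addn2 natrD.
have /andP[_ h] := truncn_bounds (powR_ge0 lam%:R c^-1).
have g01 := inv_itv01 c1.
have := gap_bounds g01 (ler0n R lam); rewrite /gap => /andP[_ h2].
lra.
Qed.

(** The k with floor (k ^ c) = n are the integers of [n ^ (1 / c), (n + 1) ^ (1
    / c)[, and the number of integers in such an interval is a difference of two
    ceilings. *)
Lemma floorpow_count R (c : R) lam n : 1 < c -> (1 <= lam)%N ->
  (n <= lam)%N ->
  \sum_(k < side c lam) (floorpow c k == n)%:R =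
  gap c^-1 n%:R + (frac_part (- (n.+1%:R `^ c^-1)) - frac_part (- (n%:R `^ c^-1))) :> R.
Proof.
move=> c1 l1 nl.
have i0 : 0 <= c^-1 by rewrite invr_ge0; lra.
have nn : n%:R `^ c^-1 <= n.+1%:R `^ c^-1 :> R.
  by apply: ler_powR_base => //; rewrite ler_nat.
have e k : (floorpow c k == n)%:R =
    (k%:R < n.+1%:R `^ c^-1)%R%:R - (k%:R < n%:R `^ c^-1)%R%:R :> R.
  rewrite floorpow_eq//; have [h1|h1] := lerP (n%:R `^ c^-1) k%:R.
    by rewrite subr0.
  by rewrite (lt_le_trans h1 nn) subrr.
rewrite (eq_bigr _ (fun (k : 'I_ _) _ => e k)) sumrB !ceil_count.
- rewrite /gap natr1.
  by move: (n.+1%:R `^ _) (n%:R `^ _) (frac_part _) (frac_part _) => x y z w; ring.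
- by rewrite powR_ge0 side_ge_root// ltnW.
- by rewrite powR_ge0 side_ge_root.
Qed.

(** The number of lattice points above (k1, k2) in the open positive octant and
    in a half space. Other octants are reached by changing the signs of e1, e2,
    e3. *)
Definition fiber R (c : R) lam (e1 e2 e3 b : R) k1 k2 : R :=
  \sum_(k3 < side c lam) [&& (0 < k1)%N, (0 < k2)%N, (0 < k3)%N,
    (floorpow c k1 + floorpow c k2 + floorpow c k3 == lam)%N
    & b <= e1 * k1%:R + e2 * k2%:R + e3 * k3%:R]%:R.

(** Twice the variation of the linear form over a unit cell, with some room for
    the thickness of the shell. *)
Definition tolerance R (c : R) lam : R :=
  20 * unitscale c lam `^ (5 * (c - 1)).

Lemma fiber_01 R (c : R) lam (e1 e2 e3 b : R) k1 k2 :
  1 < c -> 0 <= fiber c lam e1 e2 e3 b k1 k2 <= 1.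
Proof.
move=> c1; apply/andP; split; first by apply: sumr_ge0 => k _; exact: ler0n.
rewrite -[leRHS]add0r; apply: (@spread_count R (fun k3 => [&& (0 < k1)%N, (0 < k2)%N, (0 < k3)%N,
    (floorpow c k1 + floorpow c k2 + floorpow c k3 == lam)%N
    & b <= e1 * k1%:R + e2 * k2%:R + e3 * k3%:R])) => // k k' /andP[kk' _].
move=> /and5P[_ _ _ /eqP h _] /and5P[_ _ _ /eqP h' _].
have := floorpow_homo c1 kk'.
by rewrite -(ltn_add2l (floorpow c k1 + floorpow c k2)) h h' ltnn.
Qed.

Lemma floorpow0 R (c : R) : 1 < c -> floorpow c 0 = 0%N.
Proof.
by move=> c1; rewrite /floorpow powR0 ?truncn0// gt_eqF//; lra.
Qed.

Lemma fiber_level R (c : R) lam (e1 e2 e3 : R) k1 k2 k3 :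
  1 < c < 9 / 8 -> (1 <= lam)%N -> e1 ^+ 2 + e2 ^+ 2 + e3 ^+ 2 = 1 ->
  inner_pair c lam k1 k2 ->
  (floorpow c k1 + floorpow c k2 + floorpow c k3 == lam)%N ->
  `|e1 * k1%:R + e2 * k2%:R + e3 * k3%:R - level c lam e1 e2 e3 k1 k2| <
    tolerance c lam.
Proof.
move=> c12 l1 n1 v /eqP h; have /andP[c1 _] := c12.
have Q1 : 1 <= unitscale c lam `^ (5 * (c - 1)).
  by apply: powR_ge1; [exact: unitscale_ge1|lra].
have nb (x y z : R) : x ^+ 2 + y ^+ 2 + z ^+ 2 = 1 -> `|x| <= 1.
  move=> xyz; rewrite -(@ler_pXn2r _ 2)// ?nnegrE// real_normK ?num_real// expr1n.
  by have := sqr_ge0 y; have := sqr_ge0 z; lra.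
have b1 : `|e1| <= 1 by exact: nb n1.
have b2 : `|e2| <= 1 by apply: (nb e2 e1 e3); rewrite -n1; ring.
have b3 : `|e3| <= 1 by apply: (nb e3 e1 e2); rewrite -n1; ring.
have i (k : nat) : (k%:R <= k%:R :> R) && (k%:R <= k%:R + 1 :> R).
  by rewrite lexx lerDl ler01.
have S : (lam%:R : R) <= k1%:R `^ c + k2%:R `^ c + k3%:R `^ c <= lam%:R + 3.
  have /andP[a1 a2] := floorpow_itv c k1; have /andP[d1 d2] := floorpow_itv c k2.
  have /andP[f1 f2] := floorpow_itv c k3.
  rewrite -h !natrD; clear -a1 a2 d1 d2 f1 f2; apply/andP; split; lra.
have := cell_level c12 l1 v b1 b2 b3 (i k1) (i k2) (ler0n _ k3) S.
by rewrite /tolerance => h9; clear -h9 Q1; lra.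
Qed.

Lemma fiber_out R (c : R) lam (e1 e2 e3 b : R) k1 k2 :
  1 < c < 9 / 8 -> (1 <= lam)%N -> e1 ^+ 2 + e2 ^+ 2 + e3 ^+ 2 = 1 ->
  inner_pair c lam k1 k2 -> level c lam e1 e2 e3 k1 k2 <= b - tolerance c lam ->
  fiber c lam e1 e2 e3 b k1 k2 = 0.
Proof.
move=> c12 l1 n1 v lo; rewrite /fiber big1// => k3 _.
have [h|//] := boolP [&& _, _, _, _ & _].
move: h => /and5P[_ _ _ s bs].
have := fiber_level c12 l1 n1 v s; rewrite ltr_norml => /andP[_ u].
by clear -u bs lo; lra.
Qed.

(** The deviation of the number of points of a fiber from the corresponding gap. *)
Definition defect R (c : R) lam k1 k2 : R :=
  frac_part (- ((lam.+1%:R - (floorpow c k1)%:R - (floorpow c k2)%:R) `^ c^-1)) -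
  frac_part (- ((lam%:R - (floorpow c k1)%:R - (floorpow c k2)%:R) `^ c^-1)).

Lemma fiber_in R (c : R) lam (e1 e2 e3 b : R) k1 k2 :
  1 < c < 9 / 8 -> (1 <= lam)%N -> e1 ^+ 2 + e2 ^+ 2 + e3 ^+ 2 = 1 ->
  (0 < k1)%N -> (0 < k2)%N ->
  inner_pair c lam k1 k2 -> b + tolerance c lam <= level c lam e1 e2 e3 k1 k2 ->
  fiber c lam e1 e2 e3 b k1 k2 =
    gap c^-1 (lam%:R - (floorpow c k1)%:R - (floorpow c k2)%:R) + defect c lam k1 k2.
Proof.
move=> c12 l1 n1 k10 k20 v hi; have /andP[c1 _] := c12.
have mm : (floorpow c k1 + floorpow c k2 < lam)%N.
  by apply: leq_trans v; rewrite -[X in (X < _)%N]addn0 ltn_add2l.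
pose n := (lam - (floorpow c k1 + floorpow c k2))%N.
have nl : (n <= lam)%N by exact: leq_subr.
have nE : n%:R = lam%:R - (floorpow c k1)%:R - (floorpow c k2)%:R :> R.
  by rewrite /n natrB ?(ltnW mm)// natrD opprD addrA.
have n1E : n.+1%:R = lam.+1%:R - (floorpow c k1)%:R - (floorpow c k2)%:R :> R.
  have s1 : n.+1%:R = n%:R + 1 :> R by rewrite natr1.
  have s2 : lam.+1%:R = lam%:R + 1 :> R by rewrite natr1.
  rewrite s1 s2 nE.
  by move: (lam%:R : R) ((floorpow c k1)%:R : R) ((floorpow c k2)%:R : R) => x y z; ring.
rewrite /defect -n1E -nE -(floorpow_count c1 l1 nl).
apply: eq_bigr => k3 _; congr (_%:R : R); congr nat_of_bool.
rewrite k10 k20 /=; apply/and3P/eqP => [[_ /eqP s _]|s].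
  by apply/eqP; rewrite -(eqn_add2l (floorpow c k1 + floorpow c k2)) s /n subnKC// ltnW.
have s' : (floorpow c k1 + floorpow c k2 + floorpow c k3 == lam)%N.
  by rewrite s /n subnKC// ltnW.
split => //.
  rewrite lt0n; apply/eqP => k30; move: s; rewrite k30 floorpow0// => /esym/eqP.
  by rewrite /n subn_eq0 leqNgt mm.
have := fiber_level c12 l1 n1 v s'; rewrite ltr_norml => /andP[u _].
by clear -u hi; lra.
Qed.

Definition deep_pair R (c : R) lam k1 k2 : bool :=
  [&& (0 < k1)%N, (k1 < side c lam)%N, (0 < k2)%N, (k2 < side c lam)%N
    & inner_pair c lam k1 k2].

Definition defect_sum R (c : R) lam (P : nat -> nat -> bool) : R :=
  \sum_(k2 < side c lam) \sum_(k1 < side c lam | P k1 k2) defect c lam k1 k2.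

(** The defect is a difference of two sawtooth functions, at X = lam + 1 and at
    X = lam. *)
Lemma defect_sum_convex R (c : R) : 1 < c < 9 / 8 ->
  exists2 C : R, 0 < C & forall (lam : nat) (P : nat -> nat -> bool),
  (1 <= lam)%N -> (forall k2, nat_convex (P^~ k2)) ->
  (forall k1 k2, P k1 k2 -> deep_pair c lam k1 k2) ->
  `|defect_sum c lam P| <=
    C * harmonic R (side c lam) ^+ 2 * unitscale c lam `^ (6 + 3 * c).
Proof.
move=> c12; have [C C0 HC] := sawtooth_pairs c12.
exists (C + C); first by rewrite addr_gt0.
move=> lam P l1 cP dP.
have hP k1 k2 : P k1 k2 -> [/\ (k1 < side c lam)%N, (k2 < side c lam)%N &
     (floorpow c k1 + floorpow c k2 + cutoff R lam <= lam)%N].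
  by move=> /dP /and5P[].
have A := HC lam lam.+1 P l1 _ cP hP; have B := HC lam lam P l1 _ cP hP.
rewrite leqnSn leqnn in A; rewrite leqnn leqnSn in B.
have {}A := A isT; have {}B := B isT.
have -> : defect_sum c lam P =
  \sum_(k2 < side c lam) \sum_(k1 < side c lam | P k1 k2)
     (frac_part (- ((lam.+1%:R - (floorpow c k1)%:R - (floorpow c k2)%:R) `^ c^-1)) - 1 / 2) -
  \sum_(k2 < side c lam) \sum_(k1 < side c lam | P k1 k2)
     (frac_part (- ((lam%:R - (floorpow c k1)%:R - (floorpow c k2)%:R) `^ c^-1)) - 1 / 2).
  rewrite -sumrB; apply: eq_bigr => k2 _; rewrite -sumrB; apply: eq_bigr => k1 _.
  by rewrite /defect; move: (frac_part _) (frac_part _) => x y; lra.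
rewrite -mulrA mulrDl mulrA.
by apply: le_trans (ler_normB _ _) _; apply: lerD; [exact: A|exact: B].
Qed.

Definition above_level R (c : R) lam (e1 e2 e3 t : R)
    k1 k2 : bool :=
  deep_pair c lam k1 k2 && (t <= level c lam e1 e2 e3 k1 k2).

Lemma deep_pair_convex R (c : R) (lam k2 : nat) : 1 < c ->
  nat_convex (fun k1 => deep_pair c lam k1 k2).
Proof.
move=> c1 i j l /andP[ij jl] /and5P[i0 _ k20 k2M _] /and5P[_ lM _ _ vl].
apply/and5P; split=> //; [exact: leq_trans ij|exact: leq_ltn_trans lM|].
exact: inner_pair_le vl.
Qed.

(** If e3 >= 0 the rows of pairs above the level t are convex. If e3 < 0 the
    rows of their complement among the deep pairs are. *)
Lemma defect_sum_above R (c : R) : 1 < c < 9 / 8 ->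
  exists2 C : R, 0 < C & forall (lam : nat) (e1 e2 e3 t : R), (1 <= lam)%N ->
  `|defect_sum c lam (above_level c lam e1 e2 e3 t)| <=
    C * harmonic R (side c lam) ^+ 2 * unitscale c lam `^ (6 + 3 * c).
Proof.
move=> c12; have [C C0 HC] := defect_sum_convex c12; have /andP[c1 _] := c12.
exists (C + C); first by rewrite addr_gt0.
move=> lam e1 e2 e3 t l1.
have Y0 : 0 <= C * harmonic R (side c lam) ^+ 2 * unitscale c lam `^ (6 + 3 * c).
  by rewrite mulr_ge0 ?powR_ge0// mulr_ge0 ?sqr_ge0// ltW.
have [e30|e30] := lerP 0 e3.
  have cv k2 : nat_convex (fun k1 => above_level c lam e1 e2 e3 t k1 k2).
    move=> i j l ijl /andP[di ti] /andP[dl tl]; apply/andP; split.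
      exact: deep_pair_convex c1 _ _ _ ijl di dl.
    have /and5P[_ _ _ _ vl] := dl.
    apply: le_trans (level_quasiconcave e1 e2 c1 e30 ijl vl).
    by rewrite le_min; apply/andP; split; [exact: ti|exact: tl].
  apply: le_trans (HC lam _ l1 cv _) _; first by move=> k1 k2 /andP[].
  apply: ler_wpM2r; first exact: powR_ge0.
  by apply: ler_wpM2r; [exact: sqr_ge0|rewrite lerDl ltW].
pose Q k1 k2 := deep_pair c lam k1 k2 && ~~ (t <= level c lam e1 e2 e3 k1 k2).
have -> : defect_sum c lam (above_level c lam e1 e2 e3 t) =
    defect_sum c lam (deep_pair c lam) - defect_sum c lam Q.
  rewrite -sumrB; apply: eq_bigr => k2 _.
  rewrite [X in _ = X - _](bigID (fun k1 : 'I__ => t <= level c lam e1 e2 e3 k1 k2))/=.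
  by rewrite addrK.
have n30 : 0 <= - e3 by rewrite oppr_ge0 ltW.
have cQ k2 : nat_convex (Q^~ k2).
  move=> i j l ijl /andP[di ti] /andP[dl tl]; apply/andP; split.
    exact: deep_pair_convex c1 _ _ _ ijl di dl.
  have /and5P[_ _ _ _ vl] := dl.
  have := level_quasiconcave (- e1) (- e2) c1 n30 ijl vl.
  rewrite (levelN c lam e1 e2 e3 i) (levelN c lam e1 e2 e3 j) (levelN c lam e1 e2 e3 l).
  move: ti tl; set li := level _ _ _ _ _ i _; set ll := level _ _ _ _ _ l _.
  set lj := level _ _ _ _ _ j _; clearbody li lj ll; clear.
  rewrite -!ltNge ge_min !lerN2 => ti tl.
  by move=> /orP[h|h]; [exact: (le_lt_trans h ti)|exact: (le_lt_trans h tl)].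
have A := HC lam _ l1 (fun k2 => @deep_pair_convex _ c lam k2 c1) (fun _ _ h => h).
have B := HC lam Q l1 cQ (fun k1 k2 h => proj1 (andP h)).
rewrite -mulrA mulrDl mulrA.
by apply: le_trans (ler_normB _ _) _; apply: lerD; [exact: A|exact: B].
Qed.

Lemma harmonic_side_ge1 R (c : R) lam : 1 <= harmonic R (side c lam).
Proof.
apply: (@le_trans _ _ (harmonic R 1)); first by rewrite /harmonic big_ord1 invr1.
exact: harmonic_homo.
Qed.

Lemma sum_side_const R (c : R) lam (x : R) : 1 < c ->
  (1 <= lam)%N -> 0 <= x ->
  \sum_(k < side c lam) x <= 3 * unitscale c lam `^ 5 * x.
Proof.
move=> c1 l1 x0; have /andP[_ qM] := side_bounds c1 l1.
by rewrite sumr_const card_ord -[X in X <= _]mulr_natl; exact: ler_wpM2r.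
Qed.

(** To be applied with v k1 k2 the volume of the cell above (k1, k2). Pairs
    inside the cap contribute their defect and an error 7 / q. Pairs near the
    boundary of the cap, with a zero coordinate, or with a small remainder
    contribute at most 1 each and are few. *)
Lemma octant_discrepancy R (c : R) : 1 < c < 9 / 8 ->
  exists2 C : R, 0 < C & forall (lam : nat) (e1 e2 e3 b : R) (v : nat -> nat -> R),
  (1 <= lam)%N -> e1 ^+ 2 + e2 ^+ 2 + e3 ^+ 2 = 1 ->
  (forall k1 k2, 0 <= v k1 k2 <= 1) ->
  (forall k1 k2, (lam < floorpow c k1 + floorpow c k2)%N -> v k1 k2 = 0) ->
  (forall k1 k2, inner_pair c lam k1 k2 ->
    b + tolerance c lam <= level c lam e1 e2 e3 k1 k2 ->
    `|v k1 k2 - gap c^-1 (lam%:R - (floorpow c k1)%:R - (floorpow c k2)%:R)|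
      <= 7 / unitscale c lam) ->
  (forall k1 k2, inner_pair c lam k1 k2 ->
    level c lam e1 e2 e3 k1 k2 <= b - tolerance c lam -> v k1 k2 = 0) ->
  `|\sum_(k2 < side c lam) \sum_(k1 < side c lam)
      (fiber c lam e1 e2 e3 b k1 k2 - v k1 k2)| <=
    C * harmonic R (side c lam) ^+ 2 * unitscale c lam `^ (6 + 3 * c).
Proof.
move=> c12; have [C C0 HC] := defect_sum_above c12; have /andP[c1 c2] := c12.
pose A := 3 * (323 + 6 / (c - 1)).
have A0 : 0 <= A.
  apply: mulr_ge0; first exact: ler0n.
  by apply: addr_ge0; [exact: ler0n|apply: divr_ge0; [exact: ler0n|rewrite subr_ge0 ltW]].
exists (C + (6 + 60 + A + 63)).
  by apply: ltr_wpDr => //; apply: addr_ge0 => //; apply: addr_ge0.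
move=> lam e1 e2 e3 b v l1 n1 v01 vz vin vout.
have q1 := unitscale_ge1 c1 l1.
have hM1 := harmonic_side_ge1 c lam.
set M := side c lam; set q := unitscale c lam in q1 *.
set hM := harmonic R (side c lam) in hM1 *.
set Y := q `^ (6 + 3 * c).
have q0 : 0 < q by lra.
have Yge x : x <= 9 -> q `^ x <= Y by move=> x9; apply: ler_powR => //; lra.
pose t := b + tolerance c lam.
pose P := above_level c lam e1 e2 e3 t.
pose low (k1 k2 : nat) := (floorpow c k1 + floorpow c k2 <= lam)%N && ~~ inner_pair c lam k1 k2.
pose near := near_level c lam e1 e2 e3 b (tolerance c lam).
have tol0 : 0 < tolerance c lam.
  by rewrite /tolerance; apply: mulr_gt0; [exact: ltr0n|exact: powR_gt0].
pose err (k1 k2 : nat) : R := (k1 == 0%N)%:R + (k2 == 0%N)%:R + (low k1 k2)%:R +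
   (near k1 k2)%:R + 7 / q.
have q70 : 0 <= 7 / q by apply: divr_ge0; [exact: ler0n|exact: ltW].
have f01 k1 k2 := @fiber_01 R c lam e1 e2 e3 b k1 k2 c1.
have fv k1 k2 : `|fiber c lam e1 e2 e3 b k1 k2 - v k1 k2| <= 1.
  have /andP[f0 f1] := f01 k1 k2; have /andP[v0 v1] := v01 k1 k2.
  move: f0 f1 v0 v1; move: (fiber _ _ _ _ _ _ _ _) (v _ _) => x y; clear.
  by move=> *; rewrite ler_norml; lra.
have pw (k1 k2 : 'I_M) : `|fiber c lam e1 e2 e3 b k1 k2 - v k1 k2 -
     (if P k1 k2 then defect c lam k1 k2 else 0)| <= err k1 k2.
  have e0 : 0 <= (k1 == 0%N :> nat)%:R + (k2 == 0%N :> nat)%:R + (low k1 k2)%:R +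
      (near k1 k2)%:R :> R by rewrite !addr_ge0.
  have big : 1 <= (k1 == 0%N :> nat)%:R + (k2 == 0%N :> nat)%:R + (low k1 k2)%:R +
      (near k1 k2)%:R :> R -> P k1 k2 = false ->
      `|fiber c lam e1 e2 e3 b k1 k2 - v k1 k2 -
     (if P k1 k2 then defect c lam k1 k2 else 0)| <= err k1 k2.
    move=> h ->; rewrite subr0; apply: le_trans (fv k1 k2) _.
    by apply: le_trans h _; rewrite lerDl.
  have zero : fiber c lam e1 e2 e3 b k1 k2 = 0 -> v k1 k2 = 0 -> P k1 k2 = false ->
      `|fiber c lam e1 e2 e3 b k1 k2 - v k1 k2 -
     (if P k1 k2 then defect c lam k1 k2 else 0)| <= err k1 k2.
    by move=> -> -> ->; rewrite !subr0 normr0; apply: addr_ge0.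
  have [k10|k10] := posnP k1.
    apply: big; last by rewrite /P /above_level /deep_pair k10.
    by rewrite k10 eqxx -!addrA lerDl !addr_ge0.
  have [k20|k20] := posnP k2.
    apply: big; last by rewrite /P /above_level /deep_pair k20 /= !andbF.
    by rewrite k20 eqxx -!addrA addrCA lerDl !addr_ge0.
  have [lo|hi] := leqP (floorpow c k1 + floorpow c k2) lam; last first.
    apply: zero; first 1 last.
    - exact: vz.
    - apply/negP => /andP[/and5P[_ _ _ _ +] _]; rewrite /inner_pair => h.
      by move: hi; rewrite ltnNge (leq_trans _ h)// leq_addr.
    - rewrite /fiber big1// => k3 _.
      have [h|//] := boolP [&& _, _, _, _ & _].
      move: h => /and5P[_ _ _ /eqP s _].
      by move: hi; rewrite -[X in (X < _)%N]s ltnNge leq_addr.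
  have [inn|ninn] := boolP (inner_pair c lam k1 k2); last first.
    apply: big; last by rewrite /P /above_level /deep_pair (negbTE ninn) !andbF.
    have -> : low k1 k2 by rewrite /low lo.
    by rewrite addrAC lerDr !addr_ge0.
  have [nr|nnr] := boolP (near k1 k2).
    apply: big; first by rewrite nr lerDr !addr_ge0.
    apply/negP => /andP[_ h]; move: nr => /and4P[_ _ _]; rewrite ltr_norml => /andP[_].
    by rewrite ltNge lerBrDr [X in X <= _]addrC h.
  have dp : deep_pair c lam k1 k2 by rewrite /deep_pair k10 k20 inn !ltn_ord.
  have [ht|ht] := lerP t (level c lam e1 e2 e3 k1 k2).
    have -> : P k1 k2 by rewrite /P /above_level dp.
    rewrite (fiber_in c12 l1 n1 k10 k20 inn ht).
    have := vin _ _ inn ht.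
    rewrite distrC => /le_trans W; apply: le_trans (W _ _); last by rewrite /err lerDr.
    move: (gap _ _) (defect _ _ _ _) (v _ _) => x y z; clear.
    by rewrite (_ : x + y - z - y = x - z)//; ring.
  have PF : P k1 k2 = false by rewrite /P /above_level leNgt ht andbF.
  have hout : level c lam e1 e2 e3 k1 k2 <= b - tolerance c lam.
    move: nnr; rewrite /near /near_level k10 k20 inn /= -leNgt.
    move: ht; rewrite /t; move: (level _ _ _ _ _ _ _) (tolerance _ _) => x y; clear.
    by have [xb|xb] := lerP b x; lra.
  apply: zero => //; first exact: (fiber_out c12 l1 n1 inn hout).
  exact: vout inn hout.
have -> : \sum_(k2 < M) \sum_(k1 < M) (fiber c lam e1 e2 e3 b k1 k2 - v k1 k2) =
    \sum_(k2 < M) \sum_(k1 < M) (fiber c lam e1 e2 e3 b k1 k2 - v k1 k2 -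
     (if P k1 k2 then defect c lam k1 k2 else 0)) + defect_sum c lam P.
  rewrite /defect_sum -big_split/=; apply: eq_bigr => k2 _.
  by rewrite [X in _ + X]big_mkcond -big_split/=; apply: eq_bigr => k1 _; rewrite subrK.
apply: le_trans (ler_normD _ _) _; rewrite addrC (mulrDl C) (mulrDl (C * _)).
apply: lerD; first exact: HC.
apply: (@le_trans _ _ (\sum_(k2 < M) \sum_(k1 < M) err k1 k2)).
  apply: le_trans (ler_norm_sum _ _ _) _; apply: ler_sum => k2 _.
  apply: le_trans (ler_norm_sum _ _ _) _; apply: ler_sum => k1 _; exact: pw.
have Y0 : 0 <= Y by exact: powR_ge0.
apply: (@le_trans _ _ ((6 + 60 + A + 63) * Y)); last first.
  apply: ler_wpM2r => //; rewrite ler_peMr//.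
    by apply: addr_ge0 => //; apply: addr_ge0.
  by rewrite expr2; apply: mulr_ege1.
have pD x y : q `^ x * q `^ y = q `^ (x + y) by rewrite powRD// (gt_eqF q0) implybT.
have single : \sum_(k < M) (k == 0%N :> nat)%:R <= 1 :> R.
  rewrite -[leRHS]add0r; apply: (@spread_count R (fun k => k == 0%N)) => //.
  by move=> k k' /andP[kk' _] /eqP k0 /eqP k'0; rewrite k0 k'0 ltnn in kk'.
have S1 : \sum_(k2 < M) \sum_(k1 < M) (k1 == 0%N :> nat)%:R <= 3 * Y :> R.
  apply: (@le_trans _ _ (\sum_(k2 < M) 1)); first by apply: ler_sum => k2 _; exact: single.
  apply: le_trans (sum_side_const c1 l1 ler01) _; rewrite mulr1 -/q.
  by apply: ler_wpM2l; [exact: ler0n|apply: Yge; clear; lra].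
have S2 : \sum_(k2 < M) \sum_(k1 < M) (k2 == 0%N :> nat)%:R <= 3 * Y :> R.
  rewrite exchange_big/=; exact: S1.
have S3 : \sum_(k2 < M) \sum_(k1 < M) (low k1 k2)%:R <= 60 * Y :> R.
  rewrite exchange_big/=.
  apply: (@le_trans _ _ (\sum_(k1 < M) (20 * q `^ 4))).
    by apply: ler_sum => k1 _; exact: low_pairs_count.
  apply: le_trans (sum_side_const c1 l1 _) _.
    by apply: mulr_ge0; [exact: ler0n|exact: powR_ge0].
  rewrite -/q mulrACA pD.
  apply: (@le_trans _ _ (60 * q `^ (5 + 4))).
    by apply: ler_wpM2r; [exact: powR_ge0|clear; lra].
  by apply: ler_wpM2l; [exact: ler0n|apply: Yge; clear; lra].
have S4 : \sum_(k2 < M) \sum_(k1 < M) (near k1 k2)%:R <= A * Y.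
  apply: level_count => //; rewrite ltW//=.
have S5 : \sum_(k2 < M) \sum_(k1 < M) (7 / q) <= 63 * Y.
  have q5 : 0 <= 3 * q `^ 5 by apply: mulr_ge0; [exact: ler0n|exact: powR_ge0].
  apply: (@le_trans _ _ (\sum_(k1 < M) (3 * q `^ 5 * (7 / q)))).
    by apply: ler_sum => k1 _; exact: sum_side_const.
  apply: le_trans (sum_side_const c1 l1 _) _; first exact: mulr_ge0.
  rewrite -/q; apply: (@le_trans _ _ (63 * q `^ 9)); last first.
    by apply: ler_wpM2l; [exact: ler0n|apply: Yge].
  have -> : q `^ 9 = q `^ 5 * q `^ 5 / q.
    rewrite pD -[X in _ / X](@powRr1 _ q) ?ltW// -powRB ?(gt_eqF q0) ?implybT//.
    by congr (_ `^ _); clear; lra.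
  by move: (q `^ 5) q^-1 => x y; clear; rewrite (_ : 3 * x * (3 * x * (7 * y)) = 63 * (x * x * y))//; ring.
rewrite /err; under eq_bigr => k2 _ do rewrite !big_split/=.
rewrite !big_split/=.
have -> : (6 + 60 + A + 63) * Y = 3 * Y + 3 * Y + 60 * Y + A * Y + 63 * Y.
  by clear; ring.
by do 4 apply: lerD => //.
Qed.

(** * Polar coordinates *)

Lemma measurable_bool_set d (T : measurableType d) (b : T -> bool) :
  measurable_fun setT b -> measurable [set x | b x].
Proof.
move=> mb; rewrite (_ : [set x | b x] = setT `&` b @^-1` [set true]).
  exact: mb.
by apply/seteqP; split => x /=; [|case].
Qed.

Lemma measurable_coord R :
  [/\ measurable_fun setT (fun x : space3 R => x.1.1 : R),
      measurable_fun setT (fun x : space3 R => x.1.2 : R) &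
      measurable_fun setT (fun x : space3 R => x.2 : R)].
Proof.
split.
- exact: measurableT_comp measurable_fst measurable_fst.
- exact: measurableT_comp measurable_snd measurable_fst.
- exact: measurable_snd.
Qed.

Definition gpow R (c : R) (x : space3 R) : R :=
  `|x.1.1| `^ c + `|x.1.2| `^ c + `|x.2| `^ c.

Lemma measurable_abs_powR d (T : measurableType d) R (c : R) (f : T -> R) :
  measurable_fun setT f -> measurable_fun setT (fun x => `|f x| `^ c).
Proof.
move=> mf; apply: (measurableT_comp (measurable_powR c)).
exact: measurableT_comp.
Qed.

Lemma measurable_gpow R (c : R) : measurable_fun setT (@gpow R c).
Proof.
have [m1 m2 m3] := measurable_coord R.
by apply: measurable_funD; [apply: measurable_funD|]; exact: measurable_abs_powR.
Qed.

Lemma measurable_cnorm R (c : R) : measurable_fun setT (@cnorm R c).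
Proof. exact: measurableT_comp (measurable_powR _) (measurable_gpow c). Qed.

Lemma measurable_dot3 R (xi : space3 R) :
  measurable_fun setT (fun x => dot3 x xi).
Proof.
have [m1 m2 m3] := measurable_coord R.
by apply: measurable_funD; [apply: measurable_funD|];
  apply: measurable_funM => //; exact: measurable_cst.
Qed.

(** Both sides of the second condition are homogeneous of degree one, so this is
    the part of a shell that lies in the cone over a cap. *)
Definition shell_cap R (c : R) lam (a : R) (xi : space3 R) :
    set (space3 R) :=
  [set x | (lam%:R <= gpow c x < lam%:R + 1) && (a * cnorm c x <= dot3 x xi)].

Lemma measurable_shell_cap R (c : R) lam (a : R) (xi : space3 R) :
  measurable (shell_cap c lam a xi).
Proof.
apply: measurable_bool_set; apply: measurable_and.
  apply: measurable_and.
    by apply: measurable_fun_ler; [exact: measurable_cst|exact: measurable_gpow].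
  by apply: measurable_fun_ltr; [exact: measurable_gpow|exact: measurable_cst].
apply: measurable_fun_ler; last exact: measurable_dot3.
by apply: measurable_funM; [exact: measurable_cst|exact: measurable_cnorm].
Qed.

Lemma measurable_csphere R (c : R) : measurable (@csphere R c).
Proof.
rewrite /csphere (_ : [set x | _] = [set x | cnorm c x == 1]).
  apply: measurable_bool_set.
  by apply: measurable_fun_eqr; [exact: measurable_cnorm|exact: measurable_cst].
by apply/seteqP; split => x /= /eqP.
Qed.

Lemma measurable_cap R (c a : R) (xi : space3 R) : measurable (cap c a xi).
Proof.
rewrite /cap (_ : [set x | _] = csphere c `&` [set x | a <= dot3 x xi]); last by [].
apply: measurableI; first exact: measurable_csphere.
apply: measurable_bool_set.
by apply: measurable_fun_ler; [exact: measurable_cst|exact: measurable_dot3].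
Qed.

Lemma gpow_ge0 R (c : R) (x : space3 R) : 0 <= gpow c x.
Proof. by rewrite !addr_ge0// powR_ge0. Qed.

Lemma cnormE R (c : R) (x : space3 R) : cnorm c x = gpow c x `^ (c^-1).
Proof. by rewrite /cnorm div1r. Qed.

Lemma gpow_scale R (c r : R) (y : space3 R) : 0 <= r ->
  gpow c (scale3 r y) = r `^ c * gpow c y.
Proof.
move=> r0; rewrite /gpow /scale3 /= !normrM (ger0_norm r0).
by rewrite !powRM// !mulrDr.
Qed.

Lemma dot3_scale R (r : R) (y xi : space3 R) :
  dot3 (scale3 r y) xi = r * dot3 y xi.
Proof. by rewrite /dot3 /scale3 /=; ring. Qed.

Lemma gpow_csphere R (c : R) (y : space3 R) : 0 < c -> csphere c y ->
  gpow c y = 1.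
Proof.
move=> c0; rewrite /csphere /= cnormE => e.
by rewrite -(@powRVK _ c (gpow c y)) ?gt_eqF ?gpow_ge0// e powR1x.
Qed.

Lemma shell_cap_ray R (c : R) lam (a r : R) (xi y : space3 R) :
  0 < c -> 0 < r -> csphere c y ->
  (shell_cap c lam a xi (scale3 r y) : Prop) <->
  (lam%:R <= r `^ c < lam%:R + 1) && (a <= dot3 y xi).
Proof.
move=> c0 r0 ys; rewrite /shell_cap /= cnormE gpow_scale ?(ltW r0)//.
rewrite (gpow_csphere c0 ys) mulr1 powRK ?gt_eqF ?(ltW r0)//.
by rewrite dot3_scale [a * r]mulrC ler_pM2l.
Qed.

Definition shell_weight R (c : R) lam : \bar R :=
  (\int[@lebesgue_measure R]_(r in `]0%R, +oo[)
     ((r ^+ 2) * (lam%:R <= r `^ c < lam%:R + 1)%R%:R)%:E)%E.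

Lemma measurable_shell_weight R (c : R) lam :
  measurable_fun setT (fun r : R => (r ^+ 2) * (lam%:R <= r `^ c < lam%:R + 1)%R%:R).
Proof.
apply: measurable_funM; first exact: measurable_funX.
rewrite (_ : (fun r => _) =
    \1_[set r : R | lam%:R <= r `^ c < lam%:R + 1]); last first.
  apply/funext => r; rewrite indicE; congr (_%:R); congr nat_of_bool.
  by apply/idP/idP; rewrite inE.
apply: measurable_indic; apply: measurable_bool_set.
apply: measurable_and.
  by apply: measurable_fun_ler; [exact: measurable_cst|exact: measurable_powR].
by apply: measurable_fun_ltr; [exact: measurable_powR|exact: measurable_cst].
Qed.

(** On the ray through a point y of the c-sphere the condition of the shell
    bears on the radius only, and that of the cap on y only. So the polar
    coordinates formula for the indicator separates. *)
Lemma volume_shell_cap R (c : R)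
    (mu : {measure set (space3 R) -> \bar R}) lam (a : R) (xi : space3 R) :
  0 < c -> is_polar_measure c mu ->
  lebesgue3 R (shell_cap c lam a xi) = (shell_weight c lam * mu (cap c a xi))%E.
Proof.
move=> c0 [_ polar].
have mS := measurable_shell_cap c lam a xi.
have := polar (fun x => (\1_(shell_cap c lam a xi) x)%:E).
rewrite integral_indic// setIT => -> //; last 2 first.
- by apply/measurable_EFinP; exact: measurable_indic.
- by left => x; rewrite lee_fin.
rewrite /shell_weight -ge0_integralZr//; last 2 first.
- by apply/measurable_EFinP; apply: measurable_funTS; exact: measurable_shell_weight.
- by move=> r _; rewrite lee_fin mulr_ge0// sqr_ge0.
apply: eq_integral => r; rewrite inE/= in_itv/= andbT => r0.
rewrite [X in _ = (X * _)%E]EFinM -muleA; congr (_ * _)%E.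
rewrite (eq_integral (fun y : space3 R => (lam%:R <= r `^ c < lam%:R + 1)%R%:R%:E *
    (\1_(cap c a xi) y)%:E)%E); last first.
  move=> y; rewrite inE => ys; rewrite -EFinM; congr (_%:E).
  have := shell_cap_ray lam a xi c0 r0 ys; rewrite !indicE.
  have -> : (y \in cap c a xi) = (a <= dot3 y xi).
    by apply/idP/idP; rewrite inE /cap /= => // -[].
  have [h|h] := boolP (scale3 r y \in shell_cap c lam a xi).
    by move: h; rewrite inE => h [H _]; have /andP[-> ->] := H h; rewrite mulr1.
  move=> [_ H]; have : ~ ((lam%:R <= r `^ c < lam%:R + 1) && (a <= dot3 y xi)).
    by move=> /H; move: h; rewrite notin_setE.
  by move=> /negP; rewrite negb_and => /orP[/negbTE ->|/negbTE ->]; rewrite ?mul0r ?mulr0.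
rewrite ge0_integralZl_EFin//.
- rewrite integral_indic; last exact: measurable_cap.
  by congr (_ * mu _)%E; apply/seteqP; split => y; [case|case => ? ?; split].
- exact: measurable_csphere.
- exact: measurable_csphere.
- apply/measurable_EFinP; apply: measurable_funTS; apply: measurable_indic.
  exact: measurable_cap.
Qed.

Lemma coord_le_gpow R (c : R) (x : space3 R) :
  [/\ `|x.1.1| `^ c <= gpow c x, `|x.1.2| `^ c <= gpow c x & `|x.2| `^ c <= gpow c x].
Proof.
have h1 := powR_ge0 `|x.1.1| c; have h2 := powR_ge0 `|x.1.2| c.
have h3 := powR_ge0 `|x.2| c.
by rewrite /gpow; split; lra.
Qed.

Lemma unit_sphere_sq R (xi : space3 R) : unit_sphere xi ->
  xi.1.1 ^+ 2 + xi.1.2 ^+ 2 + xi.2 ^+ 2 = 1.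
Proof.
rewrite /unit_sphere /= => h.
have d0 : 0 <= dot3 xi xi by rewrite /dot3 -!expr2 !addr_ge0// sqr_ge0.
by have := sqr_sqrtr d0; rewrite h expr1n /dot3 -!expr2 => ->.
Qed.

Lemma coord_unit_sphere R (xi : space3 R) : unit_sphere xi ->
  [/\ `|xi.1.1| <= 1, `|xi.1.2| <= 1 & `|xi.2| <= 1].
Proof.
move=> /unit_sphere_sq h.
have h1 := sqr_ge0 xi.1.1; have h2 := sqr_ge0 xi.1.2; have h3 := sqr_ge0 xi.2.
have key (x : R) : x ^+ 2 <= 1 -> `|x| <= 1.
  by move=> hx; rewrite -(@ler_pXn2r _ 2)// ?nnegrE// real_normK ?num_real// expr1n.
by split; apply: key; lra.
Qed.

Lemma dot3_cnorm R (c : R) (x xi : space3 R) : 0 < c -> unit_sphere xi ->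
  `|dot3 x xi| <= 3 * cnorm c x.
Proof.
move=> c0 /coord_unit_sphere[n1 n2 n3]; have [g1 g2 g3] := coord_le_gpow c x.
rewrite cnormE.
have {}g1 := powR_le_root c0 (normr_ge0 _) g1.
have {}g2 := powR_le_root c0 (normr_ge0 _) g2.
have {}g3 := powR_le_root c0 (normr_ge0 _) g3.
move: g1 g2 g3; set G := gpow c x `^ c^-1 => g1 g2 g3.
have key (u v : R) : `|u| <= G -> `|v| <= 1 -> `|u * v| <= G.
  by move=> hu hv; rewrite normrM -[leRHS]mulr1; apply: ler_pM.
have k1 := key _ _ g1 n1; have k2 := key _ _ g2 n2; have k3 := key _ _ g3 n3.
rewrite /dot3; apply: le_trans (ler_normD _ _) _.
have := ler_normD (x.1.1 * xi.1.1) (x.1.2 * xi.1.2).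
lra.
Qed.

(** By dot3_cnorm, any height below - 3 would do. *)
Lemma cap_full R (c : R) (xi : space3 R) : 0 < c -> unit_sphere xi ->
  cap c (- 10) xi = csphere c.
Proof.
move=> c0 xi1; apply/seteqP; split => x; rewrite /cap /=; first by case.
move=> xs; split => //; have := dot3_cnorm x c0 xi1; rewrite xs mulr1.
by rewrite ler_norml => /andP[h _]; apply: le_trans h; lra.
Qed.

Lemma lebesgue3_box R (A B C : set (measurableTypeR R)) :
  measurable A -> measurable B -> measurable C ->
  lebesgue3 R ((A `*` B) `*` C) =
  (lebesgue_measure A * lebesgue_measure B * lebesgue_measure C)%E.
Proof.
move=> mA mB mC.
have h1 := @product_measure1E _ _ _ _ R (@lebesgue_measure R) (@lebesgue_measure R) A B mA mB.
have mAB : measurable (A `*` B) by exact: measurableX.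
have h2 := @product_measure1E _ _ _ _ R
  ((@lebesgue_measure R \x @lebesgue_measure R)%E) (@lebesgue_measure R) _ C mAB mC.
by rewrite -h1; exact: h2.
Qed.

Lemma shell_cap_finite R (c : R) lam (a : R) (xi : space3 R) :
  0 < c -> (lebesgue3 R (shell_cap c lam a xi) < +oo)%E.
Proof.
move=> c0.
pose B : R := (lam%:R + 1) `^ c^-1.
pose I : set (measurableTypeR R) := [set` `[- B, B]].
have mI : measurable I by exact: measurable_itv.
have IB : lebesgue_measure I = (B - - B)%:E.
  rewrite lebesgue_measure_itv/= lte_fin; case: ltP => //.
  have : 0 < B by apply: powR_gt0; rewrite ltr_wpDl.
  by move=> b0; rewrite leNgt => /negP; case; lra.
apply: (@le_lt_trans _ _ (lebesgue3 R ((I `*` I) `*` I))).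
  apply: le_measure; rewrite ?inE.
  - exact: measurable_shell_cap.
  - by apply: measurableX => //; exact: measurableX.
  move=> x /andP[/andP[_ g] _]; have [g1 g2 g3] := coord_le_gpow c x.
  have key (u : R) : `|u| `^ c <= gpow c x -> u \in `[- B, B].
    move=> hu; rewrite in_itv/= -ler_norml.
    exact/ltW/(powR_lt_root c0 (normr_ge0 _))/(le_lt_trans hu g).
  by split => /=; [split; exact: key|exact: key].
by rewrite lebesgue3_box// IB -!EFinM ltry.
Qed.

Lemma shell_weight_gt0 R (c : R) lam : 0 < c -> (1 <= lam)%N ->
  (0 < shell_weight c lam)%E.
Proof.
move=> c0 l1.
pose A : R := lam%:R `^ c^-1; pose B : R := (lam%:R + 1) `^ c^-1.
have AB : A < B by apply: ltr_powR_base; rewrite ?invr_gt0// ltrDl.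
have A1 : 1 <= A by apply: powR_ge1; rewrite ?ler1n// invr_ge0 ltW.
pose I : set R := [set` `]A, B[].
have mI : measurable I by exact: measurable_itv.
apply: (@lt_le_trans _ _ (lebesgue_measure I)).
  by rewrite lebesgue_measure_itv/= lte_fin AB -EFinB lte_fin subr_gt0.
have mJ : measurable (`]0%R, +oo[%classic : set R) by exact: measurable_itv.
have -> : lebesgue_measure I =
    (\int[lebesgue_measure]_(r in `]0%R, +oo[) (\1_I r)%:E)%E.
  rewrite integral_indic//; congr (lebesgue_measure _); apply/seteqP; split => r.
    rewrite /I /= in_itv/= => /andP[h1 h2]; split; first by rewrite h1.
    by rewrite /= in_itv/= andbT; lra.
  by case.
apply: ge0_le_integral => //.
- by apply/measurable_EFinP; apply: measurable_funTS; exact: measurable_indic.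
- by apply/measurable_EFinP; apply: measurable_funTS; exact: measurable_shell_weight.
move=> r _; rewrite lee_fin indicE.
have [|_] := boolP (r \in I); last by rewrite mulr_ge0// sqr_ge0.
rewrite inE /I /= in_itv/= => /andP[Ar rB].
have r1 : 1 <= r by lra.
have c0n : c != 0 by rewrite gt_eqF.
have -> : lam%:R <= r `^ c < lam%:R + 1.
  apply/andP; split.
    rewrite -[X in X <= _](@powRVK _ c)//; apply: ler_powR_base; [exact: ltW|exact: powR_ge0|exact: ltW].
  rewrite -[X in _ < X](@powRVK _ c)//.
  by apply: ltr_powR_base => //; lra.
by rewrite mulr1 expr2; apply: mulr_ege1.
Qed.

(** Volumes of shell caps and measures of caps are proportional, and the factor,
    which is positive and independent of the cap, cancels. *)
Lemma nuc_volume R (c : R)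
    (mu : {measure set (space3 R) -> \bar R}) lam (a : R) (xi : space3 R) :
  0 < c -> (1 <= lam)%N -> unit_sphere xi -> is_polar_measure c mu ->
  0 <= nuc c mu (cap c a xi) <= 1 /\
  nuc c mu (cap c a xi) * fine (lebesgue3 R (shell_cap c lam (- 10) xi)) =
    fine (lebesgue3 R (shell_cap c lam a xi)).
Proof.
move=> c0 l1 xi1 pol.
have f0 := shell_cap_finite lam (- 10) xi c0.
rewrite (volume_shell_cap _ _ _ c0 pol) (cap_full c0 xi1) in f0.
rewrite !(volume_shell_cap _ _ _ c0 pol) (cap_full c0 xi1).
have w0 := shell_weight_gt0 c0 l1.
have le : (mu (cap c a xi) <= mu (csphere c))%E.
  apply: le_measure; rewrite ?inE; [exact: measurable_cap|exact: measurable_csphere|].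
  by move=> x [].
have m0 : (0 <= mu (csphere c))%E by exact: measure_ge0.
have c00 : (0 <= mu (cap c a xi))%E by exact: measure_ge0.
have mf : mu (csphere c) \is a fin_num.
  by rewrite ge0_fin_numE// ltey; apply/eqP => e; move: f0; rewrite e gt0_muley// ltxx.
have cf : mu (cap c a xi) \is a fin_num.
  by rewrite ge0_fin_numE// (le_lt_trans le)// -ge0_fin_numE.
rewrite /nuc; move: le m0 c00 f0 mf cf.
case: (mu (csphere c)) => [s| |]//; case: (mu (cap c a xi)) => [t| |]//=.
rewrite !lee_fin => ts s0 t0 f0 _ _.
(* If mu vanishes on the c-sphere both sides are 0, since x / 0 = 0. *)
have [sz|sn] := eqVneq s 0.
  have tz : t = 0 by apply/eqP; rewrite eq_le t0 -sz ts.
  by rewrite sz tz mul0r !mul0r mule0 /= lexx ler01.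
have sp : 0 < s by rewrite lt_neqAle eq_sym sn.
have wf : shell_weight c lam \is a fin_num.
  rewrite ge0_fin_numE; last exact: ltW.
  by rewrite ltey; apply/eqP => e; move: f0; rewrite e gt0_mulye ?lte_fin// ltxx.
move: wf; case: (shell_weight c lam) => [u| |]//= _; split.
  by rewrite divr_ge0//= ler_pdivrMr// mul1r.
by field.
Qed.

(** * Volumes over the cells of a grid *)

(** Tonelli's theorem over a base of measure 1. *)
Lemma lebesgue3_section_bounds R (A : set (space3 R))
    (Q : set (measurableTypeR R * measurableTypeR R)) (lo hi : R) :
  measurable A -> measurable Q ->
  (@lebesgue_measure R \x @lebesgue_measure R)%E Q = 1%E ->
  (forall p x3, A (p, x3) -> Q p) -> 0 <= lo ->
  (forall p, Q p -> (lo%:E <= @lebesgue_measure R (xsection A p) <= hi%:E)%E) ->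
  lo <= fine (lebesgue3 R A) <= hi.
Proof.
move=> mA mQ Q1 AQ lo0 sec.
pose L2 := ((@lebesgue_measure R \x @lebesgue_measure R)%E :
  {measure set (measurableTypeR R * measurableTypeR R) -> \bar R}).
have Q1' : L2 Q = 1%E by exact: Q1.
have -> : lebesgue3 R A = (\int[L2]_p @lebesgue_measure R (xsection A p))%E by [].
have indQ (r : R) : 0 <= r -> (\int[L2]_p (r%:E * (\1_Q p)%:E) = r%:E)%E.
  move=> r0; rewrite ge0_integralZl_EFin//.
  - by rewrite integral_indic// setIT Q1' mule1.
  - by apply/measurable_EFinP; exact: measurable_indic.
have msec : measurable_fun setT (fun p => @lebesgue_measure R (xsection A p)).
  exact: measurable_fun_xsection.
have mind (r : R) : measurable_fun setT (fun p => r%:E * (\1_Q p)%:E)%E.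
  by apply: measurable_funeM; apply/measurable_EFinP; exact: measurable_indic.
have out p : ~ Q p -> @lebesgue_measure R (xsection A p) = 0%E.
  move=> nQ; rewrite (_ : xsection A p = set0) ?measure0//.
  by rewrite -subset0 => x; rewrite /xsection /= inE => /AQ.
have [[p0 Qp0]|nQ] := pselect (exists p, Q p); last first.
  have Q0 : Q = set0 by rewrite -subset0 => p Qp; apply: nQ; exists p.
  by move: Q1'; rewrite Q0 measure0 => /eqP; rewrite eqe eq_sym oner_eq0.
have hi0 : 0 <= hi.
  by have /andP[h1 h2] := sec _ Qp0; rewrite -lee_fin (le_trans _ h2)// (le_trans _ h1)// lee_fin.
have l1 : (lo%:E <= \int[L2]_p @lebesgue_measure R (xsection A p))%E.
  rewrite -[X in (X <= _)%E]indQ//; apply: ge0_le_integral => //.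
    by move=> p _; rewrite mule_ge0// lee_fin.
  move=> p _; rewrite indicE; have [|] := boolP (p \in Q).
    by rewrite inE => /sec/andP[h _]; rewrite mule1.
  by rewrite mule0.
have l2 : (\int[L2]_p @lebesgue_measure R (xsection A p) <= hi%:E)%E.
  rewrite -[X in (_ <= X)%E]indQ//; apply: ge0_le_integral => //.
  move=> p _; rewrite indicE; have [|] := boolP (p \in Q).
    by rewrite inE => /sec/andP[_ h]; rewrite mule1.
  by rewrite notin_setE => /out ->; rewrite mule0.
have fn : (\int[L2]_p @lebesgue_measure R (xsection A p))%E \is a fin_num.
  rewrite ge0_fin_numE; first by rewrite (le_lt_trans l2)// ltry.
  by apply: integral_ge0.
by rewrite -!lee_fin fineK// l1.
Qed.

Definition sgnb R s : R := if s then 1 else - 1.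

(** For s = false this is the reflection of ]k, k + 1], so that all these
    intervals together tile the line. *)
Definition unit_ivl R s (k : nat) : set (measurableTypeR R) :=
  if s then [set` `[k%:R, k%:R + 1[ ] else [set` `[- (k%:R + 1), - k%:R[ ].

Definition half_line R s : set (measurableTypeR R) :=
  if s then [set` `]0, +oo[ ] else [set` `]-oo, 0[ ].

Definition grid_cell R s1 s2 s3 k1 k2 : set (space3 R) :=
  (@unit_ivl R s1 k1 `*` @unit_ivl R s2 k2) `*` @half_line R s3.

Lemma measurable_unit_ivl R s k : measurable (@unit_ivl R s k).
Proof. by rewrite /unit_ivl; case: s; exact: measurable_itv. Qed.

Lemma measurable_half_line R s : measurable (@half_line R s).
Proof. by rewrite /half_line; case: s; exact: measurable_itv. Qed.

Lemma measurable_grid_cell R s1 s2 s3 k1 k2 :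
  measurable (@grid_cell R s1 s2 s3 k1 k2).
Proof.
apply: measurableX; last exact: measurable_half_line.
by apply: measurableX; exact: measurable_unit_ivl.
Qed.

Lemma lebesgue_unit_ivl R s k : @lebesgue_measure R (@unit_ivl R s k) = 1%E.
Proof.
by rewrite /unit_ivl; case: s; (rewrite lebesgue_measure_itv/= lte_fin ifT; last by lra);
  rewrite -EFinB; congr (_%:E); lra.
Qed.

Lemma unit_ivl_abs R s k (x : R) : @unit_ivl R s k x ->
  `|x| = sgnb R s * x /\ k%:R <= `|x| <= k%:R + 1.
Proof.
have k0 : 0 <= k%:R :> R by [].
rewrite /unit_ivl /sgnb; case: s => /=; rewrite in_itv/= => /andP[h1 h2].
  by rewrite mul1r ger0_norm; lra.
by rewrite mulN1r ler0_norm; lra.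
Qed.

Lemma half_line_abs R s (x : R) : @half_line R s x -> `|x| = sgnb R s * x.
Proof.
rewrite /half_line /sgnb; case: s => /=; rewrite in_itv/= ?andbT => h.
  by rewrite mul1r gtr0_norm.
by rewrite mulN1r ltr0_norm.
Qed.

Lemma cell_square R s1 s2 k1 k2 :
  (@lebesgue_measure R \x @lebesgue_measure R)%E (@unit_ivl R s1 k1 `*` @unit_ivl R s2 k2) = 1%E.
Proof.
have m1 := @measurable_unit_ivl R s1 k1; have m2 := @measurable_unit_ivl R s2 k2.
have := @product_measure1E _ _ _ _ R (@lebesgue_measure R) (@lebesgue_measure R) _ _ m1 m2.
move=> /= h; rewrite -[RHS](mule1 1%E); apply: etrans h _.
by congr (_ * _)%E; exact: lebesgue_unit_ivl.
Qed.

(** A ray meets the shell in an interval, of length at most 1 by gap_bounds. If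
    t < 0 it starts at 0. *)
Lemma half_shell_le1 R (c t : R) s (S : set R) : 1 < c ->
  measurable S -> (forall x, S x -> @half_line R s x /\ t <= `|x| `^ c < t + 1) ->
  (@lebesgue_measure R S <= 1)%E.
Proof.
move=> c1 mS hS; have c0 : 0 < c by lra.
pose t' := Num.max 0 t; have t'0 : 0 <= t' by rewrite le_max lexx.
pose al := t' `^ c^-1.
have g01 := inv_itv01 c1.
have al1 : (t' + 1) `^ c^-1 <= al + 1.
  by have := gap_bounds g01 t'0; rewrite /gap -/al => /andP[_]; lra.
pose J : set R := if s then [set` `[al, al + 1] ] else [set` `[- (al + 1), - al] ].
have mJ : measurable J by rewrite /J; case: (s); exact: measurable_itv.
have J1 : (@lebesgue_measure R J = 1)%E.
  by rewrite /J; case: (s); (rewrite lebesgue_measure_itv/= lte_fin ifT; last by lra);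
    rewrite -EFinB; congr (_%:E); lra.
rewrite -J1; apply: le_measure; rewrite ?inE//.
move=> x /hS[hx /andP[x1 x2]].
have a1 : al <= `|x|.
  apply: root_le_powR => //; rewrite /t' ge_max powR_ge0; exact: x1.
have a2 : `|x| < al + 1.
  apply: lt_le_trans al1; apply: powR_lt_root => //; apply: lt_le_trans x2 _.
  by rewrite lerD2r le_max lexx orbT.
have ex := half_line_abs hx; rewrite ex in a1 a2; move: a1 a2; rewrite /J /sgnb.
by case: (s) => /=; rewrite in_itv/=; lra.
Qed.

Lemma half_shell_gap R (c t : R) s (S : set R) : 1 < c -> 0 < t ->
  (forall x, S x <-> @half_line R s x /\ t <= `|x| `^ c < t + 1) ->
  @lebesgue_measure R S = (gap c^-1 t)%:E.
Proof.
move=> c1 t0 hS; have c0 : 0 < c by lra.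
have g01 := inv_itv01 c1.
pose al := t `^ c^-1; pose be := (t + 1) `^ c^-1.
have al0 : 0 < al by exact: powR_gt0.
have ab : al < be by apply: ltr_powR_base; rewrite ?invr_gt0//; lra.
have key (y : R) : 0 < y -> (t <= y `^ c < t + 1) = (al <= y < be).
  move=> y0; have cn : c != 0 by rewrite gt_eqF.
  apply/idP/idP => /andP[h1 h2]; apply/andP; split.
  - by apply: root_le_powR => //; exact: ltW.
  - by apply: powR_lt_root => //; exact: ltW.
  - rewrite -[X in X <= _](@powRVK _ c)//; last exact: ltW.
    by apply: ler_powR_base => //; exact: ltW.
  - rewrite -[X in _ < X](@powRVK _ c)//; last by rewrite addr_ge0// ltW.
    by apply: ltr_powR_base => //; exact: ltW.
have -> : S = (if s then [set` `[al, be[ ] else [set` `](- be), (- al)] ]).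
  apply/seteqP; split => x.
    move=> /hS[hx]; rewrite (half_line_abs hx); move: hx; rewrite /half_line /sgnb.
    case: (s) => /=; rewrite !in_itv/= ?andbT ?mul1r ?mulN1r => x0.
      by rewrite key.
    by rewrite key ?oppr_gt0// => h; lra.
  case: (s) hS => hS /=; rewrite in_itv/= => h; apply/hS.
    have x0 : 0 < x by lra.
    by rewrite gtr0_norm// key//; split; [rewrite /half_line /= in_itv/= x0|].
  have x0 : x < 0 by lra.
  rewrite ltr0_norm// key ?oppr_gt0//; split; first by rewrite /half_line /= in_itv/=.
  lra.
by case: (s); (rewrite lebesgue_measure_itv/= lte_fin ifT; last by lra);
  rewrite -EFinB; congr (_%:E); rewrite /gap -/al -/be; lra.
Qed.

Definition cell_volume R (c : R) lam (a : R) (xi : space3 R)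
    s1 s2 s3 k1 k2 : R :=
  fine (lebesgue3 R (shell_cap c lam a xi `&` grid_cell s1 s2 s3 k1 k2)).

Lemma mem_xsection_pair R (A : set (space3 R)) p (x : measurableTypeR R) :
  xsection A p x <-> A (p, x).
Proof. by rewrite /xsection /= inE. Qed.

Lemma cell_volume_bounds R (c : R) lam (a : R) (xi : space3 R)
    s1 s2 s3 k1 k2 (lo hi : R) : 0 <= lo ->
  (forall p, (unit_ivl s1 k1 `*` unit_ivl s2 k2) p ->
    (lo%:E <= @lebesgue_measure R
      (xsection (shell_cap c lam a xi `&` grid_cell s1 s2 s3 k1 k2) p) <= hi%:E)%E) ->
  lo <= cell_volume c lam a xi s1 s2 s3 k1 k2 <= hi.
Proof.
move=> lo0 sec; apply: (lebesgue3_section_bounds _ _ (@cell_square R s1 s2 k1 k2)) => //.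
- by apply: measurableI; [exact: measurable_shell_cap|exact: measurable_grid_cell].
- by apply: measurableX; exact: measurable_unit_ivl.
- by move=> p x3 [_ []].
Qed.

Lemma cell_volume_empty R (c : R) lam (a : R) (xi : space3 R)
    s1 s2 s3 k1 k2 :
  (forall x, shell_cap c lam a xi x -> grid_cell s1 s2 s3 k1 k2 x -> False) ->
  cell_volume c lam a xi s1 s2 s3 k1 k2 = 0.
Proof.
move=> h; rewrite /cell_volume (_ : _ `&` _ = set0) ?measure0//.
by rewrite -subset0 => x [h1 h2]; exact: h h1 h2.
Qed.

Lemma cell_volume_01 R (c : R) lam (a : R) (xi : space3 R)
    s1 s2 s3 k1 k2 : 1 < c ->
  0 <= cell_volume c lam a xi s1 s2 s3 k1 k2 <= 1.
Proof.
move=> c1; apply: cell_volume_bounds => // p _; rewrite measure_ge0/=.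
apply: (@half_shell_le1 _ c (lam%:R - (`|p.1| `^ c + `|p.2| `^ c)) s3) => //.
  apply: measurable_xsection; apply: measurableI; first exact: measurable_shell_cap.
  exact: measurable_grid_cell.
move=> x /mem_xsection_pair[/andP[/andP[g1 g2] _] [_ hx]]; split => //.
by move: g1 g2; rewrite /gpow /= => g1 g2; apply/andP; split; lra.
Qed.

Lemma cell_floorpow R (c : R) s (k : nat) (x : R) : 0 <= c ->
  unit_ivl s k x -> (floorpow c k)%:R <= `|x| `^ c.
Proof.
move=> c0 /unit_ivl_abs[_ /andP[kx _]]; have /andP[h _] := floorpow_itv c k.
by apply: le_trans h _; apply: ler_powR_base.
Qed.

Lemma cell_volume_far R (c : R) lam (a : R) (xi : space3 R)
    s1 s2 s3 k1 k2 : 1 < c ->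
  (lam < floorpow c k1 + floorpow c k2)%N -> cell_volume c lam a xi s1 s2 s3 k1 k2 = 0.
Proof.
move=> c1 far; apply: cell_volume_empty => x /andP[/andP[_ g2] _] [[i1 i2] _].
have c0 : 0 <= c by lra.
have h1 := cell_floorpow c0 i1; have h2 := cell_floorpow c0 i2.
have h3 : lam%:R + 1 <= (floorpow c k1)%:R + (floorpow c k2)%:R :> R.
  by rewrite natr1 -natrD ler_nat.
have := powR_ge0 `|x.2| c; move: g2; rewrite /gpow; lra.
Qed.

Lemma cutoff_ge R (c : R) lam : c != 0 ->
  16 * unitscale c lam `^ (4 * c) + 1 <= (cutoff R lam)%:R.
Proof.
move=> c0; have e : 16 * lam%:R `^ (4 / 5) = 16 * unitscale c lam `^ (4 * c) :> R.
  by rewrite (unitscaleE (4 / 5) lam c0); congr (_ * _ `^ _); field.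
have -> : (cutoff R lam)%:R =
    (Num.truncn (16 * unitscale c lam `^ (4 * c)))%:R + 2 :> R.
  by rewrite /cutoff e -addn2 natrD.
have := powR_ge0 (unitscale c lam) (4 * c); move: (_ `^ _) => y y0.
have y16 : 0 <= 16 * y by lra.
by have /andP[_ h] := truncn_bounds y16; lra.
Qed.

(** The powers of the coordinates in a cell differ from the floors at its corner
    by O(q ^ (5 (c - 1))), and the derivative of the gap at t >= q ^ (4 c) is of
    the order of q ^ (4 - 8 c). *)
Lemma gap_shift R (c q n t : R) : 1 < c < 9 / 8 -> 1 <= q ->
  q `^ (4 * c) <= t -> t <= n -> n - t <= 7 * q `^ (5 * (c - 1)) ->
  gap c^-1 n <= gap c^-1 t <= gap c^-1 n + 7 / q.
Proof.
move=> /andP[c1 c2] q1 qt tn d7.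
have g01 := inv_itv01 c1.
have q0 : 0 < q by lra.
have Q0 : 0 < q `^ (4 * c) by exact: powR_gt0.
have t0 : 0 < t by lra.
rewrite gap_nincr//=.
have d0 : 0 <= n - t by rewrite subr_ge0.
have /andP[_ u] := gap_diff_bounds g01 t0 d0; rewrite subrKC in u.
rewrite -lerBlDl; apply: le_trans u _.
have c0 : c != 0 by rewrite gt_eqF//; lra.
have gc : c * c^-1 = 1 by rewrite mulfV.
have tp : t `^ (c^-1 - 2) <= q `^ (4 - 8 * c).
  have -> : 4 - 8 * c = 4 * c * (c^-1 - 2) by rewrite mulrBr -mulrA gc; ring.
  by rewrite powRrM; apply: ler_powR_base_anti => //; lra.
have gg : c^-1 * (1 - c^-1) <= 1.
  rewrite -[leRHS]mulr1; have /andP[a b] := g01.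
  apply: ler_pM; lra.
have gg0 : 0 <= c^-1 * (1 - c^-1) by have /andP[a b] := g01; apply: mulr_ge0; lra.
apply: (@le_trans _ _ (7 * q `^ (5 * (c - 1)) * (1 * q `^ (4 - 8 * c)))).
  apply: ler_pM => //; first by apply: mulr_ge0 => //; exact: powR_ge0.
  by apply: ler_pM => //; exact: powR_ge0.
rewrite mul1r -mulrA; apply: ler_wpM2l; first exact: ler0n.
rewrite -powRD; last by rewrite (gt_eqF q0) implybT.
rewrite -powR_inv1; last exact: ltW.
by apply: ler_powR => //; lra.
Qed.

Lemma cnorm_shell R (c : R) lam (x : space3 R) : 1 < c ->
  lam%:R <= gpow c x < lam%:R + 1 ->
  0 <= cnorm c x - lam%:R `^ c^-1 <= 1.
Proof.
move=> c1 /andP[g1 g2]; rewrite cnormE.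
have i0 : 0 <= c^-1 by rewrite invr_ge0; lra.
have g01 := inv_itv01 c1.
have h1 : lam%:R `^ c^-1 <= gpow c x `^ c^-1 by exact: ler_powR_base.
have h2 : gpow c x `^ c^-1 <= (lam%:R + 1) `^ c^-1.
  by apply: ler_powR_base; [|exact: gpow_ge0|exact: ltW].
have := gap_bounds g01 (ler0n R lam); rewrite /gap => /andP[_ h3].
by apply/andP; split; lra.
Qed.

Lemma grid_cell_level R (c : R) lam (xi : space3 R) (x : space3 R)
    s1 s2 s3 k1 k2 : 1 < c < 9 / 8 -> (1 <= lam)%N ->
  unit_sphere xi -> inner_pair c lam k1 k2 -> grid_cell s1 s2 s3 k1 k2 x ->
  lam%:R <= gpow c x < lam%:R + 1 ->
  `|dot3 x xi - level c lam (sgnb R s1 * xi.1.1) (sgnb R s2 * xi.1.2)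
      (sgnb R s3 * xi.2) k1 k2| <= 9 * unitscale c lam `^ (5 * (c - 1)).
Proof.
move=> c12 l1 /coord_unit_sphere[n1 n2 n3] inn [[i1 i2] i3] g.
have [a1 b1] := unit_ivl_abs i1; have [a2 b2] := unit_ivl_abs i2; have a3 := half_line_abs i3.
have sq s : sgnb R s * sgnb R s = 1 by rewrite /sgnb; case: s; rewrite ?mulr1// mulrNN mulr1.
have ns s (u : R) : `|u| <= 1 -> `|sgnb R s * u| <= 1.
  by rewrite /sgnb; case: s; rewrite ?mul1r// mulN1r normrN.
have -> : dot3 x xi = sgnb R s1 * xi.1.1 * `|x.1.1| + sgnb R s2 * xi.1.2 * `|x.1.2| +
    sgnb R s3 * xi.2 * `|x.2|.
  rewrite a1 a2 a3 /dot3.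
  have e s (u w : R) : sgnb R s * u * (sgnb R s * w) = w * u.
    by rewrite mulrACA sq mul1r mulrC.
  by rewrite !e.
apply: cell_level => //; [exact: ns|exact: ns|exact: ns|].
by move: g; rewrite /gpow => /andP[h1 h2]; apply/andP; split; lra.
Qed.

(** If the level clears the bound by the tolerance, the whole cell satisfies the
    condition of the cap, and each vertical section is an interval whose length
    is the gap at a point close to n (gap_shift). *)
Lemma cell_volume_in R (c : R) lam (a : R) (xi : space3 R)
    s1 s2 s3 k1 k2 : 1 < c < 9 / 8 -> (1 <= lam)%N ->
  unit_sphere xi -> `|a| <= 10 -> inner_pair c lam k1 k2 ->
  a * lam%:R `^ c^-1 + tolerance c lam <=
    level c lam (sgnb R s1 * xi.1.1) (sgnb R s2 * xi.1.2) (sgnb R s3 * xi.2) k1 k2 ->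
  `|cell_volume c lam a xi s1 s2 s3 k1 k2 -
    gap c^-1 (lam%:R - (floorpow c k1)%:R - (floorpow c k2)%:R)| <= 7 / unitscale c lam.
Proof.
move=> c12 l1 xi1 a10 inn hi; have /andP[c1 c2] := c12.
have q1 := unitscale_ge1 c1 l1.
have c0 : c != 0 by rewrite gt_eqF//; lra.
set n := lam%:R - _ - _; set q := unitscale c lam in q1 *.
have Q1 : 1 <= q `^ (5 * (c - 1)) by apply: powR_ge1 => //; lra.
have g01 := inv_itv01 c1.
have q4 : q `^ (5 * (c - 1)) <= q `^ (4 * c) by apply: ler_powR => //; lra.
have ncut : 16 * q `^ (4 * c) + 1 <= n.
  apply: le_trans (cutoff_ge lam c0) _; rewrite /n.
  by move: inn; rewrite /inner_pair -(ler_nat R) !natrD; lra.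
suff : gap c^-1 n <= cell_volume c lam a xi s1 s2 s3 k1 k2 <= gap c^-1 n + 7 / q.
  move: (cell_volume _ _ _ _ _ _ _ _ _) (gap _ _) (7 / q) => x y z; clear.
  by move=> /andP[h1 h2]; rewrite ler_norml; apply/andP; split; lra.
apply: cell_volume_bounds.
  have n0 : 0 <= n by lra.
  by have /andP[] := gap_bounds g01 n0.
move=> p [i1 i2].
pose t := lam%:R - (`|p.1| `^ c + `|p.2| `^ c).
have inn' : inner_pair c lam k2 k1 by rewrite inner_pairC.
have [_ b1] := unit_ivl_abs i1; have [_ b2] := unit_ivl_abs i2.
have /andP[p1 p1'] := cell_pow_le c12 q1 (ler0n _ k1) (inner_pair_side c1 l1 inn) b1.
have /andP[p2 p2'] := cell_pow_le c12 q1 (ler0n _ k2) (inner_pair_side c1 l1 inn') b2.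
have /andP[f1 f1'] := floorpow_itv c k1; have /andP[f2 f2'] := floorpow_itv c k2.
have tn : t <= n by rewrite /t /n; clear -p1 p2 f1 f2; lra.
have nt : n - t <= 7 * q `^ (5 * (c - 1)).
  by rewrite /t /n; clear -p1' p2' f1' f2' Q1; lra.
have qt : q `^ (4 * c) <= t by clear -nt ncut q4 Q1; lra.
have t0 : 0 < t by apply: lt_le_trans qt; apply: powR_gt0; lra.
rewrite (@half_shell_gap _ c t s3 _ c1 t0).
  by rewrite !lee_fin; exact: gap_shift.
move=> x; split.
  move=> /mem_xsection_pair[/andP[/andP[g1 g2] _] [_ hx]]; split => //.
  by move: g1 g2; rewrite /gpow /t /= => g1 g2; apply/andP; split; lra.
move=> [hx /andP[x1 x2]]; apply/mem_xsection_pair.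
have g : lam%:R <= gpow c (p, x) < lam%:R + 1.
  by rewrite /gpow /=; move: x1 x2; rewrite /t; clear; move=> x1 x2; apply/andP; split; lra.
have hc : grid_cell s1 s2 s3 k1 k2 (p, x) by split.
split => //; rewrite /shell_cap /= g /=.
have := grid_cell_level c12 l1 xi1 inn hc g; rewrite -/q.
have /andP[n1 n2] := cnorm_shell c1 g.
move: hi; rewrite /tolerance -/q.
move: (level _ _ _ _ _ _ _) (dot3 _ _) (cnorm _ _) n1 n2 => l d cn n1 n2 h.
rewrite ler_norml => /andP[h1 _].
have : a * (cn - lam%:R `^ c^-1) <= 10.
  apply: le_trans (ler_norm _) _; rewrite normrM (ger0_norm n1).
  by rewrite -[leRHS]mulr1; apply: ler_pM.
by clear -h h1 Q1; lra.
Qed.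

Lemma cell_volume_out R (c : R) lam (a : R) (xi : space3 R)
    s1 s2 s3 k1 k2 : 1 < c < 9 / 8 -> (1 <= lam)%N ->
  unit_sphere xi -> `|a| <= 10 -> inner_pair c lam k1 k2 ->
  level c lam (sgnb R s1 * xi.1.1) (sgnb R s2 * xi.1.2) (sgnb R s3 * xi.2) k1 k2 <=
    a * lam%:R `^ c^-1 - tolerance c lam ->
  cell_volume c lam a xi s1 s2 s3 k1 k2 = 0.
Proof.
move=> c12 l1 xi1 a10 inn lo; have /andP[c1 c2] := c12.
have q1 := unitscale_ge1 c1 l1.
have Q1 : 1 <= unitscale c lam `^ (5 * (c - 1)) by apply: powR_ge1 => //; lra.
apply: cell_volume_empty => x /andP[g ad] hc.
have := grid_cell_level c12 l1 xi1 inn hc g.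
have /andP[n1 n2] := cnorm_shell c1 g.
move: lo ad; rewrite /tolerance.
move: (level _ _ _ _ _ _ _) (dot3 _ _) (cnorm _ _) n1 n2 => l d cn n1 n2 h ad.
rewrite ler_norml => /andP[_ h1].
have : - 10 <= a * (cn - lam%:R `^ c^-1).
  rewrite lerNl; apply: le_trans (ler_norm _) _; rewrite normrN normrM (ger0_norm n1).
  by rewrite -[leRHS]mulr1; apply: ler_pM.
by clear -h h1 Q1 ad; lra.
Qed.

Lemma fine_measure_partition d (T : measurableType d) R
    (mu : {measure set T -> \bar R}) (I : finType) (A N : set T) (F : I -> set T) :
  measurable A -> (mu A < +oo)%E -> measurable N -> mu N = 0%E ->
  (forall i, measurable (F i)) ->
  (forall i j x, F i x -> F j x -> i = j) ->
  (forall x, A x -> N x \/ exists i, F i x) ->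
  \sum_i fine (mu (A `&` F i)) = fine (mu A).
Proof.
move=> mA Afin mN N0 mF Finj cov.
have mAF i : measurable (A `&` F i) by exact: measurableI.
have fAF i : mu (A `&` F i) \is a fin_num.
  rewrite ge0_fin_numE//; apply: le_lt_trans Afin.
  by apply: le_measure; rewrite ?inE//; exact: subIsetl.
have mU : measurable (\bigcup_(i in [set` index_enum I]) (A `&` F i)).
  by apply: fin_bigcup_measurable => //; exact: finite_seq.
have -> : mu A = mu (\bigcup_(i in [set` index_enum I]) (A `&` F i)).
  apply/eqP; rewrite eq_le; apply/andP; split; last first.
    by apply: le_measure; rewrite ?inE// => x [i _ []].
  rewrite -[leRHS]adde0 -N0; apply: le_trans (measureU2 _ mU mN).
  apply: le_measure; rewrite ?inE//; first exact: measurableU.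
  by move=> x Ax; have [|[i Fi]] := cov _ Ax; [right|left; exists i => //=; exact: mem_index_enum].
rewrite measure_fin_bigcup//; last first.
  by move=> i j _ _ [x [[_ Fi] [_ Fj]]]; exact: Finj Fi Fj.
rewrite -fsbig_seq ?index_enum_uniq//.
rewrite -[LHS]/(fine (\sum_i fine (mu (A `&` F i)))%:E) -sumEFin.
by congr fine; apply: eq_bigr => i _; rewrite fineK.
Qed.

Lemma unit_ivl_disjoint R s s' k k' (x : R) :
  unit_ivl s k x -> unit_ivl s' k' x -> s = s' /\ k = k'.
Proof.
have k0 := ler0n R k; have k0' := ler0n R k'.
have key (y : R) : k%:R <= y <= k%:R + 1 -> k'%:R <= y <= k'%:R + 1 ->
    (y < k%:R + 1 /\ y < k'%:R + 1) \/ (k%:R < y /\ k'%:R < y) -> k = k'.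
  move=> /andP[a1 a2] /andP[b1 b2] h; apply/eqP.
  rewrite eqn_leq -(ltnS k) -(ltnS k') -!(ltr_nat R) -!natr1.
  by apply/andP; split; lra.
rewrite /unit_ivl; case: s; case: s' => /=; rewrite !in_itv/= => /andP[a b] /andP[a' b'].
- by split => //; apply: (key x); clear key; lra.
- by exfalso; clear key; lra.
- by exfalso; clear key; lra.
- by split => //; apply: (key (- x)); clear key; lra.
Qed.

Lemma half_line_disjoint R s s' (x : R) : half_line s x -> half_line s' x -> s = s'.
Proof. by rewrite /half_line; case: s; case: s' => //=; rewrite !in_itv/= ?andbT; lra. Qed.

Lemma unit_ivl_cover R (x : R) : exists s, exists2 k, unit_ivl s k x & k%:R <= `|x|.
Proof.
move: (truncn_bounds (normr_ge0 x)); have [x0|x0] := ger0P x => /andP[h1 h2].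
  by exists true, (Num.truncn x) => //; rewrite /unit_ivl /= in_itv/=; apply/andP.
move: h1 h2; set k := Num.truncn _; rewrite le_eqVlt => /predU1P[e _|h1 h2]; last first.
  by exists false, k; rewrite ?ltW// /unit_ivl /= in_itv/=; apply/andP; split; lra.
(* Here - x is an integer, and the interval that contains x has index k - 1. *)
have k0 : (0 < k)%N by rewrite -(ltr_nat R); lra.
have e' : k.-1%:R + 1 = k%:R :> R by rewrite natr1 prednK.
by exists false, k.-1; [rewrite /unit_ivl /= in_itv/=; apply/andP; split|]; lra.
Qed.

Lemma plane_box R :
  [set x : space3 R | x.2 = 0] = (setT `*` setT) `*` [set 0].
Proof. by apply/seteqP; split => x //= []. Qed.

Lemma lebesgue3_plane R : lebesgue3 R [set x | x.2 = 0] = 0%E.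
Proof.
rewrite plane_box lebesgue3_box//.
by rewrite (_ : lebesgue_measure [set 0 : R] = 0%E) ?mule0//; exact: lebesgue_measure_set1.
Qed.

Definition cell_index (M : nat) : finType := ((bool * bool * bool) * ('I_M * 'I_M))%type.

(** The cells tile the space up to the plane where the third coordinate
    vanishes, which is a null set. *)
Lemma sum_cell_volume R (c : R) lam (a : R) (xi : space3 R) :
  1 < c -> (1 <= lam)%N ->
  \sum_(i : cell_index (side c lam))
    cell_volume c lam a xi i.1.1.1 i.1.1.2 i.1.2 i.2.1 i.2.2 =
  fine (lebesgue3 R (shell_cap c lam a xi)).
Proof.
move=> c1 l1; have c0 : 0 < c by lra.
have m0 : measurable [set x : space3 R | x.2 = 0].
  by rewrite plane_box; do 2 (apply: measurableX => //).
apply: (@fine_measure_partition _ _ _ (lebesgue3 R) _ _ [set x | x.2 = 0]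
  (fun i : cell_index _ => grid_cell i.1.1.1 i.1.1.2 i.1.2 i.2.1 i.2.2)) => //.
- exact: measurable_shell_cap.
- exact: shell_cap_finite.
- exact: lebesgue3_plane.
- by move=> i; exact: measurable_grid_cell.
- move=> [[[s1 s2] s3] [k1 k2]] [[[r1 r2] r3] [j1 j2]] x /= [[a1 a2] a3] [[b1 b2] b3].
  have [-> e1] := unit_ivl_disjoint a1 b1; have [-> e2] := unit_ivl_disjoint a2 b2.
  by rewrite (half_line_disjoint a3 b3) (ord_inj e1) (ord_inj e2).
move=> x /andP[/andP[_ g] _]; have [x0|x0] := eqVneq x.2 0; [by left|right].
have [g1 g2 _] := coord_le_gpow c x.
have lt_side (u : R) k : k%:R <= `|u| -> `|u| `^ c <= gpow c x -> (k < side c lam)%N.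
  move=> ku uc; rewrite -(ltr_nat R); apply: le_lt_trans ku _.
  apply: (@lt_le_trans _ _ ((lam.+1)%:R `^ c^-1)); last exact: side_ge_root.
  by apply: powR_lt_root => //; apply: le_lt_trans uc _; rewrite -natr1.
have [s1 [k1 i1 /lt_side/(_ g1) l1']] := unit_ivl_cover x.1.1.
have [s2 [k2 i2 /lt_side/(_ g2) l2']] := unit_ivl_cover x.1.2.
exists ((s1, s2, 0 < x.2), (Ordinal l1', Ordinal l2')).
split; first by split.
rewrite /half_line /=; case: ltrP => h /=; rewrite in_itv/= ?h//.
by rewrite lt_neqAle x0.
Qed.

(** * Lattice points *)

(** Points on the coordinate planes have several sign patterns, so the part W of
    the parametrisation is only required to cover them. *)
Lemma card_fset_set_bounds (U : choiceType) (T : finType) (f : T -> U) (A : set U)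
    (V W : {pred T}) :
  {in V &, injective f} -> (forall t, t \in V -> A (f t)) ->
  (forall x, A x -> exists2 t, (t \in V) || (t \in W) & f t = x) ->
  finite_set A /\ (#|V| <= #|` fset_set A|%fset <= #|V| + #|W|)%N.
Proof.
move=> finj VA Acov.
have Afin : finite_set A.
  apply: (@sub_finite_set _ _ [set` [seq f t | t : T]]); last exact: finite_seq.
  by move=> x /Acov[t _ <-] /=; apply: map_f; rewrite mem_enum.
split => //; rewrite -(size_image f V) -(size_image f W) -size_cat; apply/andP; split.
  apply: uniq_leq_size; first by rewrite map_inj_in_uniq ?enum_uniq// => i j;
    rewrite !mem_enum; exact: finj.
  by move=> x /mapP[t]; rewrite mem_enum => Vt ->; rewrite in_fset_set// inE; exact: VA.
apply: uniq_leq_size => [|x]; first exact: fset_uniq.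
rewrite in_fset_set// inE => /Acov[t /orP[h|h] <-]; rewrite mem_cat; apply/orP; [left|right];
  by apply: map_f; rewrite mem_enum.
Qed.

Definition signed_int s (k : nat) : int := if s then k%:Z else - k%:Z.

Lemma signed_intE R s k : (signed_int s k)%:~R = sgnb R s * k%:R.
Proof. by rewrite /signed_int /sgnb; case: s; rewrite ?mul1r// mulN1r rmorphN. Qed.

Lemma absz_signed_int s k : `|signed_int s k|%N = k.
Proof. by rewrite /signed_int; case: s; rewrite ?abszN. Qed.

Lemma signed_int_inj s s' k k' : (0 < k)%N -> signed_int s k = signed_int s' k' ->
  s = s' /\ k = k'.
Proof. by rewrite /signed_int; case: s; case: s' => k0 h; split => //; lia. Qed.

Lemma signed_int_surj (z : int) : z = signed_int (0 <= z) `|z|%N.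
Proof. by rewrite /signed_int; case: ifP; lia. Qed.

Definition real_point R (z : int * int * int) : space3 R :=
  (z.1.1%:~R, z.1.2%:~R, z.2%:~R).

Lemma floor_powR_int R (c : R) (z : int) :
  Num.floor (`|z%:~R : R| `^ c) = (floorpow c `|z|)%:Z.
Proof.
rewrite -intr_norm -natr_absz /floorpow truncn_floor powR_ge0.
by rewrite gez0_abs// floor_ge0 powR_ge0.
Qed.

Lemma S3E R (c : R) lam (z : int * int * int) :
  S3 c lam z <->
  (floorpow c `|z.1.1| + floorpow c `|z.1.2| + floorpow c `|z.2| = lam)%N.
Proof.
rewrite /S3 /= !floor_powR_int; split; first by move=> /eqP; rewrite -!PoszD => /eqP[].
by move=> <-; rewrite !PoszD.
Qed.

Lemma floorpow_lt_side R (c : R) lam k : 1 < c -> (1 <= lam)%N ->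
  (floorpow c k <= lam)%N -> (k < side c lam)%N.
Proof.
move=> c1 l1 kl; rewrite -(ltr_nat R).
apply: (@lt_le_trans _ _ ((lam.+1)%:R `^ c^-1)); last exact: side_ge_root.
have /andP[_ h] := floorpow_itv c k; apply: powR_lt_root => //; first by lra.
by apply: lt_le_trans h _; rewrite natr1 ler_nat.
Qed.

Lemma floorpow_inj R (c : R) : 1 < c -> injective (floorpow c).
Proof.
move=> c1 i j e; case: (ltngtP i j) => // /(floorpow_homo c1); rewrite e ltnn //.
Qed.

Definition half_lattice R (c : R) lam (xi : space3 R) (b : R) :
    set (int * int * int) :=
  S3 c lam `&` [set z | b <= dot3 (real_point R z) xi].

(** Points off the coordinate planes are counted by the fibers. The others lie
    on one of three planes, have one of eight sign patterns, and two coordinates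
    of which one is determined by the other since the floors of the powers are
    injective. *)
Lemma half_lattice_count R (c : R) lam (xi : space3 R) (b : R) :
  1 < c -> (1 <= lam)%N ->
  let count := \sum_(i : cell_index (side c lam))
    fiber c lam (sgnb R i.1.1.1 * xi.1.1) (sgnb R i.1.1.2 * xi.1.2) (sgnb R i.1.2 * xi.2)
      b i.2.1 i.2.2 in
  finite_set (half_lattice c lam xi b) /\
  count <= (#|` fset_set (half_lattice c lam xi b)|%fset)%:R <=
    count + 24 * (side c lam)%:R.
Proof.
move=> c1 l1 count; set M := side c lam in count *.
pose T := (cell_index M * 'I_M)%type : finType.
pose f (t : T) : int * int * int :=
  (signed_int t.1.1.1.1 t.1.2.1, signed_int t.1.1.1.2 t.1.2.2, signed_int t.1.1.2 t.2).
pose on (t : T) := (floorpow c t.1.2.1 + floorpow c t.1.2.2 + floorpow c t.2 == lam)%N.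
pose V : {pred T} := [pred t : T | [&& (0 < t.1.2.1)%N, (0 < t.1.2.2)%N, (0 < t.2)%N,
    on t & b <= sgnb R t.1.1.1.1 * xi.1.1 * t.1.2.1%:R +
      sgnb R t.1.1.1.2 * xi.1.2 * t.1.2.2%:R + sgnb R t.1.1.2 * xi.2 * t.2%:R]].
pose W1 : {pred T} := [pred t : T | (t.1.2.1 == 0%N :> nat) && on t].
pose W2 : {pred T} := [pred t : T | (t.1.2.2 == 0%N :> nat) && on t].
pose W3 : {pred T} := [pred t : T | (t.2 == 0%N :> nat) && on t].
pose W : {pred T} := [predU [predU W1 & W2] & W3].
have countE : count = #|V|%:R.
  rewrite -sum1_card natr_sum big_mkcond/= /count /fiber pair_bigA/=.
  by apply: eq_bigr => t _; rewrite inE/=; case: ifP.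
have fdot t : dot3 (real_point R (f t)) xi =
    sgnb R t.1.1.1.1 * xi.1.1 * t.1.2.1%:R +
      sgnb R t.1.1.1.2 * xi.1.2 * t.1.2.2%:R + sgnb R t.1.1.2 * xi.2 * t.2%:R.
  rewrite /dot3 /real_point /f /= !signed_intE.
  by rewrite ![_ * _ * xi.1.1]mulrAC ![_ * _ * xi.1.2]mulrAC ![_ * _ * xi.2]mulrAC.
have fS t : on t -> S3 c lam (f t).
  by move=> /eqP h; apply/S3E; rewrite /f /= !absz_signed_int.
have [fin /andP[lo hi]] : finite_set (half_lattice c lam xi b) /\
    (#|V| <= #|` fset_set (half_lattice c lam xi b)|%fset <= #|V| + #|W|)%N.
  apply: (@card_fset_set_bounds _ T f).
  - move=> [[[[s1 s2] s3] [k1 k2]] k3] [[[[r1 r2] r3] [j1 j2]] j3].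
    rewrite !inE /f /= => /and5P[p1 p2 p3 _ _] _ [].
    move=> /(signed_int_inj p1)[-> /ord_inj ->].
    by move=> /(signed_int_inj p2)[-> /ord_inj ->] /(signed_int_inj p3)[-> /ord_inj ->].
  - move=> t; rewrite inE /= => /and5P[_ _ _ h hb]; split; first exact: fS.
    by rewrite /= fdot.
  move=> z [/S3E zS] /= zb.
  have lt_side z' : (floorpow c `|z'|%N <= lam)%N -> (`|z'|%N < M)%N.
    exact: floorpow_lt_side.
  have h1 : (`|z.1.1|%N < M)%N by apply: lt_side; rewrite -zS -addnA leq_addr.
  have h2 : (`|z.1.2|%N < M)%N by apply: lt_side; rewrite -zS addnAC leq_addl.
  have h3 : (`|z.2|%N < M)%N by apply: lt_side; rewrite -zS leq_addl.
  pose t : T := ((((0 <= z.1.1, 0 <= z.1.2), 0 <= z.2), (Ordinal h1, Ordinal h2)), Ordinal h3).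
  have tz : f t = z.
    by rewrite /f /= -!signed_int_surj -!surjective_pairing.
  exists t => //; have ont : on t by apply/eqP.
  have tb := fdot t; rewrite tz in tb; rewrite tb in zb.
  rewrite !inE ont zb !andbT !lt0n.
  by case: eqP; case: eqP; case: eqP.
split => //; rewrite countE; apply/andP; split; first by rewrite ler_nat.
apply: (@le_trans _ _ (#|V| + #|W|)%:R); first by rewrite ler_nat.
rewrite natrD lerD2l -natrM ler_nat.
have cardU : #|{: (bool * bool * bool) * 'I_M}| = (8 * M)%N.
  by rewrite !card_prod !card_bool card_ord.
have w1 : (#|W1| <= 8 * M)%N.
  rewrite -cardU; apply: (leq_card_in (fun t : T => (t.1.1, t.1.2.2))).
  move=> [[s [k1 k2]] k3] [[r [j1 j2]] j3].
  rewrite !inE /on /= => /andP[/eqP k0 /eqP kl] /andP[/eqP j0 /eqP jl] [-> e].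
  have -> : k1 = j1 by apply: ord_inj; rewrite k0.
  rewrite e; congr (_, _); apply/ord_inj/(floorpow_inj c1)/eqP.
  by rewrite -(eqn_add2l (floorpow c j1 + floorpow c j2)) jl -kl k0 j0 e.
have w2 : (#|W2| <= 8 * M)%N.
  rewrite -cardU; apply: (leq_card_in (fun t : T => (t.1.1, t.1.2.1))).
  move=> [[s [k1 k2]] k3] [[r [j1 j2]] j3].
  rewrite !inE /on /= => /andP[/eqP k0 /eqP kl] /andP[/eqP j0 /eqP jl] [-> e].
  have -> : k2 = j2 by apply: ord_inj; rewrite k0.
  rewrite e; congr (_, _); apply/ord_inj/(floorpow_inj c1)/eqP.
  by rewrite -(eqn_add2l (floorpow c j1 + floorpow c j2)) jl -kl k0 j0 e.
have w3 : (#|W3| <= 8 * M)%N.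
  rewrite -cardU; apply: (leq_card_in (fun t : T => (t.1.1, t.1.2.1))).
  move=> [[s [k1 k2]] k3] [[r [j1 j2]] j3].
  rewrite !inE /on /= => /andP[/eqP k0 /eqP kl] /andP[/eqP j0 /eqP jl] [-> e].
  have -> : k3 = j3 by apply: ord_inj; rewrite k0.
  rewrite e; congr (_, (_, _), _); apply/ord_inj/(floorpow_inj c1)/eqP.
  by rewrite -(eqn_add2l (floorpow c j1)) -(eqn_add2r (floorpow c j3)) jl -kl k0 j0 e.
have -> : (24 * M = 8 * M + 8 * M + 8 * M)%N by rewrite -!mulnDl.
have cardU2 (A B : {pred T}) : (#|[predU A & B]| <= #|A| + #|B|)%N.
  by rewrite -cardUI leq_addr.
apply: leq_trans (cardU2 _ _) (leq_add _ w3).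
exact: leq_trans (cardU2 _ _) (leq_add w1 w2).
Qed.

(** The sum over the eight octants, each of them reflected to the positive one. *)
Lemma half_lattice_discrepancy R (c : R) : 1 < c < 9 / 8 ->
  exists2 C : R, 0 < C & forall (lam : nat) (xi : space3 R) (a : R),
  (1 <= lam)%N -> unit_sphere xi -> `|a| <= 10 ->
  `|(#|` fset_set (half_lattice c lam xi (a * lam%:R `^ c^-1))|%fset)%:R -
    fine (lebesgue3 R (shell_cap c lam a xi))| <=
  C * harmonic R (side c lam) ^+ 2 * unitscale c lam `^ (6 + 3 * c).
Proof.
move=> c12; have /andP[c1 c2] := c12.
have [C0 C00 octant] := octant_discrepancy c12.
exists (8 * C0 + 72) => [|lam xi a l1 xi1 a10]; first by clear -C00; lra.
set b := a * _; set q := unitscale c lam; set h := harmonic R _.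
have q1 : 1 <= q := unitscale_ge1 c1 l1.
have h1 : 1 <= h := harmonic_side_ge1 c lam.
have hh : 1 <= h ^+ 2 by rewrite expr2; apply: mulr_ege1.
have [_] := half_lattice_count xi b c1 l1.
rewrite -(@sum_cell_volume R c lam a xi c1 l1).
set cnt := _%:R; set S := bigop _ _ _; set V := bigop _ _ _ => cntS.
have SV : `|S - V| <= 8 * (C0 * h ^+ 2 * q `^ (6 + 3 * c)).
  have -> : S - V = \sum_(s : bool * bool * bool) \sum_(k2 < side c lam) \sum_(k1 < side c lam)
      (fiber c lam (sgnb R s.1.1 * xi.1.1) (sgnb R s.1.2 * xi.1.2) (sgnb R s.2 * xi.2) b k1 k2
       - cell_volume c lam a xi s.1.1 s.1.2 s.2 k1 k2).
    rewrite /S /V -sumrB; set D := fun s : bool * bool * bool => fun k1 k2 : nat =>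
      fiber c lam (sgnb R s.1.1 * xi.1.1) (sgnb R s.1.2 * xi.1.2) (sgnb R s.2 * xi.2) b k1 k2
      - cell_volume c lam a xi s.1.1 s.1.2 s.2 k1 k2.
    transitivity (\sum_(s : bool * bool * bool)
        \sum_(p : 'I_(side c lam) * 'I_(side c lam)) D s p.1 p.2).
      by rewrite pair_bigA.
    by apply: eq_bigr => s _; rewrite exchange_big/= pair_bigA.
  have -> : 8 * (C0 * h ^+ 2 * q `^ (6 + 3 * c)) =
      \sum_(s : bool * bool * bool) (C0 * h ^+ 2 * q `^ (6 + 3 * c)).
    by rewrite sumr_const !card_prod !card_bool mulr_natl.
  apply: le_trans (ler_norm_sum _ _ _) _; apply: ler_sum => s _.
  have sq t (u : R) : (sgnb R t * u) ^+ 2 = u ^+ 2.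
    by rewrite exprMn /sgnb; case: t; rewrite ?sqrrN expr1n mul1r.
  apply: (octant lam _ _ _ b (cell_volume c lam a xi s.1.1 s.1.2 s.2)) => //.
  - by rewrite !sq; exact: unit_sphere_sq.
  - by move=> k1 k2; exact: cell_volume_01.
  - by move=> k1 k2; exact: cell_volume_far.
  - by move=> k1 k2 inn hi; exact: cell_volume_in.
  - by move=> k1 k2 inn hi; exact: cell_volume_out.
have side_le : 24 * (side c lam)%:R <= 72 * (h ^+ 2 * q `^ (6 + 3 * c)).
  have /andP[_ s1] := side_bounds c1 l1.
  have s2 : q `^ 5 <= q `^ (6 + 3 * c) by apply: ler_powR => //; clear -c1; lra.
  have s3 : q `^ (6 + 3 * c) <= h ^+ 2 * q `^ (6 + 3 * c).
    by rewrite -[leLHS]mul1r; apply: ler_wpM2r => //; exact: powR_ge0.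
  by rewrite -/q in s1; clear -s1 s2 s3; lra.
move: cntS SV side_le; rewrite -!mulrA.
move: (h * (h * _)) (24 * _) => E M; clear -C00.
by rewrite !ler_norml => /andP[a1 a2] /andP[b1 b2] m; apply/andP; split; lra.
Qed.

Lemma lattice_coord_bound R (c : R) lam (z : int * int * int) :
  1 < c -> (1 <= lam)%N -> S3 c lam z ->
  [/\ `|z.1.1%:~R| <= 2 * lam%:R `^ c^-1, `|z.1.2%:~R| <= 2 * lam%:R `^ c^-1 &
      `|z.2%:~R| <= 2 * lam%:R `^ c^-1 :> R].
Proof.
move=> c1 l1 /S3E zS.
have key (k : int) : (floorpow c `|k|%N <= lam)%N -> `|k%:~R| <= 2 * lam%:R `^ c^-1 :> R.
  move=> kl; have /andP[_ h] := floorpow_itv c `|k|%N.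
  rewrite -intr_norm -natr_absz.
  have h2 : (`|k|%N)%:R `^ c < lam%:R + 1.
    by apply: lt_le_trans h _; rewrite lerD2r ler_nat.
  have c0 : 0 < c by lra.
  apply: le_trans (ltW (powR_lt_root c0 (ler0n _ _) h2)) _.
  have g01 := inv_itv01 c1.
  have := gap_bounds g01 (ler0n R lam); rewrite /gap => /andP[_ h3].
  have : 1 <= lam%:R `^ c^-1 by apply: powR_ge1; rewrite ?ler1n// invr_ge0 ltW.
  by move: h3; move: (_ `^ _) (_ `^ _) => x y; clear; lra.
split; apply: key; rewrite -zS.
- by rewrite -addnA leq_addr.
- by rewrite addnAC leq_addl.
- by rewrite leq_addl.
Qed.

Lemma lattice_dot_bound R (c : R) lam (xi : space3 R)
    (z : int * int * int) : 1 < c -> (1 <= lam)%N -> unit_sphere xi -> S3 c lam z ->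
  `|dot3 (real_point R z) xi| <= 6 * lam%:R `^ c^-1.
Proof.
move=> c1 l1 /coord_unit_sphere[n1 n2 n3] /(lattice_coord_bound c1 l1).
move: (lam%:R `^ _) => G [g1 g2 g3].
have key (u v : R) : `|u| <= 2 * G -> `|v| <= 1 -> `|u * v| <= 2 * G.
  by move=> hu hv; rewrite normrM -[leRHS]mulr1; apply: ler_pM.
have k1 := key _ _ g1 n1; have k2 := key _ _ g2 n2; have k3 := key _ _ g3 n3.
rewrite /dot3 /real_point /=; apply: le_trans (ler_normD _ _) _.
have := ler_normD (z.1.1%:~R * xi.1.1) (z.1.2%:~R * xi.1.2).
by clear -k1 k2 k3; lra.
Qed.

Lemma half_lattice_full R (c : R) lam (xi : space3 R) :
  1 < c -> (1 <= lam)%N -> unit_sphere xi ->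
  half_lattice c lam xi (- 10 * lam%:R `^ c^-1) = S3 c lam.
Proof.
move=> c1 l1 xi1; apply/seteqP; split => z; first by case.
move=> zS; split => //=; have := lattice_dot_bound c1 l1 xi1 zS.
rewrite ler_norml => /andP[h _]; apply: le_trans h.
by have := powR_ge0 (lam%:R : R) c^-1; move: (_ `^ _) => x; clear; lra.
Qed.

Lemma half_lattice_empty R (c : R) lam (xi : space3 R) (a : R) :
  1 < c -> (1 <= lam)%N -> unit_sphere xi -> 10 <= a ->
  half_lattice c lam xi (a * lam%:R `^ c^-1) = set0.
Proof.
move=> c1 l1 xi1 a10; rewrite -subset0 => z [zS /=].
have := lattice_dot_bound c1 l1 xi1 zS; rewrite ler_norml => /andP[_ h] h2.
have p0 : 0 < lam%:R `^ c^-1 :> R by apply: powR_gt0; rewrite ltr0n.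
have := le_trans h2 h; rewrite ler_pM2r//; lra.
Qed.

Lemma real_point_scale_inj R (t : R) : t != 0 ->
  injective (fun z => scale3 t (real_point R z)).
Proof.
move=> t0 [[x1 x2] x3] [[y1 y2] y3]; rewrite /scale3 /real_point /= => -[].
by do 3 move=> /(mulfI t0)/intr_inj ->.
Qed.

(** The scaling is injective, and the upper bound 100 in the definition of the
    solid cap is satisfied by all points of the scaled set. *)
Lemma card_solid_cap R (c : R) lam (xi : space3 R) (a : R) :
  1 < c -> (1 <= lam)%N -> unit_sphere xi ->
  #|` fset_set (P3 c lam `&` solid_cap a xi)|%fset =
  #|` fset_set (half_lattice c lam xi (a * lam%:R `^ c^-1))|%fset.
Proof.
move=> c1 l1 xi1; have [fin _] := half_lattice_count xi (a * lam%:R `^ c^-1) c1 l1.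
have p0 : 0 < lam%:R `^ c^-1 :> R by apply: powR_gt0; rewrite ltr0n.
set t : R := lam%:R `^ (- (1 / c)).
have te : t = (lam%:R `^ c^-1)^-1 by rewrite /t powRN div1r.
have t0 : 0 < t by rewrite te invr_gt0.
have -> : P3 c lam `&` solid_cap a xi =
    (fun z => scale3 t (real_point R z)) @` half_lattice c lam xi (a * lam%:R `^ c^-1).
  have inner z : S3 c lam z -> (solid_cap a xi (scale3 t (real_point R z)) : Prop) <->
      a * lam%:R `^ c^-1 <= dot3 (real_point R z) xi.
    move=> zS; rewrite /solid_cap /= dot3_scale.
    have := lattice_dot_bound c1 l1 xi1 zS; rewrite ler_norml => /andP[_ h].
    rewrite te [_^-1 * _]mulrC ler_pdivlMr// ler_pdivrMr//.
    have -> : dot3 (real_point R z) xi <= 100 * lam%:R `^ c^-1.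
      by apply: le_trans h _; apply: ler_wpM2r; [exact: ltW|rewrite ler_nat].
    by rewrite andbT.
  apply/seteqP; split => x.
    move=> [[z zS <-] zc]; exists z => //; split => //.
    exact: (inner z zS).1.
  move=> [z [zS zb] <-]; split; first by exists z.
  exact: (inner z zS).2.
rewrite fset_set_image// card_imfset//=; apply: real_point_scale_inj.
by rewrite gt_eqF.
Qed.

(** * The discrepancy of spherical caps *)

Lemma harmonic_le_ln R (n : nat) : harmonic R n.+1 <= 1 + ln n.+1%:R.
Proof.
elim: n => [|n ih]; first by rewrite /harmonic big_ord1 ln1 invr1 addr0.
rewrite /harmonic big_ord_recr/= -/(harmonic R n.+1); apply: le_trans (lerD ih (lexx _)) _.
rewrite -addrA lerD2l -lerBrDl.
have n1 : 0 < n.+1%:R :> R by [].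
have n2 : 0 < n.+2%:R :> R by [].
have i2 : 0 < n.+2%:R^-1 :> R by rewrite invr_gt0.
have i1 : n.+2%:R^-1 < 1 :> R by rewrite invf_lt1// ltr1n.
have e : n.+1%:R = n.+2%:R * (1 + - n.+2%:R^-1) :> R.
  by rewrite mulrDr mulr1 mulrN mulfV// -(@natr1 R n.+1) addrK.
rewrite lerBrDl e lnM ?posrE ?subr_gt0//.
have : ln (1 + - n.+2%:R^-1) <= - n.+2%:R^-1 :> R by apply: le_ln1Dx; rewrite ltrN2.
by set x := ln (1 + _); set y := ln _; move: x y (_^-1) => x y z; clear; lra.
Qed.

Lemma harmonic_le_powR R (d : R) (n : nat) : 0 < d -> (0 < n)%N ->
  harmonic R n <= (1 + d^-1) * n%:R `^ d.
Proof.
move=> d0; case: n => // n _; apply: le_trans (harmonic_le_ln R n) _.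
have n1 : 1 <= n.+1%:R :> R by rewrite ler1n.
have p1 : 1 <= n.+1%:R `^ d :> R by apply: powR_ge1 => //; exact: ltW.
have := ln_sublinear (lt_le_trans ltr01 p1); rewrite ln_powR => /ltW h.
rewrite mulrDl mul1r; apply: lerD => //.
by rewrite mulrC ler_pdivlMr// mulrC.
Qed.

Lemma harmonic_side_sq R (c eps : R) : 1 < c -> 0 < eps ->
  exists2 C : R, 0 < C & forall lam, (1 <= lam)%N ->
  harmonic R (side c lam) ^+ 2 <= C * unitscale c lam `^ (5 * c * eps).
Proof.
(* The side is of the order of q ^ 5, and 5 * (2 * d) = 5 * c * eps. *)
move=> c1 e0; pose d := c * eps / 2.
have d0 : 0 < d by rewrite /d divr_gt0// mulr_gt0//; lra.
have D0 : 0 < 1 + d^-1 by rewrite addr_gt0// invr_gt0.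
exists ((1 + d^-1) ^+ 2 * 3 `^ (d * 2)) => [|lam l1].
  by apply: mulr_gt0; [exact: exprn_gt0|exact: powR_gt0].
have /andP[s0 s1] := side_bounds c1 l1; have q1 := unitscale_ge1 c1 l1.
set q := unitscale c lam in s0 s1 q1 *.
have M0 : (0 < side c lam)%N by [].
apply: (@le_trans _ _ (((1 + d^-1) * (side c lam)%:R `^ d) ^+ 2)).
  apply: lerXn2r; rewrite ?nnegrE ?harmonic_ge0//; last exact: harmonic_le_powR.
  by apply: mulr_ge0; [exact: ltW|exact: powR_ge0].
rewrite exprMn -[leRHS]mulrA; apply: ler_wpM2l; first exact: sqr_ge0.
rewrite -(@powR_mulrn _ (_ `^ d)) ?powR_ge0// -powRrM.
apply: (@le_trans _ _ ((3 * q `^ 5) `^ (d * 2))).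
  by apply: ler_powR_base => //; rewrite mulr_ge0// ltW.
rewrite (powRM _ (ler0n R 3) (powR_ge0 q 5)) -powRrM.
by rewrite (_ : 5 * (d * 2) = 5 * c * eps)// /d; field.
Qed.

(** For a <= 10, the discrepancy is (N a - |V a|) - nu a * (N - |V|). For a > 10
    the cap contains neither points of the c-sphere nor scaled lattice points. *)
Lemma discrepancy_at_bound R (c : R) : 1 < c < 9 / 8 ->
  exists2 C : R, 0 < C &
  forall (mu : {measure set (space3 R) -> \bar R}) (lam : nat) (xi : space3 R) (a : R),
  is_polar_measure c mu -> (1 <= lam)%N -> unit_sphere xi -> 0 < a ->
  `|discrepancy_at c mu lam xi a| <=
  C * harmonic R (side c lam) ^+ 2 * unitscale c lam `^ (6 + 3 * c).
Proof.
move=> c12; have /andP[c1 c2] := c12; have c0 : 0 < c by lra.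
have [C C0 HC] := half_lattice_discrepancy c12.
exists (2 * C) => [|mu lam xi a hmu l1 xi1 a0]; first by lra.
rewrite /discrepancy_at card_solid_cap//.
set E := harmonic R (side c lam) ^+ 2 * unitscale c lam `^ (6 + 3 * c).
have CE (x : R) : x * harmonic R (side c lam) ^+ 2 * unitscale c lam `^ (6 + 3 * c) = x * E.
  by rewrite /E mulrA.
rewrite CE; have E0 : 0 <= E.
  by apply: mulr_ge0; [exact: sqr_ge0|exact: powR_ge0].
have [a10|a10] := leP a 10; last first.
  rewrite half_lattice_empty ?(ltW a10)//.
  have -> : cap c a xi = set0.
    rewrite -subset0 => x [xs ax]; have := dot3_cnorm x c0 xi1.
    by rewrite xs mulr1 ler_norml => /andP[_ h]; have := le_trans ax h; lra.
  rewrite fset_set0 cardfs0 /nuc measure0/= mul0r mulr0 subr0 normr0.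
  by apply: mulr_ge0 => //; lra.
have na : `|a| <= 10 by rewrite gtr0_norm.
have n10 : `|- 10 : R| <= 10 by rewrite normrN ger0_norm.
have := HC lam xi a l1 xi1 na; rewrite CE.
have := HC lam xi (- 10) l1 xi1 n10; rewrite CE half_lattice_full//.
have [/andP[nu0 nu1] nuE] := nuc_volume a c0 l1 xi1 hmu.
rewrite -nuE /rc; clear CE.
move: (nuc _ _ _) E (fine _) nu0 nu1 E0.
set r : R := (#|` fset_set (S3 c lam)|%fset)%:R.
set n : R := (#|` fset_set (half_lattice _ _ _ _)|%fset)%:R.
move: n r => n r nu E V; clear -C0 => nu0 nu1 E0 h1 h2.
have -> : n - r * nu = (n - nu * V) - nu * (r - V) by ring.
apply: le_trans (ler_normB _ _) _; rewrite normrM (ger0_norm nu0).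
have : nu * `|r - V| <= 1 * (C * E) by apply: ler_pM.
lra.
Qed.

Theorem theorem1p9 (R : realType) (c : R) (hc : 1 < c < 9 / 8)
    (eps : R) (heps : 0 < eps) :
  exists C : R, 0 < C /\
    forall mu : {measure set (space3 R) -> \bar R}, is_polar_measure c mu ->
    forall (lam : nat) (xi : space3 R), (1 <= lam)%N -> unit_sphere xi ->
      (discrepancy c mu lam xi <=
        (C * lam%:R `^ (3 / c - 1 - (9 - 8 * c) / (5 * c) + eps))%:E)%E.
Proof.
move: (hc) => /andP[c1 c2]; have c0 : c != 0 by rewrite gt_eqF//; lra.
have [C1 C10 H1] := discrepancy_at_bound hc.
have [C2 C20 H2] := harmonic_side_sq c1 heps.
exists (C1 * C2); split; first exact: mulr_gt0.
move=> mu hmu lam xi l1 xi1.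
apply: ge_ereal_sup => _ [a a0 <-]; rewrite lee_fin.
apply: le_trans (H1 mu lam xi a hmu l1 xi1 a0) _.
rewrite (unitscaleE _ lam c0).
have -> : 5 * c * (3 / c - 1 - (9 - 8 * c) / (5 * c) + eps) = 5 * c * eps + (6 + 3 * c) by field.
have q0 : 0 < unitscale c lam by apply: lt_le_trans (unitscale_ge1 c1 l1).
rewrite [in leRHS]powRD; last by rewrite (gt_eqF q0) implybT.
rewrite [leRHS]mulrA; apply: ler_wpM2r; first exact: powR_ge0.
by rewrite -[leRHS]mulrA; apply: ler_wpM2l; [exact: ltW|exact: H2].
Qed.
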